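(* Let $M$ be a compact connected boundaryless manifold of finite dimension and let $f:M\to M$ be a diffeomorphism of class $C^r$, $r\ge 1$. Suppose $f=f_a$ is a member of a parameterized family $(f_t)_{t\in B^n}$ under parametric noise of level $\epsilon>0$ around $a$ (see context), and suppose there are $K\in\mathbb N$ and $\xi_0>0$ such that for all $k\ge K$ and all $x\in M$: A) $f^k(x,\Delta)\supset B(f_a^k(x),\xi_0)$; B) $f^k(x,\nu^\infty)\ll m$. Then there is a finite number of probability measures $\mu_1,\dots,\mu_l$ on $M$ such that: 1. $\mu_1,\dots,\mu_l$ are physical absolutely continuous probability measures; 2. $\operatorname{supp}\mu_i\cap\operatorname{supp}\mu_j=\emptyset$ for all $1\le i<j\le l$; 3. for every $x\in M$ there are open sets $V_1=V_1(x),\dots,V_l=V_l(x)\subset\Delta$ such that (a) $V_i\cap V_j=\emptyset$ for $1\le i<j\le l$; (b) $\nu^\infty(\Delta\setminus(V_1\cup\dots\cup V_l))=0$; (c) for all $1\le i\le l$ and $\nu^\infty$-a.e. $\underline t\in V_i$, $$\lim_{n\to\infty}\frac1n\sum_{j=0}^{n-1}\varphi(f^j(x,\underline t))=\int\varphi\,d\mu_i\quad\text{for every }\varphi\in C(M,\mathbb R).$$ Moreover, the sets $V_1(x),\dots,V_l(x)$ depend continuously on $x\in M$ with respect to the distance $d_\nu(A,B)=\nu^\infty(A\triangle B)$ between subsets of $\Delta$ modulo $\nu^\infty$-null sets.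
   Context: $M$ carries a fixed Riemannian distance $d_M$ and a normalized Riemannian volume $m$ ($m(M)=1$); absolute continuity is with respect to $m$; $B(x,\xi)$ is the ball of radius $\xi$ about $x$. Parametric noise: $B^n$ is the open unit ball of $\mathbb R^n$, $n\ge1$; $f:M\times B^n\to M$ is a $C^1$ map such that $f_t=f(\cdot,t)$ is a diffeomorphism of $M$ for each $t\in B^n$. Fix $a\in B^n$ and $\epsilon>0$ such that the closed Euclidean ball $T=\overline B^n(a,\epsilon)$ is contained in $B^n$. The noise of level $\epsilon$ around $f_a$ is the family $\{f_t:t\in T\}$. Put $\Delta=T^{\mathbb N}$ (product topology), $\nu$ = normalized Lebesgue measure on $T$, $\nu^\infty=\nu^{\mathbb N}$ the product probability on $\Delta$. For $\underline t=(t_j)_{j\ge1}\in\Delta$, $f^0(z,\underline t)=z$ and $f^k(z,\underline t)=f_{t_k}\circ\dots\circ f_{t_1}(z)$; $f^k(x,\Delta)=\{f^k(x,\underline t):\underline t\in\Delta\}$; $f^k(x,\nu^\infty)$ is the push-forward of $\nu^\infty$ under $\underline t\mapsto f^k(x,\underline t)$. $f_a^k$ is the $k$-th iterate of $f_a$. A probability $\mu$ on $M$ is stationary if $\int\int\varphi(f_t(z))\,d\mu(z)\,d\nu(t)=\int\varphi\,d\mu$ for all $\varphi\in C^0(M)$; equivalently $\mu\times\nu^\infty$ is invariant under $S:M\times\Delta\to M\times\Delta$, $S(z,\underline t)=(f_{t_1}(z),\sigma\underline t)$, $\sigma$ the left shift. It is stationary ergodic if moreover $\mu\times\nu^\infty$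 is $S$-ergodic. For $\mu$ stationary ergodic, its ergodic basin $E(\mu)$ is the set of $x\in M$ such that for $\nu^\infty$-a.e. $\underline t$, $\frac1n\sum_{j=0}^{n-1}\varphi(f^j(x,\underline t))\to\int\varphi\,d\mu$ for every continuous $\varphi:M\to\mathbb R$. A physical measure is a stationary ergodic probability $\mu$ with $m(E(\mu))>0$. *)

(* Defs.v *)
From HB Require Import structures.
From mathcomp Require Import all_boot all_order all_algebra.
From mathcomp Require Import all_classical all_reals all_analysis.

Set Implicit Arguments.
Unset Strict Implicit.
Unset Printing Implicit Defensive.

Import Order.TTheory GRing.Theory Num.Theory.
Import numFieldNormedType.Exports.

Local Open Scope classical_set_scope.
Local Open Scope ring_scope.

(* Measurable types are pointed in the library, whence this join; it only     *)
(* adds the nonemptiness of the metric space.                                 *)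
#[short(type="pmetricType")]
HB.structure Definition PointedMetric (R : numDomainType) :=
  { M of Metric R M & Pointed M }.

Notation borel X := (g_sigma_algebraType (@open X)).

Section EuclideanSpace.
Context {R : realType}.

(* The canonical norm on 'rV[R]_n in the library is the sup norm. *)
Definition enorm n (v : 'rV[R]_n) : R := Num.sqrt (\sum_(i < n) v 0 i ^+ 2).

Definition oball1 n : set 'rV[R]_n := [set t | enorm t < 1].

Definition cball n (a : 'rV[R]_n) (eps : R) : set 'rV[R]_n :=
  [set t | enorm (t - a) <= eps].

(* n-dimensional Lebesgue measure on Borel sets, as an iterated product of    *)
(* the one-dimensional one along 'rV_n.+1 = 'rV_1 * 'rV_n. It is only a set   *)
(* function here, and is meant to be evaluated on Borel sets.                 *)
Fixpoint lebesgue_rV n : set (borel 'rV[R]_n) -> \bar R :=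
  match n with
  | 0 => @dirac _ (borel 'rV[R]_0) (0 : 'rV[R]_0) R
  | n'.+1 => fun A => (lebesgue_measure \x @lebesgue_rV n')%E
      [set xv | A (row_mx (xv.1)%:M xv.2)]
  end.

(* F is of class C^k on the open set U: iterated partial derivatives up to    *)
(* order k exist and are continuous.                                          *)
Fixpoint Ck k p q (U : set 'rV[R]_p) (F : 'rV[R]_p -> 'rV[R]_q) : Prop :=
  (forall u, U u -> {for u, continuous F}) /\
  match k with
  | 0 => True
  | k'.+1 => forall i : 'I_p,
      (forall u, U u -> derivable F u (delta_mx 0 i)) /\
      Ck k' U (fun u => 'D_(delta_mx 0 i) F u)
  end.

(* r = None stands for C^oo. *)
Definition Cr (r : option nat) p q U (F : 'rV[R]_p -> 'rV[R]_q) : Prop :=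
  if r is Some k then Ck k U F else forall k, Ck k U F.

End EuclideanSpace.

Section Manifold.
Context {R : realType}.

Record chart (M : topologicalType) (d : nat) := Chart {
  cdom : set M ;
  cmap : M -> 'rV[R]_d ;
  cinv : 'rV[R]_d -> M }.

Definition cimg (M : topologicalType) d (c : chart M d) : set 'rV[R]_d :=
  cmap c @` cdom c.

(* cmap restricts to a homeomorphism between the open sets cdom and cimg;     *)
(* outside of these sets cmap and cinv are unconstrained.                     *)
Definition is_chart (M : topologicalType) d (c : chart M d) : Prop :=
  [/\ open (cdom c), open (cimg c),
      forall x, cdom c x -> {for x, continuous (cmap c)},
      forall u, cimg c u -> {for u, continuous (cinv c)} &
      forall x, cdom c x -> cinv c (cmap c x) = x].

Definition overlap (M : topologicalType) d (c c' : chart M d) : set 'rV[R]_d :=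
  [set u | cimg c u /\ cdom c' (cinv c u)].

Definition transition (M : topologicalType) d (c c' : chart M d) :=
  cmap c' \o cinv c.

Record manifold (M : topologicalType) (d : nat) := Manifold {
  atlas : set (chart M d) ;
  atlas_chart : forall c, atlas c -> is_chart c ;
  atlas_cover : forall x, exists2 c, atlas c & cdom c x ;
  atlas_smooth : forall c c', atlas c -> atlas c' ->
    Cr None (overlap c c') (transition c c') }.

(* Tangent vectors are row vectors, so that 'D_v F u = v *m 'J F u.           *)
Record riemannian (M : topologicalType) d (X : manifold M d) := Riemannian {
  rmx : chart M d -> 'rV[R]_d -> 'M[R]_d ;
  rmx_sym : forall c u, atlas X c -> cimg c u -> (rmx c u)^T = rmx c u ;
  rmx_pos : forall c u (v : 'rV[R]_d), atlas X c -> cimg c u -> v != 0 ->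
    0 < (v *m rmx c u *m v^T) 0 0 ;
  rmx_smooth : forall c, atlas X c ->
    Cr None (cimg c) (fun u => mxvec (rmx c u)) ;
  rmx_change : forall c c' u, atlas X c -> atlas X c' -> overlap c c' u ->
    rmx c u = 'J (transition c c') u *m rmx c' (transition c c' u)
              *m ('J (transition c c') u)^T }.

(* Lengths of the piecewise C^1 curves joining two points. Such a curve is    *)
(* cut into pieces each of which is a C^1 curve inside a single chart; a C^1  *)
(* curve on [0, 1] is given through a C^1 extension to the whole line.        *)
Inductive curve_length (M : topologicalType) d (X : manifold M d)
    (g : riemannian X) : M -> M -> R -> Prop :=
| curve_seg (c : chart M d) (gam : R -> 'rV[R]_d) :
    atlas X c ->
    (forall t, derivable gam t 1) -> continuous (gam^`())%classic ->
    (forall t, t \in `[0, 1] -> cimg c (gam t)) ->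
    curve_length g (cinv c (gam 0)) (cinv c (gam 1))
      (\int[lebesgue_measure]_(t in `[0, 1])
         Num.sqrt ((gam^`()%classic t *m rmx g c (gam t)
                      *m (gam^`()%classic t)^T) 0 0))%R
| curve_cat x y z L1 L2 :
    curve_length g x y L1 -> curve_length g y z L2 ->
    curve_length g x z (L1 + L2).

(* M carries its topology through mdist, so this also records that the        *)
(* Riemannian distance induces the topology of the manifold.                  *)
Definition is_riemannian_distance (M : pmetricType R) d (X : manifold M d)
    (g : riemannian X) : Prop :=
  forall x y : M, mdist x y = inf [set L | curve_length g x y L].

(* m is the Riemannian volume up to a positive constant; together with        *)
(* m(M) = 1 this determines m.                                                *)
Definition is_normalized_volume (M : pmetricType R) d (X : manifold M d)
    (g : riemannian X) (m : probability (borel M) R) : Prop :=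
  exists2 k : R, 0 < k &
    forall c (A : set (borel M)), atlas X c -> measurable A -> A `<=` cdom c ->
      m A = (k%:E * \int[@lebesgue_rV R d]_(u in cmap c @` A)
                       (Num.sqrt (\det (rmx g c u)))%:E)%E.

Definition Cr_map r (M : topologicalType) d (X : manifold M d) (h : M -> M) :=
  continuous h /\
  forall c c', atlas X c -> atlas X c' ->
    Cr r [set u | cimg c u /\ cdom c' (h (cinv c u))]
         (fun u => cmap c' (h (cinv c u))).

Definition diffeo r (M : topologicalType) d (X : manifold M d) (h : M -> M) :=
  exists k : M -> M,
    [/\ cancel h k, cancel k h, Cr_map r X h & Cr_map r X k].

(* f restricted to M x B^n is of class C^1; M x B^n is read in the product    *)
(* charts (x, t) |-> row_mx (cmap c x) t.                                     *)
Definition C1_family (M : topologicalType) d (X : manifold M d) n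
    (f : M -> 'rV[R]_n -> M) : Prop :=
  (forall x t, oball1 t ->
    {for (x, t), continuous (fun p : M * 'rV[R]_n => f p.1 p.2)}) /\
  forall c c', atlas X c -> atlas X c' ->
    Ck 1 [set w : 'rV[R]_(d + n) |
            [/\ cimg c (lsubmx w), oball1 (rsubmx w) &
                cdom c' (f (cinv c (lsubmx w)) (rsubmx w))]]
         (fun w => cmap c' (f (cinv c (lsubmx w)) (rsubmx w))).

End Manifold.

Section Noise.
Context {R : realType} {n : nat} (a : 'rV[R]_n) (eps : {posnum R}).

Definition noise : Type := set_type (cball a eps%:num).

Fact cball_center : a \in cball a eps%:num.
Proof.
rewrite inE /cball /enorm /= subrr big1 ?sqrtr0// => i _.
by rewrite mxE expr0n.
Qed.

HB.instance Definition _ := Topological.copy noise (set_type (cball a eps%:num)).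
HB.instance Definition _ := isPointed.Build noise (exist _ a cball_center).

Definition noise_seq : Type := {ptws nat -> noise}.
HB.instance Definition _ := Topological.copy noise_seq {ptws nat -> noise}.
HB.instance Definition _ := isPointed.Build noise_seq (fun=> point).

Definition is_normalized_lebesgue (nu : probability (borel noise) R) : Prop :=
  forall A : set (borel noise), measurable A ->
    nu A = ((fine (@lebesgue_rV R n (cball a eps%:num)))^-1%:E *
            @lebesgue_rV R n (set_val @` A))%E.

(* nuinf is the product probability nu^N: the unique probability on           *)
(* noise_seq with the following values on cylinders.                          *)
Definition is_product_probability (nu : probability (borel noise) R)
    (nuinf : probability (borel noise_seq) R) : Prop :=
  forall (k : nat) (A : nat -> set (borel noise)),
    (forall i, measurable (A i)) ->
    nuinf [set t | forall i, (i < k)%N -> A i (t i)] =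
    (\prod_(i < k) nu (A i))%E.

End Noise.

Section RandomMaps.
Context {R : realType} (M : pmetricType R) {n : nat} (f : M -> 'rV[R]_n -> M).
Context {a : 'rV[R]_n} {eps : {posnum R}}.
Local Notation T := (noise a eps).
Local Notation Delta := (noise_seq a eps).

(* Noise sequences are indexed from 0: t j is the (j + 1)-st noise t_{j+1}.   *)
Fixpoint rand_orbit (k : nat) (x : M) (t : Delta) : M :=
  if k is k'.+1 then f (rand_orbit k' x t) (set_val (t k')) else x.

Definition skew (p : borel M * borel Delta) : borel M * borel Delta :=
  (f p.1 (set_val (p.2 0%N)), fun j => p.2 j.+1).

Definition time_average (phi : M -> R) (x : M) (t : Delta) (k : nat) : R :=
  k%:R^-1 * \sum_(j < k) phi (rand_orbit j x t).

Definition averages_to (mu : probability (borel M) R) (x : M) (t : Delta) :=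
  forall phi : M -> R, continuous phi ->
    time_average phi x t @ \oo --> (\int[mu]_(z in setT) phi z)%R.

Definition stationary (nu : probability (borel T) R)
    (mu : probability (borel M) R) : Prop :=
  forall phi : M -> R, continuous phi ->
    (\int[nu]_t \int[mu]_z (phi (f z (set_val t)))%:E =
     \int[mu]_z (phi z)%:E)%E.

Definition stationary_ergodic (nu : probability (borel T) R)
    (nuinf : probability (borel Delta) R)
    (mu : probability (borel M) R) : Prop :=
  stationary nu mu /\
  forall A : set (borel M * borel Delta), measurable A -> skew @^-1` A = A ->
    ((mu \x nuinf) A = 0 \/ (mu \x nuinf) A = 1)%E.

Definition ergodic_basin (nuinf : probability (borel Delta) R)
    (mu : probability (borel M) R) : set (borel M) :=
  [set x | {ae nuinf, forall t, averages_to mu x t}].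

Definition physical (m : probability (borel M) R)
    (nu : probability (borel T) R) (nuinf : probability (borel Delta) R)
    (mu : probability (borel M) R) : Prop :=
  stationary_ergodic nu nuinf mu /\ (0 < m (ergodic_basin nuinf mu))%E.

Definition supp (mu : probability (borel M) R) : set M :=
  [set x | forall U : set M, open U -> U x -> (0 < mu U)%E].

End RandomMaps.

(* Main.v *)
(* By A) every closure of the set of points reachable from a given point
   contains a ball of radius xi0, so there are finitely many minimal closures
   C_i; they are pairwise disjoint, have nonempty interior, and every orbit can
   be steered into one of them. As the maps are open, the interior U_i of C_i is
   absorbing, and V_i(x) is the open set of noises which bring x into U_i.
   By B) the law of the K-th iterate from any point is absolutely continuous; a Baire
   argument gives an open piece of C_i on which these laws overlap uniformly.
   Since every point of C_i visits that piece with a probability bounded below,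
   a time average of the transition operator contracts oscillations on C_i, and
   its iterates converge to a unique measure mu_i, carried by C_i. Time averages
   along orbits are asymptotically unaffected by the transition operator (a
   square-summability law of large numbers), hence converge to the mu_i-mean.
   Ergodicity is a zero-one law: a section of an S-invariant set is independent
   of each finite part of the noise. Finally the measure of V_i(x) is lower
   semicontinuous in x, and the V_i(x) exhaust the noise space, which turns
   semicontinuity into continuity. *)
Require Import Defs.
From HB Require Import structures.
From mathcomp Require Import all_boot all_order all_algebra finmap.
From mathcomp Require Import all_classical all_reals all_analysis.
From mathcomp Require Import measurable_realfun ring lra zify.

Set Implicit Arguments.
Unset Strict Implicit.
Unset Printing Implicit Defensive.

Import Order.TTheory GRing.Theory Num.Theory.
Import numFieldNormedType.Exports.

Local Open Scope classical_set_scope.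
Local Open Scope ring_scope.

(** * Countable bases and Borel measurability *)

Section Bases.

(** Conclusion 3 concerns every starting point, whereas an ergodic theorem controls almost every
    one; so the measures are not obtained from weak compactness and Birkhoff's theorem. An averaged
    transition operator [Q] contracting oscillations on [C_i] serves twice. The iterates of [Q] on
    an indicator of [A] converge with an error at most [r^N], uniform in [A] and in the point of
    [C_i], and this uniformity makes the limit countably additive. And along the orbit of any point,
    [h] and [Q^N h] have the same asymptotic averages. The main obstacle is the overlap of laws.
    Absolute continuity gives each law a part comparable to [m], but this part may vary with the
    point in a discontinuous way. It is replaced by a finite union of basic open sets, which leaves
    countably many candidates, and domination is tested on closed sets, which makes it a closed
    condition on the point; then Baire's theorem applies. Countable bases enter because products
    such as [M x Delta] carry product sigma-algebras, for which continuous maps have to be shown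
    measurable. *)

Definition is_base (X : topologicalType) (I : Type) (B : I -> set X) :=
  (forall j, open (B j)) /\
  forall x U, nbhs x U -> exists2 j, B j x & B j `<=` U.

Lemma second_countable_base (X : ptopologicalType) :
  @second_countable X -> exists B : nat -> set X, is_base B.
Proof.
move=> [S cS [oS bS]].
have S0 : S !=set0.
  have /(_ setT filterT) [U [SU _] _] := bS point.
  by exists U.
have /pfcard_geP[S0'|[h]] := cS.
  by move: S0; rewrite S0' => -[].
exists h; split=> [j|x U /bS[V [SV Vx] VU]]; first exact/oS/funS.
by have [j _ hj] := @surj _ _ _ _ h V SV; exists j; rewrite hj.
Qed.

(** The sets containing such a cylinder form a filter. The product topology is a supremum of initial
    topologies, so convergence of this filter to [t] can be tested one coordinate at a time. *)
Lemma nbhs_cylinder (X : topologicalType) (t : {ptws nat -> X})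
    (U : set {ptws nat -> X}) :
  nbhs t U -> exists k (A : nat -> set X),
    (forall i, nbhs (t i) (A i)) /\
    [set s | forall i, (i < k)%N -> A i (s i)] `<=` U.
Proof.
pose F := [set V : set {ptws nat -> X} | exists k (A : nat -> set X),
    (forall i, nbhs (t i) (A i)) /\
    [set s | forall i, (i < k)%N -> A i (s i)] `<=` V].
have FF : Filter F.
  split.
  - by exists 0%N, (fun=> setT); split=> // i; exact: filterT.
  - move=> V W [k [A [nA AV]]] [l [B [nB BW]]].
    exists (maxn k l), (fun i => A i `&` B i); split=> [i|s sAB].
      exact: filterI.
    by split; [apply: AV|apply: BW] => i ik; have [] := sAB i _;
      rewrite ?leq_max ?ik ?orbT.
  - by move=> V W VW [k [A [nA AV]]]; exists k, A; split=> //; exact: subset_trans VW.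
suff : (F : set_system {ptws nat -> X}) --> t by apply.
apply/cvg_sup => i V [_ [[B oB <-] Bti] BV].
exists i.+1, (fun j => if j == i then B else setT); split=> [j|s sB].
  by case: eqP => [->|_]; [exact: open_nbhs_nbhs|exact: filterT].
by apply: BV; have := sB i (ltnSn i); rewrite eqxx.
Qed.

(** The radius is below [e / 2] and the rational center is within half a radius of [x], so that [x]
    lies in the interior of the ball and not merely in the ball. *)
Lemma is_base_rV (R : realType) n :
  is_base (fun p : 'rV[rat]_n * nat =>
    (ball (map_mx ratr p.1 : 'rV[R]_n) p.2.+1%:R^-1)°).
Proof.
split=> [p|x U /nbhs_ballP[e /= e0 xU]]; first exact: open_interior.
have e20 : 0 < e / 2 by rewrite divr_gt0.
have [k] := ltr_add_invr e20; rewrite add0r => ke.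
have /choice[q xq] : forall i, exists q : rat, `|x 0 i - ratr q| < k.+1%:R^-1 / 2.
  have k0 : 0 < k.+1%:R^-1 / 2 :> R by rewrite divr_gt0.
  move=> i; have [|q] := @rat_in_itvoo R (x 0 i) (x 0 i + k.+1%:R^-1 / 2).
    by rewrite ltrDl.
  by rewrite in_itv/= => /andP[xq qx]; exists q; rewrite ltr_distlC qx andbT (lt_trans _ xq)// gtrDl oppr_lt0.
exists (\row_i q i, k).
  apply/nbhs_ballP; exists (k.+1%:R^-1 / 2) => [|y xy] /=; first by rewrite divr_gt0.
  rewrite [_^-1]splitr; apply: ball_triangle xy; split=> [|i j].
    by rewrite divr_gt0.
  by rewrite !mxE ord1 /ball/= distrC xq.
move=> y /interior_subset qy; apply: xU.
rewrite (splitr e); apply: ball_triangle (le_ball (ltW ke) qy).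
have kk : k.+1%:R^-1 / 2 <= e / 2.
  by rewrite ler_pM2r// (le_trans (ltW ke))// ler_pdivrMr// ler_pMr// ler1n.
apply: le_ball kk _ _; split=> [|i j]; first by rewrite divr_gt0.
by rewrite !mxE ord1 /ball/=.
Qed.

Lemma is_base_initial (S : choiceType) (X : topologicalType) (f : S -> X) I
    (B : I -> set X) :
  is_base B ->
  @is_base (initial_topology f) I (fun j => f @^-1` B j).
Proof.
move=> [oB nB]; split=> [j|x U [_ [[V oV <-] Vx] VU]]; first by exists (B j).
have [j Bx BV] := nB (f x) V (open_nbhs_nbhs (conj oV Vx)).
by exists j => // y /BV /VU.
Qed.

(** Words over a countable type are countable, so indexing by words keeps the base of the product
    countable. The default [j0] is never read. *)
Definition cylinder (X I : Type) (j0 : I) (B : I -> set X) (s : seq I) :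
    set (nat -> X) :=
  [set t | forall i, (i < size s)%N -> B (nth j0 s i) (t i)].

Lemma is_base_ptws (X : topologicalType) I (j0 : I) (B : I -> set X) :
  is_base B ->
  @is_base {ptws nat -> X} (seq I) (cylinder j0 B).
Proof.
move=> [oB nB]; split=> [s|t U /nbhs_cylinder[k [A [nA AU]]]].
  rewrite openE => t st.
  have := @filter_forall {ptws nat -> X} 'I_(size s)
    (fun i u => B (nth j0 s i) (u (val i))) (nbhs (t : {ptws nat -> X})) (nbhs_filter _).
  suff tB (i : 'I_(size s)) : \forall u \near (t : {ptws nat -> X}),
      B (nth j0 s i) (u (val i)).
    by move=> /(_ tB); apply: filterS => u su i si; exact: (su (Ordinal si)).
  apply: (@proj_continuous nat (fun=> X) (val i) t).
  by apply: open_nbhs_nbhs; split=> //; exact: st.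
have /choice[h hP] i : exists j, B j (t i) /\ B j `<=` A i.
  by have [j ? ?] := nB _ _ (nA i); exists j.
exists (mkseq h k) => [i|u su].
  by rewrite size_mkseq => ik; rewrite nth_mkseq//; exact: (hP i).1.
apply: AU => i ik; apply: (hP i).2.
by have := su i; rewrite size_mkseq nth_mkseq//; exact.
Qed.

Lemma is_base_prod (X Y : topologicalType) I J (B : I -> set X) (C : J -> set Y) :
  is_base B -> is_base C ->
  @is_base (X * Y)%type (I * J) (fun p => B p.1 `*` C p.2).
Proof.
move=> [oB nB] [oC nC]; split=> [p|[x y] U [[V W] /= [Vx Wy] VWU]].
  rewrite openE => -[x y] [/= Bx Cy].
  by exists (B p.1, C p.2) => //=; split; apply: open_nbhs_nbhs; split=> //.
have [i Bx BV] := nB _ _ Vx; have [j Cy CW] := nC _ _ Wy.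
by exists (i, j) => //= -[u v] [/= /BV Vu /CW Wv]; exact: (VWU (u, v)).
Qed.

Lemma open_bigcup_base (X : topologicalType) I (B : I -> set X) U :
  is_base B -> open U -> U = \bigcup_(j in [set j | B j `<=` U]) B j.
Proof.
move=> [_ nB] oU; apply/seteqP; split=> [x Ux|x [j jU /jU//]].
have [j Bx BU] := nB x U (open_nbhs_nbhs (conj oU Ux)).
by exists j.
Qed.

Lemma open_base_measurable d (T : measurableType d) (X : topologicalType)
    (I : countType) (B : I -> set X) (f : T -> X) U :
  is_base B -> (forall j, measurable (f @^-1` B j)) -> open U ->
  measurable (f @^-1` U).
Proof.
move=> bB mB oU; rewrite (open_bigcup_base bB oU) preimage_bigcup.
rewrite bigcup_mkcond; apply: countable_bigcupT_measurable => // j.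
by case: ifP => // _; exact: mB.
Qed.

Lemma borel_measurable_fun d (T : measurableType d) (X : ptopologicalType)
    (f : T -> borel X) :
  (forall U : set X, open U -> measurable (f @^-1` U)) -> measurable_fun setT f.
Proof.
move=> mf; apply: (@measurability _ _ T (borel X) setT f (@open X)) => // _ [U oU <-].
by rewrite setTI; exact: mf.
Qed.

Lemma continuous_borel_measurable (X Y : ptopologicalType) (f : X -> Y) :
  continuous f -> measurable_fun setT (f : borel X -> borel Y).
Proof.
move=> /continuousP cf; apply: borel_measurable_fun => U /cf oU.
exact: sub_sigma_algebra.
Qed.

(** The domain carries the product of the Borel sigma-algebras, which for general spaces can be
    smaller than the Borel sigma-algebra of the product. Countable bases make each open set a
    countable union of open rectangles. *)
Lemma continuous_prod_borel_measurable (X Y Z : ptopologicalType) (I J : countType)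
    (B : I -> set X) (C : J -> set Y) (f : X * Y -> Z) :
  is_base B -> is_base C -> continuous f ->
  measurable_fun setT (f : borel X * borel Y -> borel Z).
Proof.
move=> bB bC /continuousP cf; apply: borel_measurable_fun => U /cf oU.
apply: (@open_base_measurable _ (borel X * borel Y)%type (X * Y)%type (I * J)%type
  _ (fun p => p) _ (is_base_prod bB bC) _ oU) => -[i j] /=.
apply: (@measurableX _ _ (borel X) (borel Y) (B i) (C j));
  apply: sub_sigma_algebra; [exact: bB.1|exact: bC.1].
Qed.

End Bases.

(** * Integration of bounded measurable functions *)

Section BoundedMeasurable.
Context {R : realType} {d : measure_display} {T : measurableType d}.
Implicit Types h g : T -> R.

Definition bmeas h := measurable_fun setT h /\ exists B, forall x, `|h x| <= B.

Lemma bmeas_cst (c : R) : bmeas (fun=> c).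
Proof. by split; [exact: measurable_cst|exists `|c|]. Qed.

Lemma bmeas_indic (A : set T) : measurable A -> bmeas \1_A.
Proof.
move=> mA; split; first exact: measurable_indic.
by exists 1 => x; rewrite indicE normr_nat lern1 leq_b1.
Qed.

Lemma bmeasD h g : bmeas h -> bmeas g -> bmeas (fun x => h x + g x).
Proof.
move=> [mh [B hB]] [mg [C gC]]; split; first exact: measurable_funD.
by exists (B + C) => x; rewrite (le_trans (ler_normD _ _))// lerD.
Qed.

Lemma bmeasM h g : bmeas h -> bmeas g -> bmeas (fun x => h x * g x).
Proof.
move=> [mh [B hB]] [mg [C gC]]; split; first exact: measurable_funM.
by exists (B * C) => x; rewrite normrM ler_pM.
Qed.

Lemma bmeasZ c h : bmeas h -> bmeas (fun x => c * h x).
Proof. exact/bmeasM/bmeas_cst. Qed.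

Lemma bmeasB h g : bmeas h -> bmeas g -> bmeas (fun x => h x - g x).
Proof.
move=> [mh [B hB]] [mg [C gC]]; split; first exact: measurable_funB.
by exists (B + C) => x; rewrite (le_trans (ler_normB _ _))// lerD.
Qed.

Lemma bmeas_sum (I : Type) (s : seq I) (F : I -> T -> R) :
  (forall i, bmeas (F i)) -> bmeas (fun x => \sum_(i <- s) F i x).
Proof.
move=> mF; elim: s => [|i s ih].
  by under eq_fun do rewrite big_nil; exact: bmeas_cst.
by under eq_fun do rewrite big_cons; exact: bmeasD.
Qed.

Section Integral.
Variable P : probability T R.

Lemma bmeas_integrable h : bmeas h -> P.-integrable setT (EFin \o h).
Proof.
move=> [mh [B hB]]; apply: measurable_bounded_integrable => //.
  by rewrite (le_lt_trans (probability_le1 _ _))// ltry.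
exists B; split; first exact: num_real.
by move=> M BM x _ /=; rewrite (le_trans (hB x))// ltW.
Qed.

Lemma bmeas_intE h : bmeas h -> (\int[P]_x (h x)%:E = (\int[P]_x h x)%R%:E)%E.
Proof. by move=> bh; rewrite fineK//; exact/integrable_fin_num/bmeas_integrable. Qed.

Lemma int_cst (c : R) : \int[P]_x c = c.
Proof. by rewrite Rintegral_cst// -[X in fine X]/(P setT) probability_setT mulr1. Qed.

Lemma int_indic (A : set T) : measurable A -> \int[P]_x \1_A x = fine (P A).
Proof. by move=> mA; rewrite /Rintegral integral_indic// setIT. Qed.

Lemma intD h g : bmeas h -> bmeas g ->
  \int[P]_x (h x + g x) = \int[P]_x h x + \int[P]_x g x.
Proof. by move=> bh bg; apply: RintegralD => //; exact: bmeas_integrable. Qed.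

Lemma intB h g : bmeas h -> bmeas g ->
  \int[P]_x (h x - g x) = \int[P]_x h x - \int[P]_x g x.
Proof. by move=> bh bg; apply: RintegralB => //; exact: bmeas_integrable. Qed.

Lemma intZ c h : bmeas h -> \int[P]_x (c * h x) = c * \int[P]_x h x.
Proof. by move=> bh; apply: RintegralZl => //; exact: bmeas_integrable. Qed.

Lemma int_sum (I : Type) (s : seq I) (F : I -> T -> R) :
  (forall i, bmeas (F i)) ->
  \int[P]_x (\sum_(i <- s) F i x) = \sum_(i <- s) \int[P]_x F i x.
Proof.
move=> mF; elim: s => [|i s ih].
  by under eq_Rintegral do rewrite big_nil; rewrite int_cst big_nil.
under eq_Rintegral do rewrite big_cons.
by rewrite intD// ?ih ?big_cons//; exact: bmeas_sum.
Qed.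

Lemma le_int h g : bmeas h -> bmeas g -> (forall x, h x <= g x) ->
  \int[P]_x h x <= \int[P]_x g x.
Proof. by move=> bh bg hg; apply: le_Rintegral => //; exact: bmeas_integrable. Qed.

Lemma int_le_cst h c : bmeas h -> (forall x, h x <= c) -> \int[P]_x h x <= c.
Proof.
by move=> bh hc; rewrite -[leRHS]int_cst; apply: le_int => //; exact: bmeas_cst.
Qed.

Lemma int_ge_cst h c : bmeas h -> (forall x, c <= h x) -> c <= \int[P]_x h x.
Proof.
by move=> bh hc; rewrite -[leLHS]int_cst; apply: le_int => //; exact: bmeas_cst.
Qed.

Lemma int_norm_le h B : bmeas h -> (forall x, `|h x| <= B) -> `|\int[P]_x h x| <= B.
Proof.
move=> bh hB; rewrite ler_norml; apply/andP; split.
  by apply: int_ge_cst => // x; have := hB x; rewrite ler_norml => /andP[].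
by apply: int_le_cst => // x; have := hB x; rewrite ler_norml => /andP[].
Qed.

End Integral.
End BoundedMeasurable.

Lemma bmeas_comp (R : realType) d d' (T : measurableType d) (U : measurableType d')
    (phi : T -> U) (h : U -> R) :
  measurable_fun setT phi -> bmeas h -> bmeas (h \o phi).
Proof.
by move=> mphi [mh [B hB]]; split; [exact: measurableT_comp|exists B => x; exact: hB].
Qed.

Lemma int_map (R : realType) d d' (T : measurableType d) (U : measurableType d')
    (P : probability T R) (Q : probability U R) (phi : T -> U) (h : U -> R) :
  measurable_fun setT phi ->
  (forall A, measurable A -> Q A = P (phi @^-1` A)) -> bmeas h ->
  \int[Q]_x h x = \int[P]_x h (phi x).
Proof.
move=> mphi QP bh; rewrite /Rintegral; congr fine.
have bhp := bmeas_comp mphi bh.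
transitivity (\int[pushforward P phi]_x (h x)%:E)%E.
  by apply: eq_measure_integral => A mA _; exact: QP.
rewrite (integral_pushforward mphi)//.
  by apply/measurable_EFinP; exact: bh.1.
exact: (bmeas_integrable P bhp).
Qed.

Section FubiniBounded.
Context {R : realType} {d1 d2 : measure_display}.
Context {T1 : measurableType d1} {T2 : measurableType d2}.
Variables (P1 : probability T1 R) (P2 : probability T2 R) (F : T1 * T2 -> R).
Hypothesis bF : bmeas F.

Lemma bmeas_prod1 x : bmeas (fun y => F (x, y)).
Proof. exact: (bmeas_comp (measurable_pair1 x) bF). Qed.

Lemma prod_integrable : (P1 \x P2)%E.-integrable setT (EFin \o F).
Proof.
move: bF => [mF [B FB]]; apply: measurable_bounded_integrable => //.
  rewrite -setXTT [ltLHS]product_measure1E//.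
  by rewrite [X in (X * _)%E]probability_setT [X in (_ * X)%E]probability_setT
    mule1 ltry.
exists B; split; first exact: num_real.
by move=> M BM x _ /=; rewrite (le_trans (FB x))// ltW.
Qed.

End FubiniBounded.

Section FubiniBounded2.
Context {R : realType} {d1 d2 : measure_display}.
Context {T1 : measurableType d1} {T2 : measurableType d2}.
Variables (P2 : probability T2 R) (F : T1 * T2 -> R).
Hypothesis bF : bmeas F.

Lemma bmeas_int1 : bmeas (fun x => \int[P2]_y F (x, y)).
Proof.
split; last first.
  move: (bF) => [_ [B FB]]; exists B => x.
  by apply: int_norm_le => // ; exact: (bmeas_prod1 bF).
apply: measurableT_comp => //.
(* The partial integral does not involve a measure on the first factor; a Dirac mass is supplied as
   a placeholder. *)
exact: (measurable_fubini_F (prod_integrable (dirac point) P2 bF)).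
Qed.

Lemma int_prod (P1 : probability T1 R) : (\int[(P1 \x P2)%E]_p F p = \int[P1]_x \int[P2]_y F (x, y))%R.
Proof.
rewrite /Rintegral -(integral12_prod_meas1 (prod_integrable P1 P2 bF)); congr fine.
apply: eq_integral => x _ /=; rewrite /fubini_F fineK//.
exact/integrable_fin_num/(bmeas_integrable P2 (bmeas_prod1 bF x)).
Qed.

End FubiniBounded2.

(** * Square-summable sequences and averages along squares *)

Section SquareSummable.
Context {R : realType} {d : measure_display} {T : measurableType d}.
Variable P : probability T R.

(** By monotone convergence the series of squares has integral at most [C]; it is therefore finite
    almost everywhere, and its terms tend to zero there. *)
Lemma ae_cvg0_square_summable (g : nat -> T -> R) (C : R) :
  (forall n, bmeas (g n)) ->
  (forall N, \sum_(n < N) \int[P]_x (g n x ^+ 2) <= C) ->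
  {ae P, forall x, g ^~ x @ \oo --> 0}.
Proof.
move=> bg gC.
have bg2 n : bmeas (fun x => g n x ^+ 2) by exact: bmeasM.
pose G x : \bar R := (\sum_(n <oo) (g n x ^+ 2)%:E)%E.
have mg2 n : measurable_fun setT (fun x => (g n x ^+ 2)%:E).
  by apply/measurable_EFinP; exact: (bg2 n).1.
have mG : measurable_fun setT G.
  by apply: ge0_emeasurable_sum => // n x _ _; rewrite lee_fin sqr_ge0.
have G0 x : (0 <= G x)%E by apply: nneseries_ge0 => n _ _; rewrite lee_fin sqr_ge0.
have iG : P.-integrable setT G.
  apply/integrableP; split=> //.
  under eq_integral do rewrite gee0_abs//.
  rewrite integral_nneseries//; last by move=> n x _; rewrite lee_fin sqr_ge0.
  apply: (@le_lt_trans _ _ C%:E); last exact: ltry.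
  apply: lime_le; first by apply: is_cvg_nneseries => n _ _; apply: integral_ge0 => x _; rewrite lee_fin sqr_ge0.
  near=> N; rewrite big_mkord.
  under eq_bigr do rewrite (bmeas_intE P (bg2 _)).
  by rewrite sumEFin lee_fin.
have := integrable_ae measurableT iG.
apply: filterS => x /(_ I) Gx.
suff cg2 : (fun n => g n x ^+ 2) @ \oo --> 0.
  apply/cvgrPdist_lt => e e0.
  have e20 : 0 < e ^+ 2 by rewrite exprn_gt0.
  move/cvgrPdist_lt : cg2 => /(_ _ e20); apply: filterS => n.
  by rewrite !sub0r !normrN normrX ltr_pXn2r ?nnegrE// ltW.
apply: cvg_series_cvg_0; apply: nondecreasing_is_cvgn.
  by apply: nondecreasing_series => n _ _; rewrite sqr_ge0.
exists (fine (G x)) => _ [N _ <-]; rewrite -lee_fin fineK//.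
rewrite /series/= -sumEFin.
by apply: nneseries_lim_ge => n _ _; rewrite lee_fin sqr_ge0.
Unshelve. all: by end_near. Qed.

End SquareSummable.

(** Induction on the telescoping bound [2 - 1/(N+1)], since [1/(N+2)^2] is at most
    [1/(N+1) - 1/(N+2)]. *)
Lemma sum_inv_square_le (R : realFieldType) N :
  \sum_(n < N) (n.+1%:R ^- 2 : R) <= 2.
Proof.
case: N => [|N]; first by rewrite big_ord0.
suff : \sum_(n < N.+1) (n.+1%:R ^- 2 : R) <= 2 - N.+1%:R^-1.
  by move/le_trans; apply; rewrite gerBl invr_ge0.
elim: N => [|N ih]; first by rewrite big_ord1 expr1n invr1; lra.
rewrite big_ord_recr/=; apply: le_trans (lerD ih (lexx _)) _.
have a0 : 0 < N.+1%:R :> R by rewrite ltr0n.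
have b0 : 0 < N.+2%:R^-1 :> R by rewrite invr_gt0 ltr0n.
have c0 : 0 < N.+1%:R^-1 :> R by rewrite invr_gt0.
have h : N.+1%:R^-1 - N.+2%:R^-1 = N.+1%:R^-1 * N.+2%:R^-1 :> R.
  by rewrite -[N.+2%:R]natr1; field; rewrite gt_eqF//= natr1 pnatr_eq0.
rewrite -exprVn; move: b0 c0 h.
set b := N.+2%:R^-1; set c := N.+1%:R^-1 => b0 c0 h.
have cb : 0 < c - b by rewrite h mulr_gt0.
nra.
Qed.

Lemma between_squares n : (0 < n)%N ->
  exists m, (m.+1 ^ 2 <= n < m.+2 ^ 2)%N.
Proof.
elim: n => // -[_ _|n /(_ isT)[m /andP[mn nm]] _]; first by exists 0%N.
have [nm'|nm'] := ltnP n.+2 (m.+2 ^ 2).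
  by exists m; rewrite nm' andbT (leq_trans mn).
exists m.+1; rewrite nm'/= (leq_ltn_trans nm)// ltn_exp2r//.
Qed.

(** A time between [(m+1)^2] and [(m+2)^2] exceeds the lower square by at most [3 (m+1)]. Over such
    a gap [s] moves by a multiple of [m+1], which is negligible against [n >= (m+1)^2]. *)
Lemma cvg_average_from_squares (R : realType) (s : nat -> R) (C : R) :
  (forall n, `|s n.+1 - s n| <= C) ->
  (fun m => m.+1%:R ^- 2 * s (m.+1 ^ 2)%N) @ \oo --> 0 ->
  (fun n => n%:R^-1 * s n) @ \oo --> 0.
Proof.
move=> sC s0.
have C0 : 0 <= C by rewrite (le_trans _ (sC 0%N)).
have sD n k : `|s (n + k)%N - s n| <= C * k%:R.
  elim: k => [|k ih]; first by rewrite addn0 subrr normr0 mulr0.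
  rewrite addnS -natr1 mulrDr mulr1 -(subrKA (s (n + k)%N)).
  by rewrite (le_trans (ler_normD _ _))// addrC lerD.
apply/cvgrPdist_le => e e0.
have e20 : 0 < e / 2 by rewrite divr_gt0.
have [M1 _ hM1] : \forall m \near \oo, `|m.+1%:R ^- 2 * s (m.+1 ^ 2)%N| <= e / 2.
  move/cvgrPdist_le : s0 => /(_ _ e20); apply: filterS => m.
  by rewrite sub0r normrN.
(* From this index on [6 C <= e (m+1)], so the drift [3 C (m+1)] since the last square is at most
   [(e / 2) (m+1)^2], hence at most [(e / 2) n]. *)
pose M := maxn M1 (Num.truncn (6 * C / e)).
exists (M.+1 ^ 2)%N => // n /= Mn.
have n0 : (0 < n)%N by rewrite (leq_trans _ Mn)// expn_gt0.
have [m /andP[mn nm]] := between_squares n0.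
have Mm : (M <= m)%N.
  by rewrite -2!ltnS -(@ltn_exp2r M.+1 m.+2 2)// (leq_ltn_trans Mn).
have nR0 : 0 < n%:R :> R by rewrite ltr0n.
rewrite sub0r normrN normrM ger0_norm ?invr_ge0// ler_pdivrMl//.
rewrite -[n in s n](subnKC mn) -(subrK (s (m.+1 ^ 2)%N) (s _)).
rewrite (le_trans (ler_normD _ _))// (splitr e) mulrDr addrC lerD//.
  have /hM1 : (M1 <= m)%N by rewrite (leq_trans _ Mm)// leq_maxl.
  rewrite normrM ger0_norm ?invr_ge0 ?exprn_ge0// ler_pdivrMl ?exprn_gt0//.
  move=> /le_trans; apply; rewrite ler_wpM2r// ?(ltW e20)//.
  by rewrite -natrX ler_nat.
apply: le_trans (sD _ _) _.
have mC : 6 * C <= e * m.+1%:R.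
  rewrite [e * _]mulrC -ler_pdivrMr//.
  apply: ltW; apply: lt_le_trans (truncnS_gt _) _.
  by rewrite ler_nat ltnS (leq_trans _ Mm)// leq_maxr.
have nm3 : (n - m.+1 ^ 2 <= 3 * m.+1)%N.
  by rewrite leq_subLR; apply: (leq_trans (ltnW nm)); nia.
apply: (@le_trans _ _ (C * (3 * m.+1)%:R)); first by rewrite ler_wpM2l// ler_nat.
apply: (@le_trans _ _ (e * m.+1%:R / 2 * m.+1%:R)).
  rewrite natrM mulrA ler_wpM2r//; lra.
have : m.+1%:R ^+ 2 <= n%:R :> R by rewrite -natrX ler_nat.
nra.
Qed.

(** * Random orbits and Markov operators *)

(* X k x t is the position at time k of the orbit of x under the noise t, and
   splice k (t, t') is the noise that follows t up to time k and t' afterwards. *)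
Record random_orbit (R : realType) dE dW (E : measurableType dE)
    (W : measurableType dW) (rho : probability W R)
    (X : nat -> E -> W -> E) (splice : nat -> W * W -> W) : Prop := RandomOrbit {
  orbit0 : forall x t, X 0%N x t = x ;
  orbit_measurable : forall k, measurable_fun setT (fun p : E * W => X k p.1 p.2) ;
  splice_measurable : forall k, measurable_fun setT (splice k) ;
  splice_preserving : forall k A, measurable A ->
    rho A = (rho \x rho)%E (splice k @^-1` A) ;
  orbit_splice_le : forall k j x t t', (j <= k)%N ->
    X j x (splice k (t, t')) = X j x t ;
  orbit_splice_add : forall k l x t t',
    X (k + l)%N x (splice k (t, t')) = X l (X k x t) t' }.

Section TransitionOperator.
Context (R : realType) dE dW (E : measurableType dE) (W : measurableType dW).
Context (rho : probability W R) (X : nat -> E -> W -> E).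
Context (splice : nat -> W * W -> W) (RO : random_orbit rho X splice).
Implicit Types h : E -> R.

(** The [k]-step transition operator of the Markov chain [X]. *)
Definition op k h (x : E) : R := \int[rho]_t h (X k x t).

(** The Markov property in the form used throughout: resampling the noise after time [k]
    independently of its past leaves expectations unchanged. *)
Lemma int_splice k (F : W -> R) : bmeas F ->
  \int[rho]_t F t = \int[rho]_t \int[rho]_t' F (splice k (t, t')).
Proof.
move=> bF; have mk := splice_measurable RO k.
rewrite -(int_prod rho (bmeas_comp mk bF)).
rewrite /Rintegral; congr fine.
have bF' := bmeas_comp mk bF.
transitivity (\int[pushforward (rho \x rho)%E (splice k)]_x (F x)%:E)%E.
  by apply: eq_measure_integral => A mA _; exact: (splice_preserving RO k).
rewrite (integral_pushforward mk)//.
  by apply/measurable_EFinP; exact: bF.1.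
exact: prod_integrable.
Qed.

Lemma bmeas_orbit k h x : bmeas h -> bmeas (fun t => h (X k x t)).
Proof.
move=> bh; have := bmeas_comp (orbit_measurable RO k) bh.
by move/bmeas_prod1; exact.
Qed.

Lemma bmeas_op k h : bmeas h -> bmeas (op k h).
Proof.
move=> bh; have := bmeas_comp (orbit_measurable RO k) bh.
exact: (bmeas_int1 rho).
Qed.

Lemma op_add k l h x : bmeas h -> op (k + l) h x = op k (op l h) x.
Proof.
move=> bh; rewrite /op (int_splice k); last exact: bmeas_orbit.
apply: eq_Rintegral => t _; apply: eq_Rintegral => t' _.
by rewrite (orbit_splice_add RO).
Qed.

Lemma op0 h : op 0 h = h.
Proof.
apply/funext => x; rewrite /op -[RHS](int_cst rho).
by apply: eq_Rintegral => t _; rewrite (orbit0 RO).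
Qed.

Lemma op_norm_le k h B x : bmeas h -> (forall x, `|h x| <= B) -> `|op k h x| <= B.
Proof. by move=> bh hB; apply: int_norm_le => //; exact: bmeas_orbit. Qed.

Section Increments.
Variables (h : E -> R) (x : E).
Hypothesis bh : bmeas h.

Let D j t := h (X j.+1 x t) - op 1 h (X j x t).

Let bD j : bmeas (D j).
Proof. by apply: bmeasB; apply: bmeas_orbit => //; exact: bmeas_op. Qed.

(* Given the noise up to time j, the increment D j has mean zero. *)
Let D_orthogonal i j : (i < j)%N -> \int[rho]_t (D i t * D j t) = 0.
Proof.
move=> ij; rewrite (int_splice j); last exact: bmeasM.
rewrite -[RHS](int_cst rho); apply: eq_Rintegral => t _.
transitivity (\int[rho]_t' (D i t * (h (X 1 (X j x t) t') - op 1 h (X j x t)))).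
  apply: eq_Rintegral => t' _; rewrite /D.
  rewrite [X i.+1 _ _](orbit_splice_le RO)// [X i _ _](orbit_splice_le RO) ?(ltnW ij)//.
  by rewrite [X j _ _](orbit_splice_le RO)// -(addn1 j) (orbit_splice_add RO).
rewrite intZ; last by apply: bmeasB; [exact: bmeas_orbit|exact: bmeas_cst].
rewrite intB ?int_cst ?subrr ?mulr0//; [exact: bmeas_orbit|exact: bmeas_cst].
Qed.

(** Orthogonality makes the second moment of a sum of [n] increments at most [n (2 B)^2]. At
    [n = (m+1)^2] the averages have second moments of order [1/(m+1)^2], which is summable;
    boundedness of the increments fills the gaps between squares. *)
Lemma ae_increment_average :
  {ae rho, forall t, (fun n => n%:R^-1 * \sum_(j < n) D j t) @ \oo --> 0}.
Proof.
have [mh [B hB]] := bh.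
have B0 : 0 <= B by rewrite (le_trans _ (hB x)).
have DB j t : `|D j t| <= 2 * B.
  rewrite (le_trans (ler_normB _ _))// mulrDl mul1r lerD//.
  by apply: op_norm_le => //; exact: hB.
have bS n : bmeas (fun t => \sum_(j < n) D j t) by apply: bmeas_sum => j; exact: bD.
have S2 n : \int[rho]_t (\sum_(j < n) D j t) ^+ 2 <= n%:R * (2 * B) ^+ 2.
  elim: n => [|n ih].
    under eq_Rintegral do rewrite big_ord0 expr0n/=.
    by rewrite int_cst mul0r.
  under eq_Rintegral => t _ do rewrite big_ord_recr/= sqrrD -mulr_natl addrAC.
  have bDn2 : bmeas (fun t => D n t ^+ 2) by exact: bmeasM.
  have bS2 : bmeas (fun t => (\sum_(j < n) D j t) ^+ 2) by exact: bmeasM.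
  have bSD : bmeas (fun t => (\sum_(j < n) D j t) * D n t) by exact: bmeasM.
  rewrite intD; [|exact: bmeasD|exact: bmeasZ].
  have SD0 : \int[rho]_t ((\sum_(j < n) D j t) * D n t) = 0.
    under eq_Rintegral do rewrite mulr_suml.
    rewrite int_sum; last by move=> j; exact: bmeasM.
    by apply: big1 => j _; exact: D_orthogonal.
  rewrite intZ// SD0 mulr0 addr0 intD// -natr1 mulrDl mul1r lerD//.
  apply: int_le_cst => // t.
  by rewrite -[D n t ^+ 2]real_normK ?num_real// lerXn2r ?nnegrE// mulr_ge0.
suff : {ae rho, forall t,
    (fun m => m.+1%:R ^- 2 * \sum_(j < m.+1 ^ 2) D j t) @ \oo --> 0}.
  apply: filterS => t; apply: (@cvg_average_from_squares _
    (fun n => \sum_(j < n) D j t) (2 * B)) => n.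
  by rewrite big_ord_recr/= addrAC subrr add0r.
apply: (@ae_cvg0_square_summable _ _ _ rho
  (fun m t => m.+1%:R ^- 2 * \sum_(j < m.+1 ^ 2) D j t) (2 * (2 * B) ^+ 2)).
  by move=> m; exact: bmeasZ.
move=> N; apply: (@le_trans _ _ (\sum_(n < N) n.+1%:R ^- 2 * (2 * B) ^+ 2)).
  apply: ler_sum => n _.
  under eq_Rintegral do rewrite exprMn.
  rewrite intZ; last exact: bmeasM.
  apply: le_trans (ler_wpM2l _ (S2 _)) _; first by rewrite exprn_ge0// invr_ge0 exprn_ge0.
  rewrite mulrA ler_wpM2r ?exprn_ge0 ?mulr_ge0// natrX.
  have : n.+1%:R != 0 :> R by rewrite pnatr_eq0.
  move: n.+1%:R => u u0; rewrite le_eqVlt; apply/orP; left; apply/eqP.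
  by field.
by rewrite -mulr_suml ler_wpM2r ?exprn_ge0 ?mulr_ge0//; exact: sum_inv_square_le.
Qed.

End Increments.

End TransitionOperator.

Lemma cvg_sumr (R : realType) (T I : Type) (F : set_system T) (r : seq I)
    (g : I -> T -> R) (l : I -> R) : Filter F ->
  (forall i, g i @ F --> l i) ->
  (fun x => \sum_(i <- r) g i x) @ F --> \sum_(i <- r) l i.
Proof.
move=> FF gl; elim: r => [|i r ih].
  by rewrite big_nil; under eq_fun do rewrite big_nil; exact: cvg_cst.
by rewrite big_cons; under eq_fun do rewrite big_cons; exact: cvgD.
Qed.

Lemma int_cvg (R : realType) d (T : measurableType d) (P : probability T R)
    (h_ : nat -> T -> R) (h : T -> R) (B : R) :
  (forall n, bmeas (h_ n)) -> bmeas h -> (forall n x, `|h_ n x| <= B) ->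
  (forall x, h_ ^~ x @ \oo --> h x) ->
  (fun n => \int[P]_x h_ n x) @ \oo --> \int[P]_x h x.
Proof.
move=> bh_ bh hB hh.
have [] := @dominated_convergence _ T R P setT measurableT
  (fun n => EFin \o h_ n) (EFin \o h) (cst B%:E).
- by move=> n; apply/measurable_EFinP; exact: (bh_ n).1.
- by apply/measurable_EFinP; exact: bh.1.
- by apply: aeW => x _; apply: cvg_EFin; [exact: nearW|exact: hh].
- exact: (bmeas_integrable P (bmeas_cst B)).
- by apply: aeW => x n _ /=; rewrite lee_fin.
by move=> _ _ hint; apply: fine_cvg; rewrite -bmeas_intE.
Qed.

Section MarkovOperators.
Context (R : realType) dE dW (E : measurableType dE) (W : measurableType dW).
Context (rho : probability W R) (X : nat -> E -> W -> E).
Context (splice : nat -> W * W -> W) (RO : random_orbit rho X splice).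
Implicit Types (h g : E -> R) (Q : (E -> R) -> E -> R).

Definition absorbing (C : set E) := forall x, C x -> forall k t, C (X k x t).

Definition average h n x t := n%:R^-1 * \sum_(j < n) h (X j x t).

(* The properties of the one-step operator that survive composition and
   averaging, and that are needed to identify the limits of its averages. *)
Record markov_op Q : Prop := MarkovOp {
  mo_bmeas : forall h, bmeas h -> bmeas (Q h) ;
  mo_lin : forall a h g, bmeas h -> bmeas g ->
    Q (fun x => a * h x + g x) = (fun x => a * Q h x + Q g x) ;
  mo_cst : forall c, Q (fun=> c) = (fun=> c) ;
  mo_le : forall C h g, absorbing C -> bmeas h -> bmeas g ->
    (forall x, C x -> h x <= g x) -> forall x, C x -> Q h x <= Q g x ;
  mo_cvg : forall (h_ : nat -> E -> R) h B, (forall n, bmeas (h_ n)) -> bmeas h ->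
    (forall n x, `|h_ n x| <= B) -> (forall x, h_ ^~ x @ \oo --> h x) ->
    forall x, (fun n => Q (h_ n) x) @ \oo --> Q h x ;
  mo_comm : forall h, bmeas h -> Q (op rho X 1 h) = op rho X 1 (Q h) ;
  mo_average : forall h x, bmeas h -> {ae rho, forall t,
    (fun n => average h n x t - average (Q h) n x t) @ \oo --> 0} }.

Lemma absorbingT : absorbing setT. Proof. by []. Qed.

Lemma mo_norm_le Q h B : markov_op Q -> bmeas h -> (forall x, `|h x| <= B) ->
  forall x, `|Q h x| <= B.
Proof.
move=> mQ bh hB x; rewrite ler_norml; apply/andP; split.
  rewrite -[leLHS](congr1 (@^~ x) (mo_cst mQ (- B))).
  apply: (mo_le mQ absorbingT) => // [|y _]; first exact: bmeas_cst.
  by have := hB y; rewrite ler_norml => /andP[].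
rewrite -[leRHS](congr1 (@^~ x) (mo_cst mQ B)).
apply: (mo_le mQ absorbingT) => // [|y _]; first exact: bmeas_cst.
by have := hB y; rewrite ler_norml => /andP[].
Qed.

(** The probabilistic clause is the last one. At time [j] the difference of [h] and [op 1 h] is the
    centered increment plus the drop of [h] from time [j] to time [j+1]; the drops telescope to a
    bounded quantity, which dividing by [n] removes. *)
Lemma markov_op_op1 : markov_op (op rho X 1).
Proof.
split.
- by move=> h; exact: (bmeas_op RO).
- move=> a h g bh bg; apply/funext => x.
  rewrite /op intD ?intZ//; [exact: (bmeas_orbit RO)| |exact: (bmeas_orbit RO)].
  exact/bmeasZ/(bmeas_orbit RO).
- by move=> c; apply/funext => x; rewrite /op int_cst.
- move=> C h g aC bh bg hg x Cx.
  by apply: le_int => [||t]; [exact: (bmeas_orbit RO)..|exact/hg/aC].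
- move=> h_ h B bh_ bh hB hh x.
  by apply: (@int_cvg _ _ _ _ _ _ B) => [n||n t|t];
    [exact: (bmeas_orbit RO)|exact: (bmeas_orbit RO)|exact: hB|exact: hh].
- by [].
move=> h x bh; have := ae_increment_average RO x bh; apply: filterS => t.
have [_ [B hB]] := bh => cvg_incr.
have cvg_tail : (fun n => n%:R^-1 * (h (X 0 x t) - h (X n x t))) @ \oo --> 0.
  apply/cvgrPdist_le => e e0; near=> n.
  rewrite sub0r normrN normrM ger0_norm ?invr_ge0//.
  have n0 : 0 < n%:R :> R by near: n; exists 1%N => // n /= n0; rewrite ltr0n.
  rewrite ler_pdivrMl//.
  apply: (@le_trans _ _ (2 * B)).
    by rewrite (le_trans (ler_normB _ _))// mulrDl mul1r lerD.
  rewrite -ler_pdivrMr//; near: n; exists (Num.truncn (2 * B / e)).+1 => // n /= hn.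
  by rewrite (le_trans (ltW (truncnS_gt _)))// ler_nat.
have := cvgD cvg_incr cvg_tail; rewrite addr0 => cvg_sum.
suff -> : (fun n => average h n x t - average (op rho X 1 h) n x t) =
    (fun n => n%:R^-1 * \sum_(j < n) (h (X j.+1 x t) - op rho X 1 h (X j x t))) \+
    (fun n => n%:R^-1 * (h (X 0 x t) - h (X n x t)));
  first exact: cvg_sum.
apply/funext => n; rewrite /average -mulrBr /= -mulrDr; congr (_ * _).
elim: n => [|n ih]; first by rewrite !big_ord0 !subrr addr0.
rewrite !big_ord_recr/= opprD addrACA ih; ring.
Unshelve. all: by end_near. Qed.

Lemma markov_op_id : markov_op id.
Proof.
split=> // h x bh; apply: aeW => t.
by under eq_fun do rewrite subrr; exact: cvg_cst.
Qed.

Lemma markov_op_comp Q Q' : markov_op Q -> markov_op Q' -> markov_op (Q \o Q').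
Proof.
move=> mQ mQ'; split=> /=.
- by move=> h bh; apply: (mo_bmeas mQ); exact: (mo_bmeas mQ').
- move=> a h g bh bg; rewrite (mo_lin mQ')// (mo_lin mQ)//; exact: (mo_bmeas mQ').
- by move=> c; rewrite (mo_cst mQ') (mo_cst mQ).
- move=> C h g aC bh bg hg; apply: (mo_le mQ aC); [exact: (mo_bmeas mQ')..|].
  exact: (mo_le mQ' aC).
- move=> h_ h B bh_ bh hB hh; apply: (@mo_cvg _ mQ _ _ B) => [n||n|].
  + exact: (mo_bmeas mQ').
  + exact: (mo_bmeas mQ').
  + by apply: (mo_norm_le mQ').
  + exact: (mo_cvg mQ' bh_ bh hB hh).
- by move=> h bh; rewrite (mo_comm mQ')// (mo_comm mQ)//; exact: (mo_bmeas mQ').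
- move=> h x bh.
  have := mo_average mQ x (mo_bmeas mQ' bh); have := mo_average mQ' x bh.
  apply: filterS2 => t c1 c2; have := cvgD c1 c2; rewrite addr0 => c12.
  suff -> : (fun n => average h n x t - average (Q (Q' h)) n x t) =
    (fun n => average h n x t - average (Q' h) n x t) \+
    (fun n => average (Q' h) n x t - average (Q (Q' h)) n x t);
    first exact: c12.
  by apply/funext => n /=; rewrite addrA subrK.
Qed.

Lemma markov_op_iter Q n : markov_op Q -> markov_op (iter n Q).
Proof.
by move=> mQ; elim: n => [|n ih]; [exact: markov_op_id|exact: (markov_op_comp mQ ih)].
Qed.

Definition mix L (Q_ : nat -> (E -> R) -> E -> R) h x : R :=
  L.+1%:R^-1 * \sum_(k < L.+1) Q_ k h x.

Lemma markov_op_mix L (Q_ : nat -> (E -> R) -> E -> R) : (forall k, markov_op (Q_ k)) -> markov_op (mix L Q_).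
Proof.
move=> mQ; have L0 : L.+1%:R != 0 :> R by rewrite pnatr_eq0.
have bS h : bmeas h -> bmeas (fun x => \sum_(k < L.+1) Q_ k h x).
  by move=> bh; apply: bmeas_sum => k; exact: (mo_bmeas (mQ k)).
split.
- by move=> h bh; apply: bmeasZ; exact: bS.
- move=> a h g bh bg; apply/funext => x; rewrite /mix.
  under eq_bigr => k _ do rewrite (mo_lin (mQ k))//.
  by rewrite big_split/= -mulr_sumr mulrDr mulrCA.
- move=> c; apply/funext => x; rewrite /mix.
  under eq_bigr => k _ do rewrite (mo_cst (mQ k)).
  by rewrite sumr_const card_ord -[c *+ _]mulr_natl mulKf.
- move=> C h g aC bh bg hg x Cx; rewrite ler_wpM2l ?invr_ge0//.
  by apply: ler_sum => k _; exact: (mo_le (mQ k) aC).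
- move=> h_ h B bh_ bh hB hh x; apply: cvgMl_tmp.
  apply: (@cvg_sumr _ _ _ _ _ (fun (k : 'I_L.+1) n => Q_ k (h_ n) x) (fun k => Q_ k h x)) => k.
  exact: (mo_cvg (mQ k) bh_ bh hB hh).
- move=> h bh; apply/funext => x; rewrite /mix.
  under eq_bigr => k _ do rewrite (mo_comm (mQ k))//.
  rewrite [RHS]/op intZ; last exact: (bmeas_orbit RO 1 x (bS _ bh)).
  congr (_ * _); rewrite int_sum// => k.
  exact: (bmeas_orbit RO 1 x (mo_bmeas (mQ k) bh)).
- move=> h x bh.
  have : {ae rho, forall t, forall k, (fun n => average h n x t -
      average (Q_ k h) n x t) @ \oo --> 0}.
    by apply/ae_foralln => k; exact: (mo_average (mQ k)).
  apply: filterS => t cvgk.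
  rewrite [X in X @ \oo --> _](_ : _ = (fun n => L.+1%:R^-1 *
      \sum_(k < L.+1) (average h n x t - average (Q_ k h) n x t))).
    have h0 : (fun n => \sum_(k < L.+1) (average h n x t -
        average (Q_ k h) n x t)) @ \oo --> \sum_(k < L.+1) (0 : R).
      by apply: cvg_sumr => k; exact: cvgk.
    rewrite big1// in h0; rewrite -[X in _ --> X](mulr0 (L.+1%:R^-1)).
    exact: cvgMl_tmp.
  apply/funext => n; rewrite sumrB sumr_const card_ord mulrBr -[average h n x t *+ _]mulr_natl mulKf//.
  congr (_ - _); rewrite /average.
  under [X in _ * X]eq_bigr do rewrite /mix mulr_sumr.
  rewrite -mulr_sumr mulrCA; congr (_ * _).
  rewrite exchange_big/= mulr_sumr; apply: eq_bigr => j _.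
  by rewrite mulr_sumr.
Qed.

End MarkovOperators.

(** * The limit measure of a contracting operator *)

(** Values of the limit measure are identified below by bounding their distance to a common iterate
    by a multiple of [r ^+ n], for all [n]. *)
Lemma geometric_unique (R : realType) (r K a b : R) : 0 <= r < 1 ->
  (forall n, `|a - b| <= K * r ^+ n) -> a = b.
Proof.
move=> /andP[r0 r1] abK; apply/eqP; rewrite -subr_eq0 -normr_eq0 eq_le normr_ge0 andbT.
have rn0 : (fun n => K * r ^+ n) @ \oo --> 0.
  rewrite -(mulr0 K); apply: cvgMl_tmp; apply: cvg_expr.
  by rewrite ger0_norm.
rewrite -(cvg_lim _ rn0)//; apply: limr_ge; first by apply/cvg_ex; exists 0.
exact: nearW.
Qed.

Lemma indic_bigsetU_cvg (R : realType) (T : Type) (F : nat -> set T) (x : T) :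
  (fun n => \1_(\big[setU/set0]_(i < n) F i) x : R) @ \oo -->
  (\1_(\bigcup_i F i) x : R).
Proof.
have [[i _ Fix]|nFx] := pselect ((\bigcup_i F i) x).
  rewrite [X in _ --> X]indicE mem_set; last by exists i.
  apply: cvg_near_cst; exists i.+1 => // n /= ni.
  by rewrite indicE mem_set// -bigcup_mkord; exists i.
rewrite [X in _ --> X]indicE memNset//; apply: cvg_near_cst; apply: nearW => n.
rewrite indicE memNset// -bigcup_mkord => -[i _ Fix]; apply: nFx; by exists i.
Qed.

Lemma indic_01 (R : realType) (T : Type) (A : set T) (x : T) :
  0 <= (\1_A x : R) <= 1.
Proof. by rewrite indicE ler0n lern1 leq_b1. Qed.

(** The sum counts the [k] with [k+1 <= (n+1) h x], so it is the integer part of [(n+1) h x]. *)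
Lemma layer_cake_approx (R : realType) (T : Type) (h : T -> R) (n : nat) x :
  0 <= h x <= 1 ->
  `|h x - n.+1%:R^-1 * \sum_(k < n.+1) \1_[set y | k.+1%:R <= n.+1%:R * h y] x|
    <= n.+1%:R^-1.
Proof.
move=> /andP[h0 h1]; have n0 : 0 < n.+1%:R :> R by rewrite ltr0n.
set y := n.+1%:R * h x.
have y0 : 0 <= y by rewrite mulr_ge0// ltW.
have yn : y <= n.+1%:R by rewrite ger_pMr.
have tn : (Num.truncn y <= n.+1)%N.
  by rewrite -(ler_nat R) (le_trans _ yn)// truncn_le.
have -> : \sum_(k < n.+1) \1_[set y | k.+1%:R <= n.+1%:R * h y] x =
    (Num.truncn y)%:R :> R.
  transitivity (\sum_(k < n.+1) (k < Num.truncn y)%:R : R).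
    apply: eq_bigr => k _; rewrite indicE truncn_ge_nat//.
    by congr (nat_of_bool _)%:R; apply/idP/idP => [/set_mem//|ky]; exact: mem_set.
  rewrite -natr_sum; congr _%:R.
  rewrite -(subnKC tn) big_split_ord/=.
  rewrite [X in (X + _)%N](eq_bigr (fun=> 1%N)); last by move=> i _; rewrite ltn_ord.
  rewrite [X in (_ + X)%N](eq_bigr (fun=> 0%N)); last by move=> i _; rewrite ltnNge leq_addr.
  by rewrite sum1_card card_ord big1// addn0.
have -> : h x = n.+1%:R^-1 * y by rewrite mulKf// gt_eqF.
rewrite -mulrBr normrM ger0_norm ?invr_ge0 ?(ltW n0)// ger_pMr ?invr_gt0//.
have /andP[ty yt] := truncn_itv y0.
by rewrite ger0_norm ?subr_ge0// lerBlDr addrC natr1 ltW.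
Qed.

Section LimitMeasure.
Context (R : realType) dE dW (E : measurableType dE) (W : measurableType dW).
Context (rho : probability W R) (X : nat -> E -> W -> E).
Context (Q : (E -> R) -> E -> R) (mQ : markov_op rho X Q).
Context (C : set E) (aC : absorbing X C) (mC : measurable C) (C0 : C !=set0).
Context (r : R) (r01 : 0 < r < 1).
Hypothesis contraction : forall h x y, bmeas h -> (forall z, 0 <= h z <= 1) ->
  C x -> C y -> Q h x - Q h y <= r.
Implicit Types h g : E -> R.

Let mQn n : markov_op rho X (iter n Q) := markov_op_iter n mQ.

Let rn_gt0 n : 0 < r ^+ n.
Proof. by rewrite exprn_gt0//; case/andP: r01. Qed.

Lemma mo_ge_cst Q' h c x : markov_op rho X Q' -> bmeas h ->
  (forall y, C y -> c <= h y) -> C x -> c <= Q' h x.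
Proof.
move=> mQ' bh ch Cx; rewrite -[leLHS](congr1 (@^~ x) (mo_cst mQ' c)).
by apply: (mo_le mQ' aC) => //; exact: bmeas_cst.
Qed.

Lemma mo_le_cst Q' h c x : markov_op rho X Q' -> bmeas h ->
  (forall y, C y -> h y <= c) -> C x -> Q' h x <= c.
Proof.
move=> mQ' bh ch Cx; rewrite -[leRHS](congr1 (@^~ x) (mo_cst mQ' c)).
by apply: (mo_le mQ' aC) => //; exact: bmeas_cst.
Qed.

Lemma mo_scale Q' a h : markov_op rho X Q' -> bmeas h ->
  Q' (fun x => a * h x) = (fun x => a * Q' h x).
Proof.
move=> mQ' bh; have := mo_lin mQ' a bh (bmeas_cst 0).
under eq_fun do rewrite addr0; move=> ->; rewrite (mo_cst mQ').
by apply/funext => x; rewrite addr0.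
Qed.

Lemma mo_sum Q' (F : nat -> E -> R) k x : markov_op rho X Q' ->
  (forall j, bmeas (F j)) ->
  Q' (fun x => \sum_(j < k) F j x) x = \sum_(j < k) Q' (F j) x.
Proof.
move=> mQ' bF; elim: k => [|k ih].
  by under eq_fun do rewrite big_ord0; rewrite (mo_cst mQ') big_ord0.
rewrite big_ord_recr/= -ih.
have -> : (fun x => \sum_(j < k.+1) F j x) =
    (fun x => 1 * (\sum_(j < k) F j x) + F k x).
  by apply/funext => y; rewrite big_ord_recr/= mul1r.
by rewrite (mo_lin mQ')// ?mul1r//; exact: bmeas_sum.
Qed.

(** After [n] steps the oscillation on [C] is at most [r ^+ n]. Subtracting the infimum and dividing
    by [r ^+ n] gives again a function with values in [0, 1], to which one more contraction
    applies. *)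
Lemma iter_contraction n h x y : bmeas h -> (forall z, 0 <= h z <= 1) ->
  C x -> C y -> iter n Q h x - iter n Q h y <= r ^+ n.
Proof.
move=> bh h01; elim: n x y => [|n ih] x y Cx Cy.
  have /andP[_ h1] := h01 x; have /andP[h0 _] := h01 y.
  by rewrite /= expr0; lra.
set g := iter n Q h in ih *; have bg : bmeas g by exact: (mo_bmeas (mQn n)).
have lbg z : C z -> lbound (g @` C) (g z - r ^+ n).
  by move=> Cz _ [w Cw <-]; rewrite lerBlDr -lerBlDl; exact: ih.
have gC0 : has_inf (g @` C).
  by split; [exists (g x), x|exists (g x - r ^+ n); exact: lbg].
pose a := inf (g @` C).
(* The indicator keeps the values in [0, 1] off [C] too. As [C] is absorbing, the values of [Q] on
   [C] depend on the values on [C] alone. *)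
pose g' z := \1_C z * ((r ^+ n)^-1 * (g z - a)).
have bg' : bmeas g'.
  by apply: bmeasM; [exact: bmeas_indic|apply/bmeasZ/bmeasB => //; exact: bmeas_cst].
have ag z : C z -> a <= g z by move=> Cz; apply: ge_inf; [exact: gC0.2|exists z].
have ga z : C z -> g z <= a + r ^+ n.
  by move=> Cz; rewrite -lerBlDr; apply: lb_le_inf; [exact: gC0.1|exact: lbg].
have g'01 z : 0 <= g' z <= 1.
  rewrite /g' indicE; case: (boolP (z \in C)) => [/set_mem Cz|_]; last by rewrite mul0r lexx ler01.
  rewrite mul1r mulr_ge0 ?invr_ge0 ?(ltW (rn_gt0 _)) ?subr_ge0 ?ag//=.
  by rewrite ler_pdivrMl// mulr1 lerBlDl ga.
have gE z : C z -> g z = r ^+ n * g' z + a.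
  move=> Cz; rewrite /g' indicE mem_set// mul1r mulVKf ?subrK//.
  by rewrite gt_eqF.
have bga : bmeas (fun z => r ^+ n * g' z + a).
  by apply: bmeasD; [exact: bmeasZ|exact: bmeas_cst].
have QgE z : C z -> Q g z = r ^+ n * Q g' z + a.
  move=> Cz; rewrite -[a in RHS](congr1 (@^~ z) (mo_cst mQ a)).
  rewrite -[RHS](congr1 (@^~ z) (mo_lin mQ (r ^+ n) bg' (bmeas_cst a))).
  by apply/eqP; rewrite eq_le; apply/andP; split;
    apply: (mo_le mQ aC) => // w Cw; rewrite gE.
rewrite !iterS -/g !QgE// opprD addrACA subrr addr0 -mulrBr exprSr.
by rewrite ler_pM2l//; exact: contraction.
Qed.

(** Over [C] the suprema of the iterates decrease, the infima increase, and their gap is at most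
    [r ^+ n]. The limit is the infimum of [S], the set of upper bounds of all iterates; bounds from
    times [m] and [n] are compared at time [m + n]. *)
Lemma limit_exists h : bmeas h -> (forall z, 0 <= h z <= 1) ->
  exists c, forall n x, C x -> `|iter n Q h x - c| <= r ^+ n.
Proof.
move=> bh h01; have [x0 Cx0] := C0.
pose S := [set b | exists n, forall x, C x -> iter n Q h x <= b].
have lbS n x : C x -> lbound S (iter n Q h x - r ^+ n).
  move=> Cx b [m hb].
  apply: (@le_trans _ _ (iter (m + n) Q h x0)).
    rewrite iterD; apply: (mo_ge_cst (mQn m)) => // [|y Cy].
      exact: (mo_bmeas (mQn n)).
    by rewrite lerBlDr -lerBlDl; exact: iter_contraction.
  rewrite addnC iterD; apply: (mo_le_cst (mQn n)) => //.
  exact: (mo_bmeas (mQn m)).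
have S0 n x : C x -> S (iter n Q h x + r ^+ n).
  by move=> Cx; exists n => y Cy; rewrite -lerBlDl; exact: iter_contraction.
exists (inf S) => n x Cx; rewrite ler_distl; apply/andP; split.
  rewrite lerBlDr; apply: ge_inf; last exact: S0.
  by exists (iter n Q h x - r ^+ n); exact: lbS.
rewrite -lerBlDr; apply: lb_le_inf; last exact: lbS.
by exists (iter n Q h x + r ^+ n); exact: S0.
Qed.

(** The value 0 on sets that are not measurable makes the set function total. *)
Definition limit_value (A : set E) : R :=
  if pselect (measurable A) is left mA
  then projT1 (cid (limit_exists (bmeas_indic mA) (indic_01 R A))) else 0.

Lemma limit_valueP A n x : measurable A -> C x ->
  `|iter n Q \1_A x - limit_value A| <= r ^+ n.
Proof.
rewrite /limit_value; case: pselect => // mA _ Cx.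
by case: (cid _) => c /= hc; exact: hc.
Qed.

Let r01w : 0 <= r < 1. Proof. by case/andP: r01 => /ltW -> ->. Qed.

Lemma limit_value_eq A c K x : measurable A -> C x ->
  (forall n, `|iter n Q \1_A x - c| <= K * r ^+ n) -> limit_value A = c.
Proof.
move=> mA Cx hc; apply: (geometric_unique (K := 1 + K) r01w) => n.
rewrite -(subrKA (iter n Q \1_A x)) (le_trans (ler_normD _ _))//.
by rewrite distrC mulrDl mul1r lerD// limit_valueP.
Qed.

Let mu A : \bar R := (limit_value A)%:E.

Let mu0 : mu set0 = 0%E.
Proof.
have [x0 Cx0] := C0; congr (_%:E).
apply: (limit_value_eq (K := 0) measurable0 Cx0) => n.
by rewrite indic0 (mo_cst (mQn n)) subrr normr0 mul0r.
Qed.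

Let mu_ge0 A : (0 <= mu A)%E.
Proof.
rewrite lee_fin; have [x0 Cx0] := C0.
have [mA|nmA] := pselect (measurable A); last by rewrite /limit_value; case: pselect.
apply/ler_addgt0Pr => e e0.
have [n rne] : exists n, r ^+ n < e.
  have : (fun n => r ^+ n) @ \oo --> 0.
    by apply: cvg_expr; rewrite ger0_norm; case/andP: r01w.
  move/cvgrPdist_lt => /(_ _ e0)[n _ /(_ n (leqnn n))].
  by rewrite sub0r normrN gtr0_norm// => h; exists n.
have := limit_valueP n mA Cx0; rewrite ler_distl => /andP[_ h].
have : 0 <= iter n Q \1_A x0.
  apply: (mo_ge_cst (mQn n)) => [|y _|//]; first exact: bmeas_indic.
  by case/andP: (indic_01 R A y).
lra.
Qed.

Let limit_valueU A B : measurable A -> measurable B -> [disjoint A & B] ->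
  limit_value (A `|` B) = limit_value A + limit_value B.
Proof.
move=> mA mB AB; have [x0 Cx0] := C0.
apply: (limit_value_eq (K := 2) (measurableU _ _ mA mB) Cx0) => n.
have -> : \1_(A `|` B) = (fun x => 1 * \1_A x + \1_B x) :> (E -> R).
  apply/funext => x; rewrite mul1r !indicE in_setU.
  have [xA|_] := boolP (x \in A); last by rewrite add0r.
  have [xB|_] := boolP (x \in B); last by rewrite addr0.
  by move/disj_setPS : AB => /(_ x)[]; split; exact/set_mem.
rewrite (mo_lin (mQn n) 1 (bmeas_indic mA) (bmeas_indic mB)).
rewrite mul1r opprD addrACA (le_trans (ler_normD _ _))// mulrDl mul1r.
by rewrite lerD// limit_valueP.
Qed.

(** A single iterate [N] is within [r ^+ N] of the limit for all sets at once, and it is continuous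
    under bounded pointwise convergence of indicators. Three errors below [e / 4] then separate the
    partial unions from the whole. *)
Let mu_sigma : semi_sigma_additive mu.
Proof.
move=> F mF tF mUF; have [x0 Cx0] := C0.
have mU n : measurable (\big[setU/set0]_(i < n) F i).
  by rewrite -bigcup_mkord; exact: bigcup_measurable.
have sumE n : (\sum_(0 <= i < n) mu (F i) =
    (limit_value (\big[setU/set0]_(i < n) F i))%:E)%E.
  elim: n => [|n ih]; first by rewrite big_geq// big_ord0 -mu0.
  rewrite big_nat_recr//= ih big_ord_recr/= -EFinD (limit_valueU (mU n) (mF n))//.
  rewrite -bigcup_mkord; apply/disj_setPS => x [[i /= ni Fix] Fnx].
  have : i = n by apply: tF => //; exists x.
  by move=> ein; rewrite ein ltnn in ni.
under eq_fun do rewrite sumE.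
apply: cvg_EFin; first exact: nearW.
apply/cvgrPdist_lt => e e0.
have e40 : 0 < e / 4 by rewrite divr_gt0.
have [N rNe] : exists n, r ^+ n < e / 4.
  have : (fun n => r ^+ n) @ \oo --> 0.
    by apply: cvg_expr; rewrite ger0_norm; case/andP: r01w.
  move/cvgrPdist_lt => /(_ _ e40)[n _ /(_ n (leqnn n))].
  by rewrite sub0r normrN gtr0_norm// => h; exists n.
have := @mo_cvg _ _ _ _ _ _ _ _ (mQn N)
  (fun n => \1_(\big[setU/set0]_(i < n) F i)) (\1_(\bigcup_i F i)) 1.
move=> /(_ _ _ _ _ x0)/cvgrPdist_lt H.
have {}H := H (fun n => bmeas_indic (mU n)) (bmeas_indic mUF) _
  (fun x => @indic_bigsetU_cvg R _ F x) _ e40.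
have /H : forall n x, `|\1_(\big[setU/set0]_(i < n) F i) x : R| <= 1.
  by move=> n x; rewrite indicE normr_nat lern1 leq_b1.
apply: filterS => n /= hn.
have := limit_valueP N (mU n) Cx0; have := limit_valueP N mUF Cx0.
move: hn; rewrite !ltr_norml !ler_norml => /andP[? ?] /andP[? ?] /andP[? ?].
apply/andP; split; lra.
Qed.

HB.instance Definition _ := isMeasure.Build _ _ _ mu mu0 mu_ge0 mu_sigma.

Let muT : mu setT = 1%E.
Proof.
have [x0 Cx0] := C0; congr (_%:E).
apply: (limit_value_eq (K := 0) measurableT Cx0) => n.
by rewrite indicT (mo_cst (mQn n)) subrr normr0 mul0r.
Qed.

HB.instance Definition _ := Measure_isProbability.Build _ _ _ mu muT.

Lemma limit_measure_exists : exists P : probability E R,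
  forall h, bmeas h -> (forall z, 0 <= h z <= 1) ->
  forall n x, C x -> `|iter n Q h x - \int[P]_y h y| <= r ^+ n.
Proof.
pose P : probability E R := mu; exists P => h bh h01 n x Cx; apply/ler_addgt0Pr => e e0.
have e20 : 0 < e / 2 by rewrite divr_gt0.
have [k ke] : exists k, k.+1%:R^-1 < e / 2.
  by have [k] := ltr_add_invr e20; rewrite add0r; exists k.
(* Indicators of level sets carry the estimate over to [h]: in their average the weights add up to
   1, so the error [r ^+ n] is not multiplied. *)
pose L k j := [set y | j.+1%:R <= k.+1%:R * h y].
have mL j : measurable (L k j).
  rewrite (_ : L k j = (fun y => k.+1%:R * h y) @^-1` `[j.+1%:R, +oo[).
    by rewrite -[X in measurable X]setTI; apply: (bmeasZ _ bh).1 => //; exact: measurable_itv.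
  by apply/seteqP; split=> y /=; rewrite in_itv/= andbT.
pose hk x : R := k.+1%:R^-1 * \sum_(j < k.+1) \1_(L k j) x.
have bS : bmeas (fun x => \sum_(j < k.+1) \1_(L k j) x : R).
  by apply: bmeas_sum => j; exact: bmeas_indic.
have bhk : bmeas hk by exact: bmeasZ.
have hhk y : `|h y - hk y| <= k.+1%:R^-1 by exact: layer_cake_approx.
have i1 : `|\int[P]_y h y - \int[P]_y hk y| <= k.+1%:R^-1.
  by rewrite -intB//; apply: int_norm_le => //; exact: bmeasB.
have i2 : `|iter n Q h x - iter n Q hk x| <= k.+1%:R^-1.
  have := mo_norm_le (mQn n) (bmeasB bh bhk) hhk x.
  suff -> : iter n Q (fun x => h x - hk x) = (fun x => iter n Q h x - iter n Q hk x) by [].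
  have -> : (fun x => h x - hk x) = (fun x => -1 * hk x + h x).
    by apply/funext => y; rewrite mulN1r addrC.
  by rewrite (mo_lin (mQn n))//; apply/funext => y; rewrite mulN1r addrC.
have i3 : `|iter n Q hk x - \int[P]_y hk y| <= r ^+ n.
  have QhkE : iter n Q hk x = k.+1%:R^-1 * \sum_(j < k.+1) iter n Q \1_(L k j) x.
    rewrite (mo_scale _ (mQn n))//= (@mo_sum _ (fun j => \1_(L k j)) _ _ (mQn n))// => j.
    exact: bmeas_indic.
  rewrite QhkE intZ// int_sum => [|j]; last exact: bmeas_indic.
  rewrite -mulrBr -sumrB normrM ger0_norm ?invr_ge0// ler_pdivrMl//.
  apply: le_trans (ler_norm_sum _ _ _) _.
  rewrite mulr_natl -[X in _ *+ X]card_ord -sumr_const ler_sum// => j _.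
  by rewrite int_indic//= limit_valueP.
move: i1 i2 i3 ke; move: k.+1%:R^-1 => u; rewrite !ler_norml => /andP[? ?] /andP[? ?] /andP[? ?] ?.
apply/andP; split; lra.
Qed.

End LimitMeasure.

Section LimitMeasureProperties.
Context (R : realType) dE dW (E : measurableType dE) (W : measurableType dW).
Context (rho : probability W R) (X : nat -> E -> W -> E).
Context (splice : nat -> W * W -> W) (RO : random_orbit rho X splice).
Context (Q : (E -> R) -> E -> R) (mQ : markov_op rho X Q).
Context (C : set E) (aC : absorbing X C) (mC : measurable C) (C0 : C !=set0).
Context (r : R) (r01 : 0 < r < 1) (P : probability E R).
Hypothesis limP : forall h, bmeas h -> (forall z, 0 <= h z <= 1) ->
  forall n x, C x -> `|iter n Q h x - \int[P]_y h y| <= r ^+ n.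
Implicit Types h g : E -> R.

Let mQn n : markov_op rho X (iter n Q) := markov_op_iter n mQ.

Let r01w : 0 <= r < 1. Proof. by case/andP: r01 => /ltW -> ->. Qed.

Lemma fine_prob_eq (A : set E) (c : R) : measurable A -> fine (P A) = c -> P A = c%:E.
Proof. by move=> mA <-; rewrite fineK//; exact: fin_num_measure. Qed.

Lemma limit_measure_support : P C = 1%E.
Proof.
apply: fine_prob_eq => //; rewrite -int_indic//.
have [x0 Cx0] := C0; apply: (geometric_unique (K := 1) r01w) => n.
have := limP (bmeas_indic mC) (indic_01 R C) n Cx0.
suff -> : iter n Q \1_C x0 = 1 by rewrite distrC mul1r.
apply/eqP; rewrite eq_le; apply/andP; split.
  apply: (mo_le_cst aC (mQn n)) => [|y Cy|//]; first exact: bmeas_indic.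
  by rewrite indicE (mem_set Cy).
apply: (mo_ge_cst aC (mQn n)) => [|y Cy|//]; first exact: bmeas_indic.
by rewrite indicE (mem_set Cy).
Qed.

(** This is the source of absolute continuity: a set that [Q] does not see from [C] remains unseen
    by all further iterates. *)
Lemma limit_measure_null A : measurable A -> (forall x, C x -> Q \1_A x = 0) ->
  P A = 0%E.
Proof.
move=> mA QA0; apply: fine_prob_eq => //; rewrite -int_indic//.
have [x0 Cx0] := C0; apply: (geometric_unique (K := 1) r01w) => n.
have Qn0 m x : C x -> iter m.+1 Q \1_A x = 0.
  elim: m x => [|m ih] x Cx; first exact: QA0.
  apply/eqP; rewrite eq_le iterS; apply/andP; split.
    by apply: (mo_le_cst aC mQ) => [|y /ih ->//|//]; exact: (mo_bmeas (mQn m.+1) (bmeas_indic mA)).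
  by apply: (mo_ge_cst aC mQ) => [|y /ih ->//|//]; exact: (mo_bmeas (mQn m.+1) (bmeas_indic mA)).
have := limP (bmeas_indic mA) (indic_01 R A) n.+1 Cx0.
rewrite Qn0// distrC mul1r => /le_trans; apply.
by rewrite exprS ger_pMl ?exprn_gt0//; case/andP: r01 => // _ /ltW.
Qed.

Let unit_scale h : bmeas h -> exists a b g, [/\ bmeas g, forall z, 0 <= g z <= 1 &
  h = fun x => a * g x + b].
Proof.
move=> bh; have [_ [B hB]] := bh.
have B0 : 0 <= B by rewrite (le_trans _ (hB point)).
(* The summand 1 keeps the scale invertible when [B = 0]. *)
pose c := (2 * B + 1)^-1.
have c0 : 0 < c by rewrite invr_gt0; lra.
have c1 : c * (2 * B + 1) = 1 by rewrite mulVf//; lra.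
exists c^-1, (- B), (fun x => c * (h x + B)); split=> [|z|].
- by apply/bmeasZ/bmeasD => //; exact: bmeas_cst.
- by have := hB z; rewrite ler_norml => /andP[? ?]; apply/andP; split; nra.
- by apply/funext => x; rewrite mulKf ?addrK// gt_eqF.
Qed.

(** [Q] commutes with the one-step operator. At [x0] the iterates applied to [op 1 g] tend to its
    mean; exchanging the operators, they are also averages of iterates of [g] over points of [C],
    and tend to the mean of [g]. *)
Lemma limit_measure_stationary h : bmeas h ->
  \int[P]_x op rho X 1 h x = \int[P]_x h x.
Proof.
suff H g : bmeas g -> (forall z, 0 <= g z <= 1) ->
    \int[P]_x op rho X 1 g x = \int[P]_x g x.
  move=> bh; have [a [b [g [bg g01 ->]]]] := unit_scale bh.
  rewrite (mo_lin (markov_op_op1 RO) a bg (bmeas_cst b)).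
  rewrite (mo_cst (markov_op_op1 RO)).
  have bog := bmeas_op RO 1 bg.
  by rewrite !intD ?intZ ?H//; try exact: bmeasZ; exact: bmeas_cst.
move=> bg g01; have [x0 Cx0] := C0.
have bog := bmeas_op RO 1 bg.
have og01 z : 0 <= op rho X 1 g z <= 1.
  apply/andP; split.
    by apply: int_ge_cst => [|t]; [exact: (bmeas_orbit RO)|case/andP: (g01 (X 1 z t))].
  by apply: int_le_cst => [|t]; [exact: (bmeas_orbit RO)|case/andP: (g01 (X 1 z t))].
apply: (geometric_unique (K := 2) r01w) => n.
have h1 := limP bog og01 n Cx0.
have h2 : `|op rho X 1 (iter n Q g) x0 - \int[P]_x g x| <= r ^+ n.
  rewrite -[X in _ - X](int_cst rho) -intB; [|exact/(bmeas_orbit RO)/(mo_bmeas (mQn n))|exact: bmeas_cst].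
  rewrite ler_norml; apply/andP; split.
    apply: int_ge_cst => [|t]; first by apply: bmeasB; [exact/(bmeas_orbit RO)/(mo_bmeas (mQn n))|exact: bmeas_cst].
    by have := limP bg g01 n (aC Cx0 1%N t); rewrite ler_norml => /andP[].
  apply: int_le_cst => [|t]; first by apply: bmeasB; [exact/(bmeas_orbit RO)/(mo_bmeas (mQn n))|exact: bmeas_cst].
  by have := limP bg g01 n (aC Cx0 1%N t); rewrite ler_norml => /andP[].
rewrite (mo_comm (mQn n))// in h1.
move: h1 h2; rewrite !ler_norml => /andP[? ?] /andP[? ?]; apply/andP; split; lra.
Qed.

(** Almost surely, for all [N] at once, [h] and [iter N Q h] have asymptotically equal averages. On
    [C] the second function is within [r ^+ N] of the mean, and the [k] times before the orbit
    settles in [C] contribute at most [k / n]. *)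
Lemma limit_measure_average h x : bmeas h -> (forall z, 0 <= h z <= 1) ->
  {ae rho, forall t, (exists k, forall j, (k <= j)%N -> C (X j x t)) ->
    (fun n => average X h n x t) @ \oo --> \int[P]_y h y}.
Proof.
move=> bh h01; pose c := \int[P]_y h y.
have c01 : 0 <= c <= 1.
  by rewrite int_ge_cst ?int_le_cst// => z; case/andP: (h01 z).
have : {ae rho, forall t, forall N, (fun n => average X h n x t -
    average X (iter N Q h) n x t) @ \oo --> 0}.
  by apply/ae_foralln => N; exact: (mo_average (mQn N)).
apply: filterS => t avN [k Ck].
apply/cvgrPdist_le => e e0.
have e30 : 0 < e / 3 by rewrite divr_gt0.
have [N rNe] : exists n, r ^+ n < e / 3.
  have : (fun n => r ^+ n) @ \oo --> 0.
    by apply: cvg_expr; rewrite ger0_norm; case/andP: r01w.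
  move/cvgrPdist_lt => /(_ _ e30)[n _ /(_ n (leqnn n))].
  by rewrite sub0r normrN gtr0_norm// ?exprn_gt0//; [move=> h'; exists n|case/andP: r01].
move/cvgrPdist_le : (avN N) => /(_ _ e30) avNe.
near=> n.
have n0 : 0 < n%:R :> R by near: n; exists 1%N => // n /= n0; rewrite ltr0n.
have d1 : `|average X h n x t - average X (iter N Q h) n x t| <= e / 3.
  by rewrite -normrN -sub0r; near: n.
have kn : k%:R <= e / 3 * n%:R.
  rewrite mulrC -ler_pdivrMr//; near: n; exists (Num.truncn (k%:R / (e / 3))).+1 => // n /= hn.
  by rewrite (le_trans (ltW (truncnS_gt _)))// ler_nat.
have Qh01 z : 0 <= iter N Q h z <= 1.
  apply/andP; split.
    by apply: (mo_ge_cst (absorbingT X) (mQn N)) => // y _; case/andP: (h01 y).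
  by apply: (mo_le_cst (absorbingT X) (mQn N)) => // y _; case/andP: (h01 y).
have d2 : `|average X (iter N Q h) n x t - c| <= e / 3 + e / 3.
  have -> : c = n%:R^-1 * \sum_(j < n) c.
    by rewrite sumr_const card_ord -[c *+ _]mulr_natl mulKf// gt_eqF.
  rewrite -mulrBr -sumrB normrM ger0_norm ?invr_ge0 ?(ltW n0)// ler_pdivrMl//.
  apply: le_trans (ler_norm_sum _ _ _) _.
  apply: (@le_trans _ _ (\sum_(j < n) (r ^+ N + (j < k)%:R))).
    apply: ler_sum => j _; have [jk|kj] := ltnP j k.
      rewrite (@le_trans _ _ 1)//; last by rewrite lerDr exprn_ge0//; case/andP: r01w.
      have := Qh01 (X j x t); rewrite ler_norml => /andP[? ?].
      case/andP: c01 => ? ?; apply/andP; split; lra.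
    by rewrite addr0; apply: limP => //; exact: Ck.
  rewrite big_split/= sumr_const card_ord -[_ *+ n]mulr_natl mulrDr lerD//.
    by rewrite ler_pM2l// ltW.
  rewrite mulrC (le_trans _ kn)// -natr_sum ler_nat.
  rewrite -[leqRHS](card_ord k) -sum1_card.
  have [nk|kn'] := leqP n k.
    rewrite (big_ord_widen k (fun j => ((j < k) : nat)) nk).
    by rewrite big_mkcond leq_sum// => j _; case: ifP; rewrite ?leq_b1.
  rewrite -(subnKC (ltnW kn')) big_split_ord/= [X in (_ + X)%N]big1 ?addn0.
    by rewrite leq_sum// => j _; rewrite leq_b1.
  by move=> j _; rewrite ltnNge leq_addr.
rewrite -/c; move: d1 d2; rewrite !ler_norml => /andP[? ?] /andP[? ?].
apply/andP; split; lra.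
Unshelve. all: by end_near. Qed.

End LimitMeasureProperties.

(** * A zero-one law for skew-invariant sets *)

Section ZeroOneLaw.
Context (R : realType) dE dW (E : measurableType dE) (W : measurableType dW).
Context (rho : probability W R) (X : nat -> E -> W -> E).
Context (splice : nat -> W * W -> W) (RO : random_orbit rho X splice).
Context (Q : (E -> R) -> E -> R).
Context (C : set E) (aC : absorbing X C) (C0 : C !=set0).
Context (r : R) (r01 : 0 < r < 1) (P : probability E R).
Hypothesis limP : forall h, bmeas h -> (forall z, 0 <= h z <= 1) ->
  forall n x, C x -> `|iter n Q h x - \int[P]_y h y| <= r ^+ n.
Hypothesis Qharmonic : forall h, bmeas h -> op rho X 1 h = h -> Q h = h.
Context (skew : E * W -> E * W).
Hypothesis skewE : forall k x t t',
  iter k skew (x, splice k (t, t')) = (X k x t, t').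
Context (G : set (set W)) (GE : (@measurable _ W) = <<s G >>).
Context (GI : setI_closed G) (GT : G setT).
Hypothesis Gfinite : forall D, G D ->
  exists k, forall t t', D (splice k (t, t')) <-> D t.

Lemma harmonic_constant h : bmeas h -> (forall z, 0 <= h z <= 1) ->
  op rho X 1 h = h -> forall x, C x -> h x = \int[P]_y h y.
Proof.
move=> bh h01 hh x Cx; apply: (geometric_unique (K := 1) (r := r)) => [|n].
  by case/andP: r01 => /ltW -> ->.
have Qh n' : iter n' Q h = h by elim: n' => // n' ih; rewrite iterS ih Qharmonic.
by have := limP bh h01 n Cx; rewrite Qh mul1r.
Qed.

(** The probability [h x] of the section of [A] over [x] is harmonic, hence a constant [c] on [C],
    and [c] is the product measure of [A]. Independence of the section over [x0] from itself gives
    [c = c^2]. *)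
Lemma skew_invariant_01 (A : set (E * W)) : measurable A ->
  skew @^-1` A = A -> ((P \x rho) A = 0 \/ (P \x rho) A = 1)%E.
Proof.
move=> mA AE.
have AkE k : iter k skew @^-1` A = A.
  elim: k => // k ih; rewrite -[RHS]AE -[in RHS]ih.
  by apply/seteqP; split=> p /=; rewrite -iterSr.
have bA : bmeas (\1_A : E * W -> R) := bmeas_indic mA.
pose h x : R := \int[rho]_t \1_A (x, t).
have bh : bmeas h := bmeas_int1 rho bA.
have h01 x : 0 <= h x <= 1.
  have bAx := bmeas_prod1 bA x.
  by rewrite int_ge_cst ?int_le_cst// => t; case/andP: (indic_01 R A (x, t)).
have hE x : h x = fine (rho (xsection A x)).
  rewrite /h -int_indic; last exact: measurable_xsection.
  by apply: eq_Rintegral => t _; rewrite !indicE mem_xsection.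
have Asplice k x t t' : \1_A (x, splice k (t, t')) = \1_A (X k x t, t') :> R.
  rewrite !indicE; congr (_%:R); congr nat_of_bool.
  apply/idP/idP => /set_mem hA; apply/mem_set; first by rewrite -(AkE k) in hA; rewrite -skewE.
  by rewrite -(AkE k) /preimage/= skewE.
have hharm : op rho X 1 h = h.
  apply/funext => x; rewrite /op /h (int_splice RO 1 (bmeas_prod1 bA x)).
  apply: eq_Rintegral => t _; apply: eq_Rintegral => t' _; by rewrite Asplice.
set c := \int[P]_y h y.
have hc x : C x -> h x = c := harmonic_constant bh h01 hharm (x := x).
have c0 : 0 <= c by apply: int_ge_cst => // z; case/andP: (h01 z).
have PA : (P \x rho)%E A = c%:E.
  rewrite -bmeas_intE//; apply: eq_integral => x _ /=.
  by rewrite hE fineK//; apply: fin_num_measure; exact: measurable_xsection.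
have [x0 Cx0] := C0.
have mAx := measurable_xsection x0 mA.
(* The section of A at x0 is independent of every event that depends on a
   finite part of the noise, hence of itself. *)
have AG D : G D -> rho (xsection A x0 `&` D) = (c%:E * rho D)%E.
  move=> GD; have [k kD] := Gfinite GD.
  have mD : measurable D by rewrite GE; exact: sub_sigma_algebra.
  rewrite -[LHS]fineK; last by apply: fin_num_measure; exact: measurableI.
  rewrite -[rho D]fineK; last exact: fin_num_measure.
  rewrite -EFinM -!int_indic//; last exact: measurableI.
  congr (_%:E).
  have bAD : bmeas (\1_(xsection A x0 `&` D) : W -> R).
    by apply: bmeas_indic; exact: measurableI.
  rewrite (int_splice RO k bAD) -intZ; last exact: bmeas_indic.
  apply: eq_Rintegral => t _.
  transitivity (\int[rho]_t' (\1_D t * \1_A (X k x0 t, t')) : R).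
    apply: eq_Rintegral => t' _; rewrite -Asplice !indicE in_setI mulrC mem_xsection.
    by rewrite -natrM mulnb; congr ((_ && _)%:R); apply/idP/idP; rewrite !inE => /kD.
  rewrite intZ; last exact: bmeas_prod1.
  by rewrite mulrC -/(h _) hc//; exact: aC.
have AD D : measurable D -> rho (xsection A x0 `&` D) = (c%:E * rho D)%E.
  move=> mD.
  (* Both sides are finite measures in [D]; they agree on [G], which is stable under intersection
     and generates. *)
  have mm : mrestr rho mAx D = mscale (NngNum c0) rho D.
    apply: (measure_unique G (fun=> setT)) => //.
    - by rewrite bigcup_const//; exists 0%N.
    - by move=> B GB; rewrite -[LHS]/(rho (B `&` _)) setIC; exact: AG.
    - move=> _; rewrite -[ltLHS]/(rho (setT `&` _)) setTI.
      by rewrite (le_lt_trans (probability_le1 _ _))// ltry.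
  by rewrite setIC; exact: mm.
have := AD _ mAx; rewrite setIid.
have -> : rho (xsection A x0) = c%:E.
  rewrite -(hc _ Cx0) hE fineK//; exact: fin_num_measure.
rewrite PA -EFinM => -[] /eqP; rewrite -subr_eq0 -{1}(mulr1 c) -mulrBr mulf_eq0.
by case/orP => /eqP; [left; congr _%:E|right; congr _%:E; lra].
Qed.

End ZeroOneLaw.

(** * The noise space *)

Section NoiseSequences.
Context (R : realType) (n : nat) (a : 'rV[R]_n) (eps : {posnum R}).
Local Notation T := (noise a eps).
Local Notation Delta := (noise_seq a eps).

Definition noise_base (p : 'rV[rat]_n * nat) : set T :=
  set_val @^-1` (ball (map_mx ratr p.1 : 'rV[R]_n) p.2.+1%:R^-1)°.

Lemma is_base_noise : @is_base T _ noise_base.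
Proof. exact: (is_base_initial set_val (@is_base_rV R n)). Qed.

Definition noise_seq_base (s : seq ('rV[rat]_n * nat)) : set Delta :=
  cylinder (0, 0%N) noise_base s.

Lemma is_base_noise_seq : @is_base Delta _ noise_seq_base.
Proof. exact: (is_base_ptws (0, 0%N) is_base_noise). Qed.

Lemma noise_coord_continuous i : continuous (fun t : Delta => t i).
Proof. exact: (@proj_continuous nat (fun=> T) i). Qed.

Lemma noise_seq_continuous (X : topologicalType) (F : X -> Delta) :
  (forall i, continuous (fun x => F x i)) -> continuous F.
Proof.
move=> cF x U /nbhs_cylinder[k [A [nA AU]]].
have := @filter_forall X 'I_k (fun i y => A i (F y i)) (nbhs x) _.
move=> H; have {H} : \forall y \near x, forall i : 'I_k, A i (F y i).
  by apply: H => i; exact: (cF i x _ (nA i)).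
by apply: filterS => y Ay; apply: AU => i ik; exact: (Ay (Ordinal ik)).
Qed.

Definition cyl k (A : nat -> set (borel T)) : set (borel Delta) :=
  [set t : Delta | forall i, (i < k)%N -> A i (t i)].

Lemma cyl_widen k l A : (k <= l)%N ->
  cyl k A = cyl l (fun i => if (i < k)%N then A i else setT).
Proof.
move=> kl; apply/seteqP; split=> t tA i.
  by move=> il; case: ifP => // ik; exact: tA.
by move=> ik; have := tA i (leq_trans ik kl); rewrite ik.
Qed.

Definition cylinders : set (set (borel Delta)) :=
  [set D | exists k A, (forall i, measurable (A i)) /\ D = cyl k A].

Lemma measurable_cyl k A : (forall i, measurable (A i)) -> measurable (cyl k A).
Proof.
move=> mA; rewrite (_ : cyl k A =
    \bigcap_(i in [set i | (i < k)%N]) ((fun t : Delta => t i) @^-1` A i)).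
  apply: bigcap_measurableType => i _.
  have := continuous_borel_measurable (@noise_coord_continuous i).
  by move=> /(_ measurableT (A i) (mA i)); rewrite setTI.
by [].
Qed.

Lemma cylinders_setT : cylinders setT.
Proof. by exists 0%N, (fun=> setT); split=> //; apply/seteqP; split=> t. Qed.

Lemma cylinders_setI : setI_closed cylinders.
Proof.
move=> _ _ [k [A [mA ->]]] [l [B [mB ->]]].
pose AB i := (if (i < k)%N then A i else setT) `&` (if (i < l)%N then B i else setT).
exists (maxn k l), AB; split.
  by move=> i; apply: measurableI; case: ifP.
rewrite (cyl_widen A (leq_maxl k l)) (cyl_widen B (leq_maxr k l)).
apply/seteqP; split=> t => [[tA tB] i il|tAB].
  by split; [exact: tA|exact: tB].
by split=> i il; have [] := tAB i il.
Qed.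

Lemma noise_base_measurable p : measurable (noise_base p : set (borel T)).
Proof. by apply: sub_sigma_algebra; exact: is_base_noise.1. Qed.

(** The topology has a countable base made of cylinders with open sides, so each open set is a
    countable union of measurable cylinders. *)
Lemma borel_noise_seqE : (@measurable _ (borel Delta)) = <<s cylinders >>.
Proof.
apply/seteqP; split.
  apply: smallest_sub; first exact: smallest_sigma_algebra.
  move=> U oU.
  have := @open_base_measurable _ (g_sigma_algebraType cylinders) Delta _ _ id U
    is_base_noise_seq _ oU; apply => s.
  apply: sub_sigma_algebra; exists (size s), (fun i => noise_base (nth (0, 0%N) s i)).
  by split=> // i; exact: noise_base_measurable.
apply: smallest_sub; first exact: sigma_algebra_measurable.
by move=> _ [k [A [mA ->]]]; exact: measurable_cyl.
Qed.

Definition splice j (p : borel Delta * borel Delta) : borel Delta :=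
  fun i => if (i < j)%N then p.1 i else p.2 (i - j)%N.

Lemma splice_continuous j :
  continuous (splice j : Delta * Delta -> Delta).
Proof.
apply: noise_seq_continuous => i; rewrite /splice; case: (ltnP i j) => _ p.
  apply: (@continuous_comp (Delta * Delta)%type Delta T fst (fun t => t i) p).
    exact: cvg_fst.
  exact: noise_coord_continuous.
apply: (@continuous_comp (Delta * Delta)%type Delta T snd (fun t => t (i - j)%N) p).
  exact: cvg_snd.
exact: noise_coord_continuous.
Qed.

Lemma splice_measurable_fun j : measurable_fun setT (splice j).
Proof.
exact: (continuous_prod_borel_measurable is_base_noise_seq is_base_noise_seq
  (@splice_continuous j)).
Qed.

Lemma splice_cyl j l A : splice j @^-1` cyl (j + l) A =
  cyl j A `*` cyl l (fun i => A (j + i)%N).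
Proof.
apply/seteqP; split=> [[t t']|[t t']] /= hA.
  split=> i /= ij; have := hA _; rewrite /splice/=.
    by move=> /(_ i); rewrite ij; apply; rewrite ltn_addr.
  by move=> /(_ (j + i)%N); rewrite ltn_add2l [(j + i < j)%N]ltnNge leq_addr/= addKn; apply.
move: hA => [/= h1 h2] i ijl; rewrite /splice/=; case: ltnP => [|ji]; first exact: h1.
by have := h2 (i - j)%N; rewrite subnKC// ltn_subLR//; apply.
Qed.

Variables (nu : probability (borel T) R) (nuinf : probability (borel Delta) R).
Hypothesis nuP : is_product_probability nu nuinf.

Lemma nuinf_cyl k A : (forall i, measurable (A i)) ->
  nuinf (cyl k A) = (\prod_(i < k) nu (A i))%E.
Proof. exact: nuP. Qed.

(** Both sides are probabilities in [D], so it is enough to compare them on cylinders, where each is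
    a product of [nu]-masses. *)
Lemma splice_nuinf j (D : set (borel Delta)) : measurable D ->
  nuinf D = (nuinf \x nuinf)%E (splice j @^-1` D).
Proof.
move=> mD.
pose m2 := pushforward (nuinf \x nuinf)%E (splice j).
suff : nuinf D = m2 D by [].
apply: (measure_unique cylinders (fun=> setT)) => //.
- exact: borel_noise_seqE.
- exact: cylinders_setI.
- by move=> _; exact: cylinders_setT.
- by rewrite bigcup_const//; exists 0%N.
- exact: splice_measurable_fun.
- move=> mspl _ [k [A [mA ->]]].
  (* Widening to length [j + k] by trivial sides allows the cylinder to be cut at [j] even when [k]
     is smaller than [j]. *)
  rewrite (cyl_widen A (leq_addl j k)).
  rewrite -[RHS]/((nuinf \x nuinf)%E (splice j @^-1` _)) splice_cyl.
  have mA' i : measurable (if (i < k)%N then A i else setT) by case: ifP.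
  rewrite [RHS]product_measure1E; [|exact: measurable_cyl..].
  transitivity (\prod_(i < j + k) nu (if (i < k)%N then A i else setT))%E.
    exact: (@nuinf_cyl (j + k)).
  rewrite big_split_ord/=; congr (_ * _)%E; apply/esym; first exact: (@nuinf_cyl j).
  exact: (@nuinf_cyl k (fun i => if (j + i < k)%N then A (j + i)%N else setT)).
- by move=> _; rewrite (le_lt_trans (probability_le1 _ _))// ltry.
Qed.

Lemma nuinf_head (A : set (borel T)) : measurable A ->
  nu A = nuinf ((fun t : borel Delta => t 0%N) @^-1` A).
Proof.
move=> mA; have := @nuinf_cyl 1 (fun=> A) (fun=> mA); rewrite big_ord1 => <-.
by congr (nuinf _); apply/seteqP; split=> t; [exact|move=> At [|]].
Qed.

(** This turns topological reachability into positive probability: around a point of [U] there is a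
    basic cylinder inside [U], whose mass is a finite product of positive factors. *)
Lemma nuinf_open_gt0 (U : set Delta) :
  (forall V : set T, open V -> V !=set0 -> (0 < nu V)%E) ->
  open U -> U !=set0 -> (0 < nuinf U)%E.
Proof.
move=> nu0 oU [t Ut].
have [s st sU] := is_base_noise_seq.2 t U (open_nbhs_nbhs (conj oU Ut)).
have mB i : measurable (noise_base (nth (0, 0%N) s i) : set (borel T)).
  exact: noise_base_measurable.
apply: (@lt_le_trans _ _ (nuinf (cyl (size s) (fun i => noise_base (nth (0, 0%N) s i))))).
  rewrite nuinf_cyl//.
  apply: (@big_ind _ (fun x => (0 < x)%E)) => // [x y x0 y0|i _].
    exact: mule_gt0.
  apply: (nu0 (noise_base (nth (0, 0%N) s i))); first exact: is_base_noise.1.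
  by exists (t i); exact: st.
apply: le_measure; rewrite ?inE//; first exact: measurable_cyl.
exact: sub_sigma_algebra.
Qed.

End NoiseSequences.

(** * Positivity of the noise law on nonempty open sets *)

Section LebesgueRowVectors.
Context {R : realType}.

(* No measurability is required, since the integral of a nonnegative function
   is defined as a supremum over the simple functions below it. *)
Lemma le_integral_unmeasurable d (T : measurableType d)
    (mu : {measure set T -> \bar R}) (f g : T -> \bar R) :
  (forall x, 0 <= f x)%E -> (forall x, f x <= g x)%E ->
  (\int[mu]_x f x <= \int[mu]_x g x)%E.
Proof.
move=> f0 fg; rewrite !ge0_integralTE// => [|x]; last exact: le_trans (fg x).
apply: le_ereal_sup => _ [h hf <-].
by exists h => // x; exact: le_trans (hf x) (fg x).
Qed.

Lemma lebesgue_rV_ge0 n (A : set (borel 'rV[R]_n)) : (0 <= lebesgue_rV A)%E.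
Proof.
case: n A => [|n] A /=; first exact: measure_ge0.
elim: n A => [|n ih] A; first by apply: integral_ge0 => x _ /=; exact: measure_ge0.
by apply: integral_ge0 => x _; exact: ih.
Qed.

(** [A] is an arbitrary set, so monotonicity of the measure cannot be invoked. By induction, the
    slices over an interval of length [2 d] have measure at least the constant [k], and the
    integrands are compared directly. *)
Lemma lebesgue_rV_box n (c : 'rV[R]_n) (d : R) (A : set (borel 'rV[R]_n)) :
  0 < d -> (forall v : 'rV[R]_n, (forall i, `|v 0 i - c 0 i| < d) -> A v) ->
  (((d *+ 2) ^+ n)%:E <= lebesgue_rV A)%E.
Proof.
move=> d0; elim: n c A => [|n ih] c A cA.
  rewrite expr0 /= diracE mem_set//.
  by apply: cA => -[].
pose B : set R := `]c 0 ord0 - d, c 0 ord0 + d[%classic.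
have lB : lebesgue_measure B = (d *+ 2)%:E.
  rewrite lebesgue_measure_itv/= lte_fin ifT; last by lra.
  by rewrite -EFinB; congr (_%:E); rewrite mulr2n; ring.
have dn0 : 0 <= (d *+ 2) ^+ n by rewrite exprn_ge0// mulrn_wge0// ltW.
pose c' : 'rV[R]_n := rsubmx (c : 'rV_(1 + n)).
pose k := (d *+ 2) ^+ n.
have -> : ((d *+ 2) ^+ n.+1)%:E = (\int[lebesgue_measure]_x (k%:E * (\1_B x)%:E))%E.
  rewrite ge0_integralZl_EFin//; last first.
    by apply/measurable_EFinP; apply: measurable_indic; exact: measurable_itv.
  rewrite integral_indic//; first by rewrite setIT exprSr EFinM -lB.
  exact: measurable_itv.
apply: le_integral_unmeasurable => x; first by rewrite -EFinM lee_fin mulr_ge0// indicE.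
rewrite /= indicE; have [/set_mem|_] := boolP (x \in B); last first.
  by rewrite mule0; exact: lebesgue_rV_ge0.
rewrite /B/= in_itv/= => /andP[x1 x2]; rewrite mule1.
apply: (ih c') => v vc; apply/xsectionP; apply: cA => i.
case: (@splitP 1 n i) => [j ij|j ij].
  have -> : i = lshift n j by exact/val_inj.
  have -> : c 0 (lshift n j) = c 0 ord0 by congr (c 0 _); apply/val_inj; rewrite /= (ord1 j).
  have -> : row_mx (x%:M : 'M[R]_1) v 0 (lshift n j) = x.
    by rewrite row_mxEl mxE (ord1 j) eqxx mulr1n.
  by rewrite ltr_distl; apply/andP; split.
have -> : i = rshift 1 j by exact/val_inj.
have -> : row_mx (x%:M : 'M[R]_1) v 0 (rshift 1 j) = v 0 j by rewrite row_mxEr.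
by have := vc j; rewrite /c' mxE.
Qed.

End LebesgueRowVectors.

Section NoisePositive.
Context (R : realType) (n : nat) (a : 'rV[R]_n) (eps : {posnum R}).
Local Notation T := (noise a eps).

Let sq (v : 'rV[R]_n) : R := \sum_i (v 0 i - a 0 i) ^+ 2.

Let cballE (v : 'rV[R]_n) : cball a eps%:num v <-> sq v <= eps%:num ^+ 2.
Proof.
rewrite /cball/= /enorm.
have -> : \sum_i (v - a) 0 i ^+ 2 = sq v by apply: eq_bigr => i _; rewrite !mxE.
have e0 : 0 <= eps%:num by [].
split=> h.
  rewrite -[leLHS]sqr_sqrtr; last by apply: sumr_ge0 => i _; rewrite sqr_ge0.
  by rewrite lerXn2r ?nnegrE// sqrtr_ge0.
by rewrite -[leRHS]ger0_norm// -sqrtr_sqr ler_wsqrtr.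
Qed.

Let sq_continuous : continuous sq.
Proof.
move=> v; apply: cvg_sumr => [|i]; first exact: (nbhs_filter v).
have ci : (fun w : 'rV[R]_n => w 0 i - a 0 i) @ v --> v 0 i - a 0 i.
  have cw : (fun w : 'rV[R]_n => w 0 i) @ v --> v 0 i.
    exact: (@coord_continuous R 1 n 0 i v).
  have := @cvgB _ _ _ (nbhs v) (nbhs_filter v) _ _ _ _ cw (@cvg_cst _ (a 0 i) _ (nbhs v) (nbhs_filter v)).
  exact.
by under eq_fun do rewrite expr2; rewrite expr2;
  exact: (@cvgM _ _ (nbhs v) (nbhs_filter v) _ _ _ _ ci ci).
Qed.

(** A point of [V] may lie on the boundary sphere of the noise ball. Pulled slightly towards the
    center [a], it becomes interior to the ball while staying in the open set [G] that cuts out [V];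
    a small box around it has positive volume. *)
Lemma noise_open_gt0 (nu : probability (borel T) R) (V : set T) :
  is_normalized_lebesgue nu -> open V -> V !=set0 -> (0 < nu V)%E.
Proof.
move=> nuE oV [t Vt].
pose L := @lebesgue_rV R n (cball a eps%:num).
have L0 : (0 <= L)%E by exact: lebesgue_rV_ge0.
(* Total mass 1 forces the normalizing factor to be nonzero; this excludes the values 0 and infinity
   of [L], for which the inverse of [fine L] is 0. *)
have c0 : 0 < (fine L)^-1.
  rewrite lt_neqAle invr_ge0 fine_ge0// andbT eq_sym; apply/eqP => c0.
  have := nuE setT measurableT; rewrite probability_setT c0 mul0e => -[] /eqP.
  by rewrite oner_eq0.
rewrite nuE; last exact: sub_sigma_algebra.
apply: mule_gt0; first by rewrite lte_fin.
have [G oG GV] := oV.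
pose tau := set_val t.
have Gtau : G tau by rewrite -[G _]/((set_val @^-1` G) t) GV.
have [dlt /= d0 dG] : exists2 dl : R, 0 < dl & ball tau dl `<=` G.
  by have /nbhs_ballP[dl dl0 ?] := open_nbhs_nbhs (conj oG Gtau); exists dl.
have /cballE tau_le : cball a eps%:num tau by apply: set_mem; exact: (valP t).
have e0 : 0 < eps%:num by [].
(* Chosen to give [s < 1] together with [s * eps < dlt]: the displacement of each coordinate is at
   most [s * eps]. *)
pose s := dlt / (2 * (eps%:num + dlt)).
have s0 : 0 < s by rewrite divr_gt0// mulr_gt0// addr_gt0.
have s1 : s < 1 by rewrite ltr_pdivrMr ?mul1r ?mulr_gt0 ?addr_gt0//; lra.
have sd : s * eps%:num < dlt.
  rewrite mulrAC ltr_pdivrMr ?mulr_gt0 ?addr_gt0//; nra.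
pose u : 'rV[R]_n := \row_i (tau 0 i + s * (a 0 i - tau 0 i)).
have Gu : G u.
  apply: dG; split=> // i j; rewrite (ord1 i) mxE /ball/= opprD addrA subrr sub0r normrN.
  rewrite normrM gtr0_norm// (le_lt_trans _ sd)// ler_pM2l//.
  rewrite -(@ler_pXn2r _ 2)// ?nnegrE//.
  rewrite real_normK ?num_real// -sqrrN opprB (le_trans _ tau_le)//.
  by rewrite /sq (bigD1 j)//= lerDl; apply: sumr_ge0 => k _; rewrite sqr_ge0.
have squ : sq u < eps%:num ^+ 2.
  have -> : sq u = (1 - s) ^+ 2 * sq tau.
    by rewrite /sq mulr_sumr; apply: eq_bigr => i _; rewrite mxE; ring.
  apply: (@le_lt_trans _ _ ((1 - s) ^+ 2 * eps%:num ^+ 2)).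
    by rewrite ler_wpM2l// sqr_ge0.
  rewrite gtr_pMl ?exprn_gt0// expr_lt1//; lra.
have nu_ : nbhs u (G `&` [set v | sq v < eps%:num ^+ 2]).
  apply: filterI; first exact: open_nbhs_nbhs.
  exact: (cvgr_lt (sq u) (@sq_continuous u)).
have /nbhs_ballP[d' /= d'0 ud'] := nu_.
apply: (@lt_le_trans _ _ ((d' *+ 2) ^+ n)%:E); first by rewrite lte_fin exprn_gt0// mulrn_wgt0.
apply: (lebesgue_rV_box (c := u)) => // v vu.
have [Gv /ltW/cballE vT] : (G `&` [set v | sq v < eps%:num ^+ 2]) v.
  by apply: ud'; split=> // i j; rewrite (ord1 i) /ball/= distrC.
exists (exist _ v (mem_set vT) : T) => //.
by rewrite -GV.
Qed.

End NoisePositive.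

(** * Overlapping laws *)

Lemma decreasing_small (R : realType) d (T : measurableType d)
    (P : probability T R) (D : nat -> set T) (e : R) :
  (forall i, measurable (D i)) -> nonincreasing_seq D ->
  \bigcap_i D i = set0 -> 0 < e -> exists i, (P (D i) < e%:E)%E.
Proof.
move=> mD nD D0 e0.
have P0 : (P (D 0%N) < +oo)%E by rewrite (le_lt_trans (probability_le1 _ _))// ltry.
have := @nonincreasing_cvg_mu _ _ _ P D P0 mD _ nD.
rewrite D0 measure0 => /(_ measurable0).
move=> /fine_cvgP[_ /cvgrPdist_lt /(_ _ e0)[i _ /(_ i (leqnn i))]].
rewrite /= sub0r normrN ger0_norm ?fine_ge0// => Pe; exists i.
by rewrite -lte_fin fineK// in Pe; exact: fin_num_measure.
Qed.

Lemma measureD_le (R : realType) d (T : measurableType d) (P : probability T R)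
    (A B : set T) :
  measurable A -> measurable B -> (P A <= P (A `\` B) + P B)%E.
Proof.
move=> mA mB; have mAB : measurable (A `\` B) by exact: measurableD.
apply: (@le_trans _ _ (P ((A `\` B) `|` B))); last exact: measureU2.
apply: le_measure; rewrite ?inE//; first exact: measurableU.
by move=> x Ax; have [Bx|nBx] := pselect (B x); [right|left].
Qed.

(** [W] is the positive set in a Hahn decomposition of [p - m / 2], in effect the place where the
    density of [p] is at least one half. If [m W] were 0, then [p W = 0] and the negative set would
    have [p]-mass 1, more than half its [m]-mass. *)
Lemma half_dominated_set (R : realType) d (T : measurableType d)
    (p m : probability T R) : p `<< m ->
  exists W, [/\ measurable W, (0 < m W)%E &
    forall A, measurable A -> A `<=` W -> (2^-1%:E * m A <= p A)%E].
Proof.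
move=> /null_content_dominatesP pm.
pose cm := charge_of_finite_measure m; pose cp := charge_of_finite_measure p.
pose nu := cadd cp (cscale (- 2^-1) cm).
have [W [N [[mW pW] [mN nN] WN WN0]]] := Hahn_decomposition nu.
have nuE A : nu A = (p A - 2^-1%:E * m A)%E.
  by rewrite /nu /cadd/= /cscale /= EFinN mulNe.
have nN' : (p N - 2^-1%:E * m N <= 0)%E by rewrite -nuE; exact: nN.
have pW' A : measurable A -> A `<=` W -> (0 <= p A - 2^-1%:E * m A)%E.
  by move=> mA AW; rewrite -nuE; exact: pW.
have mfin A : measurable A -> (2^-1%:E * m A)%E \is a fin_num.
  by move=> mA; rewrite fin_numM//; exact: fin_num_measure.
exists W; split=> //.
  rewrite lt0e measure_ge0 andbT; apply/eqP => mW0.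
  have pW0 := pm _ mW mW0.
  have pN : p N = 1%E.
    have -> : N = ~` W.
      apply/seteqP; split=> x; first by move=> Nx Wx; have : (W `&` N) x by []; rewrite WN0.
      by move=> nWx; have : (W `|` N) x by [rewrite WN]; case.
    by rewrite probability_setC// pW0 sube0.
  move: nN'; rewrite pN sube_le0.
  rewrite leNgt => /negP; apply.
  apply: (@le_lt_trans _ _ (2^-1%:E * 1)%E).
    by rewrite lee_pmul2l//; exact: probability_le1.
  by rewrite mule1 lte_fin; lra.
move=> A mA AW; have := pW' A mA AW; rewrite sube_ge0//.
by apply/orP; left; exact: mfin.
Qed.

(** * Regularity of Borel probabilities on a metric space *)

Section Regularity.
Context (R : realType) (M : pmetricType R) (m : probability (borel M) R).

Definition regular (A : set (borel M)) := forall e : R, 0 < e ->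
  exists F G : set M, [/\ closed F, open G, F `<=` A, A `<=` G &
    (m (G `\` F : set (borel M)) < e%:E)%E].

Lemma open_borel (U : set M) : open U -> measurable (U : set (borel M)).
Proof. exact: sub_sigma_algebra. Qed.

Lemma closed_borel (F : set M) : closed F -> measurable (F : set (borel M)).
Proof.
by move=> cF; rewrite -(setCK F); apply: measurableC; apply: open_borel; exact: closed_openC.
Qed.

Let regular_open (U : set M) : open U -> regular U.
Proof.
move=> oU e e0.
(* Points of [U] away from its complement at scale [1/(n+1)]; these closed sets increase to [U]
   because [U] is open. *)
pose F n := ~` (\bigcup_(y in ~` U) (ball y (n.+1%:R^-1 : R))°).
have cF n : closed (F n).
  apply: open_closedC; apply: bigcup_open => y _; exact: open_interior.
have FU n : F n `<=` U.
  move=> x Fx; apply: contrapT => nUx; apply: Fx; exists x => //.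
  by apply: nbhsx_ballx; rewrite invr_gt0.
have [|||n mn] := @decreasing_small R _ (borel M) m (fun n => U `\` F n) e _ _ _ e0.
- by move=> i; apply: measurableD; [exact: open_borel|exact: closed_borel].
- move=> i j ij; apply/subsetPset => x [Ux nFx]; split=> // Fx; apply: nFx.
  move=> [y Uy xy]; apply: Fx; exists y => //.
  move: xy; apply: interiorS; apply: le_ball.
  by rewrite lef_pV2 ?posrE// ler_nat ltnS.
- apply/seteqP; split=> x // UFx.
  have [Ux _] := UFx 0%N I.
  have /nbhs_ballP[d /= d0 xU] := open_nbhs_nbhs (conj oU Ux).
  have [n] := ltr_add_invr d0; rewrite add0r => nd.
  have [_] := UFx n I; apply=> -[y /= Uy /interior_subset xy]; apply: Uy.
  by apply: xU; apply: le_ball (ltW nd) _ (ball_sym xy).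
- by exists (F n), U; split.
Qed.

Let regularC A : regular A -> regular (~` A).
Proof.
move=> rA e e0; have [F [G [cF oG FA AG mGF]]] := rA e e0.
exists (~` G), (~` F); split.
- exact: open_closedC.
- exact: closed_openC.
- exact: subsetC.
- exact: subsetC.
- by rewrite setDE setCK setIC -setDE.
Qed.

(** A countable union of closed sets need not be closed, so it is cut after finitely many terms at
    the cost [e / 2] of the tail [H n]. The other half pays for the gaps between [G i] and [F i],
    bounded by a geometric series. *)
Let regular_bigcup (A : nat -> set (borel M)) :
  (forall i, regular (A i)) -> regular (\bigcup_i A i).
Proof.
move=> rA e e0.
have e20 : 0 < e / 2 by rewrite divr_gt0.
have ei i : 0 < e / 2 / (2 ^ i.+1)%:R by rewrite divr_gt0// ltr0n expn_gt0.
have /choice[F /choice[G FG]] i := rA i _ (ei i).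
have mF i : measurable (F i : set (borel M)).
  by have [cF _ _ _ _] := FG i; exact: closed_borel.
have mG i : measurable (G i : set (borel M)).
  by have [_ oG _ _ _] := FG i; exact: open_borel.
pose H n := \bigcup_i F i `\` \bigcup_(i in `I_n) F i.
have mFn n : measurable (\bigcup_(i in `I_n) F i : set (borel M)).
  by apply: bigcup_measurable => i _.
have mFoo : measurable (\bigcup_i F i : set (borel M)) by exact: bigcup_measurable.
have [|||n mn] := @decreasing_small R _ (borel M) m H (e / 2) _ _ _ e20.
- by move=> i; apply: measurableD.
- move=> i j ij; apply/subsetPset => x [Fx nFx]; split=> // -[k /= ki Fkx].
  by apply: nFx; exists k => //=; exact: leq_trans ij.
- apply/seteqP; split=> x // Hx.
  have [[i _ Fix] _] := Hx 0%N I.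
  by have [_] := Hx i.+1 I; apply; exists i => /=.
exists (\bigcup_(i in `I_n) F i), (\bigcup_i G i); split.
- rewrite bigcup_mkord; apply: closed_bigsetU => i _.
  by have [] := FG i.
- by apply: bigcup_open => i _; have [] := FG i.
- by move=> x [i _ Fx]; exists i => //; have [_ _ + _ _] := FG i; exact.
- by move=> x [i _ Ax]; exists i => //; have [_ _ _ + _] := FG i; exact.
have mGi : measurable (\bigcup_i G i : set (borel M)) by exact: bigcup_measurable.
pose D i : set (borel M) := G i `\` F i.
have mD i : measurable (D i) by exact: measurableD.
have mDoo : measurable (\bigcup_i D i) by exact: bigcup_measurable.
apply: (@le_lt_trans _ _ (m (\bigcup_i D i `|` H n))).
  apply: le_measure; rewrite ?inE//; first exact: measurableD.
    by apply: measurableU => //; exact: measurableD.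
  move=> x [[i _ Gx] nFx].
  have [Fx|nF] := pselect ((\bigcup_i F i) x); [right|left]; first by split.
  by exists i => //; split=> // Fx; apply: nF; exists i.
apply: (@le_lt_trans _ _ (m (\bigcup_i D i) + m (H n))%E).
  by apply: measureU2 => //; exact: measurableD.
rewrite (splitr e) EFinD; apply: lee_ltD => //.
  by rewrite ge0_fin_numE// (le_lt_trans (probability_le1 _ _))// ltry.
have := @measure_sigma_subadditive _ _ _ m (\bigcup_i D i) D mD mDoo (@subset_refl _ _).
move=> /le_trans; apply.
apply: le_trans (epsilon_trick0 xpredT (ltW e20)).
by apply: lee_nneseries => // i _; have [_ _ _ _] := FG i; exact: ltW.
Qed.

Lemma borel_regular (A : set (borel M)) : measurable A -> regular A.
Proof.
have : <<s (@open M) >> `<=` regular.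
  apply: smallest_sub; last exact: regular_open.
  split.
  - by apply: (regular_open open0).
  - by move=> B rB; rewrite setTD; exact: regularC.
  - exact: regular_bigcup.
exact.
Qed.

End Regularity.

(** Otherwise dependent choice gives open sets meeting [K], each with closure inside the previous
    one and off the next closed set; the counter in the state tells which one. The complements of
    the closures cover [K], and a finite subcover contradicts nestedness. *)
Lemma baire_compact (R : realType) (M : pmetricType R) (K : set M)
    (F : nat -> set M) :
  compact K -> K !=set0 -> (forall j, closed (F j)) -> K `<=` \bigcup_j F j ->
  exists j U, [/\ open U, (U `&` K) !=set0 & U `&` K `<=` F j].
Proof.
move=> cK [x0 Kx0] cF KF; apply: contrapT => noF.
pose good := {U : set M | open U /\ (U `&` K) !=set0}.
have step (p : nat * good) : {q : nat * good | q.1 = p.1.+1 /\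
    closure (projT1 q.2) `<=` projT1 p.2 `\` F p.1}.
  case: p => j [U [oU UK]]; apply: cid => /=.
  have [x [[Ux Kx] nFx]] : exists x, (U `&` K) x /\ ~ F j x.
    apply: contrapT => nx; apply: noF; exists j, U; split=> // x UKx.
    by apply: contrapT => nFx; apply: nx; exists x.
  have oUF : open (U `\` F j) by apply: openI => //; exact: closed_openC.
  have /nbhs_ballP[e /= e0 eUF] := open_nbhs_nbhs (conj oUF (conj Ux nFx : (U `\` F j) x)).
  have e20 : 0 < e / 2 by rewrite divr_gt0.
  have gV : open (ball x (e / 2))° /\ ((ball x (e / 2))° `&` K) !=set0.
    by split; [exact: open_interior|exists x; split=> //; exact: nbhsx_ballx].
  exists (j.+1, exist _ (ball x (e / 2))° gV); split=> // y /= cy.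
  apply: eUF; have [z [/interior_subset xz yz]] := cy _ (nbhsx_ballx y _ e20).
  by rewrite (splitr e); apply: ball_triangle xz (ball_sym yz).
have gT : open [set: M] /\ (setT `&` K) !=set0.
  by split; [exact: openT|exists x0].
have [u [u0 uS]] := dependent_choice step (0%N, exist _ setT gT : good).
have u1 n : (u n).1 = n by elim: n => [|n ih]; [rewrite u0|rewrite (uS n).1 ih].
pose U n := projT1 (u n).2.
have clU n : closure (U n.+1) `<=` U n `\` F n.
  by have := (uS n).2; rewrite u1.
have Udec n k : U (n + k)%N `<=` U n.
  elim: k => [|k ih]; first by rewrite addn0.
  by rewrite addnS => x /subset_closure/clU[/ih].
move: cK; rewrite compact_cover => cK.
have [] := cK nat setT (fun n => ~` closure (U n)).
- by move=> n _; apply: closed_openC; exact: closed_closure.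
- move=> x Kx; have [j _ Fx] := KF x Kx; exists j.+1 => // /clU[]; exact.
move=> D _ KD.
pose N := (\max_(i <- enum_fset D) i)%N.
have [x [Ux Kx]] : (U N `&` K) !=set0 by exact: (projT2 (u N).2).2.
have [i /= Di nx] := KD x Kx; apply: nx; apply: subset_closure.
have iN : (i <= N)%N by apply: leq_bigmax_seq.
by move: Ux; rewrite -(subnKC iN); exact: Udec.
Qed.

(** * Semicontinuity of the probability of an open slice *)

Section SectionSemicontinuity.
Context (R : realType) (M : pmetricType R) (D : ptopologicalType).
Context (P : probability (borel D) R).

Lemma open_section (G : set (M * D)) x : open G -> open [set t | G (x, t)].
Proof.
rewrite !openE => oG t Gt.
have [[V W] /= [Vx Wt] VW] := oG (x, t) Gt.
by apply: filterS Wt => t' Wt'; apply: (VW (x, t')); split=> //; exact: nbhs_singleton.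
Qed.

(** A noise in the slice over [x] stays in the slices over a whole ball around [x], uniformly near
    that noise; so the open sets [V n] exhaust the slice. Bounding the lost part, and not just the
    mass, later controls symmetric differences. *)
Lemma slice_lsc (G : set (M * D)) (x : M) (e : R) : open G -> 0 < e ->
  \forall y \near x,
    (P ([set t | G (x, t)] `\` [set t | G (y, t)] : set (borel D)) < e%:E)%E.
Proof.
move=> oG e0.
pose V n : set D := [set t | forall y, ball x (n.+1%:R^-1 : R) y -> G (y, t)]°.
have mG y : measurable ([set t | G (y, t)] : set (borel D)).
  by apply: sub_sigma_algebra; exact: open_section.
have mV n : measurable (V n : set (borel D)).
  by apply: sub_sigma_algebra; exact: open_interior.
pose H n : set (borel D) := [set t | G (x, t)] `\` V n.
have mH n : measurable (H n) by exact: measurableD.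
have nH : nonincreasing_seq H.
  move=> i j ij; apply/subsetPset => t [Gt nVt]; split=> // Vt; apply: nVt.
  move: Vt; apply: interiorS => t' hG y xy; apply: hG.
  by apply: le_ball xy; rewrite lef_pV2 ?posrE// ler_nat ltnS.
have H0 : \bigcap_n H n = set0.
  apply/seteqP; split=> t // Ht.
  have [Gt _] := Ht 0%N I.
  have [[A B] /= [Ax Bt] AB] := open_nbhs_nbhs (conj oG Gt).
  have /nbhs_ballP[d /= d0 xA] := Ax.
  have [n] := ltr_add_invr d0; rewrite add0r => nd.
  have [_] := Ht n I; apply; apply: filterS Bt => t' Bt' y xy.
  by apply: (AB (y, t')); split=> //=; apply: xA; apply: le_ball xy; exact: ltW.
have [n Pn] := decreasing_small P mH nH H0 e0.
apply: (@filterS _ _ _ (ball x (n.+1%:R^-1 : R))); last by apply: nbhsx_ballx; rewrite invr_gt0.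
move=> y xy; apply: le_lt_trans Pn; apply: le_measure.
- by apply/mem_set; exact: (measurableD (mG x) (mG y)).
- by apply/mem_set; exact: mH.
by move=> t [Gxt nGyt]; split=> // /interior_subset Vt; apply: nGyt; exact: Vt.
Qed.

Lemma slice_gt_open (G : set (M * D)) (c : R) : open G ->
  open [set x | (c%:E < P ([set t | G (x, t)] : set (borel D)))%E].
Proof.
move=> oG; rewrite openE => x /= cx.
have mG y : measurable ([set t | G (y, t)] : set (borel D)).
  by apply: sub_sigma_algebra; exact: open_section.
have finG y : P ([set t | G (y, t)] : set (borel D)) \is a fin_num.
  exact: fin_num_measure.
pose p y := fine (P ([set t | G (y, t)] : set (borel D))).
have cp : c < p x by rewrite -lte_fin fineK.
have e0 : 0 < p x - c by rewrite subr_gt0.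
have := slice_lsc x oG e0; apply: filterS => y hy.
have := measureD_le P (mG x) (mG y).
move=> /le_lt_trans /(_ (lte_leD _ hy (lexx _))).
rewrite /= -(fineK (finG x)) -(fineK (finG y)) -EFinD lte_fin lte_fin -/(p x) -/(p y).
move=> /(_ isT); lra.
Qed.

End SectionSemicontinuity.

Section Overlap.
Context (R : realType) (M : pmetricType R) (D : ptopologicalType).
Context (m : probability (borel M) R) (P : probability (borel D) R).
Context (phi : M * D -> M).
Hypothesis cM : compact [set: M].
Hypothesis cphi : continuous phi.
Hypothesis mphi : forall x, measurable_fun setT (fun t : borel D => phi (x, t) : borel M).
Hypothesis phi_null : forall x (A : set (borel M)), measurable A -> m A = 0%E ->
  P ((fun t => phi (x, t)) @^-1` A) = 0%E.

Let p x (A : set (borel M)) : R := fine (P ((fun t => phi (x, t)) @^-1` A)).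
Let mr (A : set (borel M)) : R := fine (m A).

Let mpre x (A : set (borel M)) : measurable A -> measurable ((fun t : borel D => phi (x, t)) @^-1` A).
Proof. by move=> mA; rewrite -[X in measurable X]setTI; exact: mphi. Qed.

Let fin_p x (A : set (borel M)) : measurable A ->
  P ((fun t => phi (x, t)) @^-1` A) \is a fin_num.
Proof. by move=> mA; apply: fin_num_measure; exact: mpre. Qed.

Let le_p x (A B : set (borel M)) : measurable A -> measurable B -> A `<=` B -> p x A <= p x B.
Proof.
move=> mA mB AB; apply: fine_le; [exact: fin_p mA|exact: fin_p mB|].
apply: (le_measure P (mem_set (mpre x mA)) (mem_set (mpre x mB))).
by move=> t; exact: AB.
Qed.

Let le_mr (A B : set (borel M)) : measurable A -> measurable B -> A `<=` B -> mr A <= mr B.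
Proof.
move=> mA mB AB; apply: fine_le; [exact: fin_num_measure mA|exact: fin_num_measure mB|].
exact: (le_measure m (mem_set mA) (mem_set mB)).
Qed.

Let mrD (A B : set (borel M)) : measurable A -> measurable B -> mr A <= mr (A `\` B) + mr B.
Proof.
move=> mA mB; have mAB := measurableD mA mB.
rewrite -lee_fin EFinD !fineK; try exact: fin_num_measure.
exact: measureD_le.
Qed.

Let p_setC x (A : set (borel M)) : measurable A -> p x (~` A) = 1 - p x A.
Proof.
move=> mA; rewrite /p preimage_setC probability_setC; last exact: mpre.
by rewrite fineB//; exact: fin_p.
Qed.

(** Upper semicontinuity of the mass of a closed set, obtained from the open slices of its
    complement. *)
Let closed_p_ge (A : set M) c : closed A -> closed [set x | c <= p x A].
Proof.
move=> cA; rewrite -[X in closed X]setCK; apply: open_closedC.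
have oG : open (phi @^-1` (~` A)).
  by move/continuousP : cphi; apply; exact: closed_openC.
rewrite (_ : ~` _ = [set x | ((1 - c)%:E <
    P ([set t | (phi @^-1` (~` A)) (x, t)] : set (borel D)))%E]).
  exact: slice_gt_open.
apply/seteqP; split=> x /=.
  move=> /negP; rewrite -ltNge => pc.
  rewrite -[P _]fineK; last exact: (fin_p x (measurableC (closed_borel cA))).
  rewrite lte_fin -/(p x (~` A)) p_setC; last exact: closed_borel.
  lra.
rewrite -[P _]fineK; last exact: (fin_p x (measurableC (closed_borel cA))).
rewrite lte_fin -/(p x (~` A)) p_setC; last exact: closed_borel.
by move=> h; apply/negP; rewrite -ltNge; lra.
Qed.

(** The law from [x] exceeds [m / 2] on [U] up to an error of a quarter of the mass of [U]. Testing
    closed sets makes the condition an intersection of closed conditions on [x], as Baire's theorem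
    requires; regularity of [m] recovers all Borel sets afterwards. *)
Let dominating (U : set M) x := 0 < mr U /\
  forall A : set M, closed A -> (mr (A `&` U) - mr U / 4) / 2 <= p x A.

Let dominating_closed U : closed [set x | dominating U x].
Proof.
have [U0|U0] := ltP 0 (mr U); last first.
  rewrite (_ : [set x | _] = set0); first exact: closed0.
  by apply/seteqP; split=> x // -[]; rewrite ltNge U0.
rewrite (_ : [set x | _] = \bigcap_(A in @closed M)
    [set x | (mr (A `&` U) - mr U / 4) / 2 <= p x A]).
  by apply: closed_bigI => A cA; exact: closed_p_ge.
apply/seteqP; split=> x /=; first by move=> [_ h] A cA; exact: h.
by move=> h; split=> // A cA; exact: h.
Qed.

Let dominating_borel (U : set M) x (A : set (borel M)) : open U -> dominating U x ->
  measurable A -> (mr (A `&` U) - mr U / 4) / 2 <= p x A.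
Proof.
move=> oU [U0 dU] mA; have mU := open_borel oU.
apply/ler_addgt0Pr => e e0.
have [F [G [cF oG FA AG mGF]]] := borel_regular m mA e0.
have mF := closed_borel cF; have mG := open_borel oG.
have h1 := dU F cF; have h2 : p x F <= p x A by exact: le_p.
have h3 : mr (A `&` U) <= mr (G `\` F) + mr (F `&` U).
  apply: le_trans (mrD _ (measurableI _ _ mF mU)) _; first exact: measurableI.
  rewrite lerD2r; apply: le_mr.
  - by apply: measurableD; exact: measurableI.
  - exact: measurableD.
  - by move=> y [[Ay Uy] nFU]; split; [exact: AG|move=> Fy; exact: nFU].
have h4 : mr (G `\` F) < e.
  by rewrite -lte_fin fineK//; apply: fin_num_measure; exact: measurableD.
lra.
Qed.

(** The set [W] on which the law dominates [m / 2] is merely measurable. A finite union of basic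
    sets approximates it up to an eighth of its mass on each side, which fits into the tolerance of
    one quarter; finite unions are used because they are countable in number. *)
Let dominating_exists (B : nat -> set M) x : is_base B ->
  exists s : seq nat, dominating (\big[setU/set0]_(i <- s) B i) x.
Proof.
move=> bB.
have [W [mW W0 pW]] : exists W : set (borel M), [/\ measurable W, 0 < mr W &
    forall A, measurable A -> A `<=` W -> mr A / 2 <= p x A].
  pose Y : {mfun (borel D) >-> (borel M)} := mfun_Sub (mem_set (mphi x)).
  have dom : (distribution P Y : set (borel M) -> \bar R) `<< m.
    apply/null_content_dominatesP => A mA mA0.
    exact: (phi_null x mA mA0).
  have [W [mW W0 pW]] := half_dominated_set dom.
  exists W; split=> //; first by rewrite fine_gt0// W0 (le_lt_trans (probability_le1 _ _))// ltry.
  move=> A mA AW; rewrite mulrC -lee_fin EFinM !fineK.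
  - exact: pW.
  - exact: fin_p.
  - exact: fin_num_measure.
have e0 : 0 < mr W / 8 by rewrite divr_gt0.
have [F [G [cF oG FW WG mGF]]] := borel_regular m mW e0.
have mF := closed_borel cF; have mG := open_borel oG.
pose s n := [seq i <- iota 0 n | `[< B i `<=` G >]].
pose U n := \big[setU/set0]_(i <- s n) B i.
have UE n : U n = \bigcup_(i in [set i | (i < n)%N /\ B i `<=` G]) B i.
  rewrite /U -bigcup_seq; apply/seteqP; split=> y [i /= si By]; exists i => //=.
    by move: si; rewrite mem_filter mem_iota add0n => /andP[/asboolP ? ?].
  case: si => iN BG; rewrite mem_filter mem_iota add0n; apply/andP; split=> //.
  exact/asboolP.
have oU n : open (U n) by rewrite UE; apply: bigcup_open => i _; exact: bB.1.
have mU n : measurable (U n : set (borel M)) by exact: open_borel.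
have [|||n mn] := @decreasing_small R _ (borel M) m (fun n => G `\` U n) (mr W / 8) _ _ _ e0.
- by move=> i; exact: measurableD.
- move=> i j ij; apply/subsetPset => y [Gy nUy]; split=> // Uy; apply: nUy.
  move: Uy; rewrite !UE => -[k [ki BG] By]; exists k => //; split=> //.
  exact: leq_trans ij.
- apply/seteqP; split=> y // GU.
  have [Gy _] := GU 0%N I.
  have [j Bj BG] := bB.2 y G (open_nbhs_nbhs (conj oG Gy)).
  by have [_] := GU j.+1 I; apply; rewrite UE; exists j.
exists (s n); rewrite -/(U n).
have UG : U n `<=` G by rewrite UE => y [i [_ BG]]; exact: BG.
have h1 : mr (G `\` F) < mr W / 8.
  by rewrite -lte_fin fineK//; apply: fin_num_measure; exact: measurableD.
have h2 : mr (G `\` U n) < mr W / 8.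
  by rewrite -lte_fin fineK//; apply: fin_num_measure; exact: measurableD.
have h3 : mr (U n `\` W) <= mr (G `\` F).
  apply: le_mr; [exact: measurableD|exact: measurableD|].
  by move=> y [Uy nWy]; split; [exact: UG|move=> Fy; exact/nWy/FW].
have h4 : mr W <= mr G by exact: le_mr.
have h5 := mrD mG (mU n).
split; first lra.
move=> A cA; have mA := closed_borel cA.
have h6 : mr (A `&` U n `&` W) / 2 <= p x (A `&` U n `&` W).
  by apply: pW => //; apply: measurableI => //; exact: measurableI.
have h7 : p x (A `&` U n `&` W) <= p x A.
  apply: le_p => //; first by apply: measurableI => //; exact: measurableI.
  by move=> y [[]].
have h8 : mr (A `&` U n) <= mr (U n `\` W) + mr (A `&` U n `&` W).
  apply: le_trans (mrD _ (measurableI _ _ (measurableI _ _ mA (mU n)) mW)) _.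
    exact: measurableI.
  rewrite lerD2r; apply: le_mr.
  - by apply: measurableD; [exact: measurableI|apply: measurableI => //; exact: measurableI].
  - exact: measurableD.
  - by move=> y [[Ay Uy] nAUW]; split=> // Wy; apply: nAUW.
lra.
Qed.

(* By Baire, the laws from all points of an open piece of K dominate m on most
   of one and the same open set. Whichever of [h >= 1/2] and [h < 1/2] covers
   half of that set then has a mass bounded below under all these laws. *)
Lemma overlap_open (K : set M) : compact K -> K !=set0 ->
  exists (U : set M) (eta : R), [/\ open U, (U `&` K) !=set0, 0 < eta <= 1 &
    forall x y (h : borel M -> R), (U `&` K) x -> (U `&` K) y -> bmeas h ->
      (forall z, 0 <= h z <= 1) ->
      \int[P]_t h (phi (x, t)) - \int[P]_t h (phi (y, t)) <= 1 - eta].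
Proof.
move=> cK K0.
have [B bB] := second_countable_base (compact_second_countable cM).
(* Every finite list of indices has a code, so the sequence [Us] runs through all finite unions of
   basic sets; a number that codes no list yields the empty one. *)
pose s (n : nat) : seq nat := odflt [::] (choice.unpickle n).
pose Us n := \big[setU/set0]_(i <- s n) B i.
have oUs n : open (Us n).
  rewrite /Us -bigcup_seq; apply: bigcup_open => i _; exact: bB.1.
have [n [U [oU UK Ud]]] : exists n U, [/\ open U, (U `&` K) !=set0 &
    U `&` K `<=` [set x | dominating (Us n) x]].
  apply: (baire_compact (F := fun n => [set x | dominating (Us n) x])) => // x Kx.
  have [sx dx] := dominating_exists x bB.
  by exists (choice.pickle sx) => //; rewrite /Us /s choice.pickleK.
have [x0 /Ud [Un0 _]] := UK.
have mUn := open_borel (oUs n).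
have Un1 : mr (Us n) <= 1.
  by rewrite -lee_fin fineK ?probability_le1//; exact: fin_num_measure.
(* A level set covering half of [Us n] gets mass at least [(1/2 - 1/4) / 2], one eighth of the mass
   of [Us n]; there [h] is on one side of [1/2], which costs another factor 2. *)
exists U, (mr (Us n) / 16); split=> //; first by apply/andP; split; lra.
move=> x y h /Ud dx /Ud dy bh h01.
pose A : set (borel M) := [set z | 2^-1 <= h z].
have mA : measurable A.
  rewrite (_ : A = h @^-1` `[2^-1, +oo[).
    by rewrite -[X in measurable X]setTI; apply: bh.1 => //; exact: measurable_itv.
  by apply/seteqP; split=> z /=; rewrite in_itv/= andbT.
have bhz z : bmeas (fun t : borel D => h (phi (z, t))) := bmeas_comp (mphi z) bh.
have b1 z (C : set (borel M)) : measurable C -> bmeas (\1_((fun t => phi (z, t)) @^-1` C) : borel D -> R).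
  by move=> mC; apply: bmeas_indic; exact: mpre.
have i1 z (C : set (borel M)) : measurable C -> \int[P]_t \1_((fun t => phi (z, t)) @^-1` C) t = p z C.
  by move=> mC; rewrite int_indic//; exact: mpre.
have hx1 : \int[P]_t h (phi (x, t)) <= 1.
  by apply: int_le_cst => // t; case/andP: (h01 (phi (x, t))).
have hy0 : 0 <= \int[P]_t h (phi (y, t)).
  by apply: int_ge_cst => // t; case/andP: (h01 (phi (y, t))).
have split_U : mr (Us n) <= mr (A `&` Us n) + mr (~` A `&` Us n).
  apply: le_trans (mrD mUn (measurableI _ _ (measurableC mA) mUn)) _.
  rewrite lerD2r; apply: le_mr.
  - by apply: measurableD => //; apply: measurableI => //; exact: measurableC.
  - exact: measurableI.
  - by move=> z [Uz nAz]; split=> //; apply: contrapT => nA; apply: nAz.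
have [AU|AU] := leP (mr (Us n) / 2) (mr (A `&` Us n)).
  have py := dominating_borel (oUs n) dy mA.
  have : 2^-1 * p y A <= \int[P]_t h (phi (y, t)).
    rewrite -(i1 _ _ mA) -intZ; last exact: b1.
    apply: le_int => // [|t]; first exact/bmeasZ/b1.
    rewrite indicE; have [/set_mem Aphi|_] := boolP (t \in _).
      by rewrite mulr1; exact: Aphi.
    by rewrite mulr0; case/andP: (h01 (phi (y, t))).
  lra.
have px := dominating_borel (oUs n) dx (measurableC mA).
have : \int[P]_t h (phi (x, t)) <= 1 - 2^-1 * p x (~` A).
  rewrite -(i1 _ _ (measurableC mA)).
  rewrite -[X in X - _](int_cst P) -intZ; last exact/b1/measurableC.
  rewrite -intB; [|exact: bmeas_cst|exact/bmeasZ/b1/measurableC].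
  apply: le_int => // [|t]; first by apply: bmeasB; [exact: bmeas_cst|exact/bmeasZ/b1/measurableC].
  rewrite indicE; have [/set_mem /= nAphi|_] := boolP (t \in _).
    rewrite mulr1; have : h (phi (x, t)) < 2^-1 by rewrite ltNge; apply/negP.
    lra.
  by rewrite mulr0 subr0; case/andP: (h01 (phi (x, t))).
lra.
Qed.

End Overlap.

(** * Minimal absorbing sets *)

Section MinimalSets.
Context (R : realType) (M : pmetricType R) (xi : R) (reach : M -> set M).
Hypothesis cM : compact [set: M].
Hypothesis xi0 : 0 < xi.
Hypothesis reach_refl : forall x, reach x x.
Hypothesis reach_closure : forall x y, closure (reach x) y ->
  reach y `<=` closure (reach x).
Hypothesis reach_ball : forall x, exists z, ball z xi `<=` reach x.

Local Notation L x := (closure (reach x)).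

Let L_sub x y : L x y -> L y `<=` L x.
Proof.
move=> Lxy; rewrite [X in _ `<=` X](closure_id _).1; last exact: closed_closure.
by apply: closure_subset; exact: reach_closure.
Qed.

Let finite_net : exists s : seq M, forall z, exists2 q, q \in s & ball z xi q.
Proof.
move: cM; rewrite compact_cover => /(_ M setT (fun q => (ball q xi)°)) [].
- by move=> q _; exact: open_interior.
- by move=> z _; exists z => //; exact: nbhsx_ballx.
move=> D _ DM; exists (enum_fset D) => z.
by have [q /= qD /interior_subset qz] := DM z I; exists q => //; exact: ball_sym.
Qed.

(* Every set L x contains a ball of radius xi, hence a point of the finite net;
   the minimal sets are therefore all of the form L q with q in the net. *)
Lemma minimal_family : exists (l : nat) (C : 'I_l -> set M),
  [/\ forall i, exists x, C i = L x,
      forall i j, i != j -> C i `&` C j = set0,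
      forall i x, C i x -> C i `<=` L x &
      forall x, exists i, C i `<=` L x].
Proof.
have [s sP] := finite_net.
pose p (i : 'I_(size s)) := nth point s i.
have netP x : exists i, L x (p i).
  have [z zx] := reach_ball x.
  have [q qs zq] := sP z.
  have qi : (index q s < size s)%N by rewrite index_mem.
  by exists (Ordinal qi); rewrite /p /= nth_index//; apply: subset_closure; exact: zx.
pose minimal i := `[< forall y, L (p i) y -> L (p i) `<=` L y >].
have below x : exists2 i, minimal i & L (p i) `<=` L x.
  (* Minimality comes from choosing the net point in [L x] whose closure contains the fewest net
     points. A net point [p j] in any smaller [L y] must have the same count, so [p i] belongs to
     [L (p j)]. *)
  pose N i := #|[pred j | `[< L (p i) (p j) >]]|.
  have [i0 Li0] := netP x.
  have [i /asboolP Li Nmin] := @arg_minnP _ i0 (fun i => `[< L x (p i) >]) N (asboolT Li0).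
  exists i; last exact: L_sub.
  apply/asboolP => y Ly; have [j Lyj] := netP y.
  have Lij : L (p i) (p j) by exact: (L_sub Ly).
  have sub_ji : [pred k | `[< L (p j) (p k) >]] \subset [pred k | `[< L (p i) (p k) >]].
    apply/fintype.subsetP => k; rewrite !finset.inE => /asboolP Ljk.
    by apply/asboolP; exact: (L_sub Lij).
  have eqN : N j = N i.
    apply/eqP; rewrite eqn_leq subset_leq_card//= Nmin//.
    by apply/asboolP; exact: (L_sub Li).
  have /(_ i) := subset_cardP eqN sub_ji.
  rewrite !finset.inE => eq_ji; have /asboolP Lji : `[< L (p j) (p i) >].
    by rewrite eq_ji; apply/asboolP; apply: subset_closure; exact: reach_refl.
  by apply: subset_trans (L_sub Lji) _; exact: (L_sub Lyj).
(* The least index is kept for each minimal set, so that different indices give different, hence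
   disjoint, sets. *)
pose rep := [set i | minimal i &&
  [forall j : 'I_(size s), (j < i)%N ==> ~~ `[< L (p j) = L (p i) >]]]%SET.
have repP i : minimal i -> exists2 j, j \in rep & L (p j) = L (p i).
  move=> mi.
  have [j /asboolP Lj jmin] := @arg_minnP _ i (fun j => `[< L (p j) = L (p i) >]) val (asboolT erefl).
  exists j => //; rewrite finset.inE; apply/andP; split.
    by move: mi => /asboolP mi; apply/asboolP; rewrite Lj.
  apply/forallP => k; apply/implyP => kj; apply/negP => /asboolP Lkj.
  by have := jmin k; rewrite leqNgt kj; apply/implyP; apply/asboolP; rewrite Lkj.
pose C (k : 'I_#|rep|) := L (p (enum_val k)).
have minC (k : 'I_#|rep|) : minimal (enum_val k).
  by have := enum_valP k; rewrite finset.inE => /andP[].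
exists #|rep|, C; split.
- by move=> i; exists (p (enum_val i)).
- move=> i j ij; apply/seteqP; split=> z // [Ciz Cjz].
  have CE k : C k z -> C k = L z.
    move=> Ckz; apply/seteqP; split; last exact: L_sub.
    by have /asboolP := minC k; exact.
  have CC : L (p (enum_val i)) = L (p (enum_val j)).
    by rewrite -/(C i) -/(C j) (CE i)// (CE j).
  have := enum_valP i; have := enum_valP j; rewrite !finset.inE.
  move=> /andP[_ /forallP/(_ (enum_val i))/implyP hj].
  move=> /andP[_ /forallP/(_ (enum_val j))/implyP hi].
  have [lij|lij|/val_inj/enum_val_inj eij] := ltngtP (enum_val i) (enum_val j).
  + by have /asboolP := hj lij.
  + by have /asboolP := hi lij; rewrite CC.
  + by rewrite eij eqxx in ij.
- by move=> i x Cix; have /asboolP := minC i; exact.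
- move=> x; have [i mi Li] := below x; have [j rj Lj] := repP i mi.
  exists (enum_rank_in rj j).
  by rewrite /C enum_rankK_in// Lj.
Qed.

End MinimalSets.

Lemma continuous_pair_for (X Y Z : topologicalType) (g : X -> Y) (h : X -> Z) x :
  {for x, continuous g} -> {for x, continuous h} ->
  {for x, continuous (fun y => (g y, h y))}.
Proof.
move=> cg ch A [[B C] /= [nB nC] BCA].
have gB : nbhs x (g @^-1` B) by exact: cg.
have hC : nbhs x (h @^-1` C) by exact: ch.
suff : nbhs x ((fun y => (g y, h y)) @^-1` A) by [].
by apply: filterS (filterI gB hC) => y [By Cy]; exact: (BCA (g y, h y)).
Qed.

(** * Noisy orbits, reachable sets and hitting events *)

Section NoisyOrbits.
Context (R : realType) (M : pmetricType R) (n : nat) (f : M -> 'rV[R]_n -> M).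
Context (a : 'rV[R]_n) (eps : {posnum R}).
Local Notation T := (noise a eps).
Local Notation Delta := (noise_seq a eps).
Local Notation X := (rand_orbit f : nat -> borel M -> borel Delta -> borel M).
Context (nu : probability (borel T) R) (nuinf : probability (borel Delta) R).
Hypothesis nuP : is_product_probability nu nuinf.
Hypothesis cM : compact [set: M].
Hypothesis f_continuous : forall x t, oball1 t ->
  {for (x, t), continuous (fun p : M * 'rV[R]_n => f p.1 p.2)}.
Hypothesis sub_oball : cball a eps%:num `<=` @oball1 R n.

Lemma noise_step_continuous : continuous (fun p : M * T => f p.1 (set_val p.2)).
Proof.
move=> [x t].
have ot : oball1 (set_val t) by apply: sub_oball; apply: set_mem; exact: (valP t).
apply: (@continuous_comp (M * T)%type (M * 'rV[R]_n)%type M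
  (fun p => (p.1, set_val p.2)) (fun p => f p.1 p.2)); last exact: f_continuous.
apply: continuous_pair_for; first exact: cvg_fst.
apply: (@continuous_comp (M * T)%type T 'rV[R]_n snd set_val).
  exact: cvg_snd.
exact: initial_continuous.
Qed.

Lemma rand_orbit_continuous k :
  continuous (fun p : M * Delta => rand_orbit f k p.1 p.2).
Proof.
elim: k => [|k ih] p /=; first exact: cvg_fst.
apply: (@continuous_comp (M * Delta)%type (M * T)%type M
  (fun p => (rand_orbit f k p.1 p.2, p.2 k)) (fun p => f p.1 (set_val p.2)));
  last exact: noise_step_continuous.
apply: continuous_pair_for; first exact: ih.
apply: (@continuous_comp (M * Delta)%type Delta T snd (fun t => t k)).
  exact: cvg_snd.
exact: noise_coord_continuous.
Qed.

Definition shift_noise k (t : Delta) : Delta := fun j => t (k + j)%N.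

Lemma rand_orbit_add k l x t :
  rand_orbit f (k + l) x t = rand_orbit f l (rand_orbit f k x t) (shift_noise k t).
Proof. by elim: l => [|l ih]; rewrite ?addn0// addnS /= ih. Qed.

Lemma rand_orbit_eq k x (t t' : Delta) : (forall j, (j < k)%N -> t j = t' j) ->
  rand_orbit f k x t = rand_orbit f k x t'.
Proof.
elim: k => // k ih tt' /=; rewrite ih ?tt'// => j jk.
by rewrite tt'// ltnW.
Qed.

Lemma rand_orbit_splice_le k j x (t t' : Delta) : (j <= k)%N ->
  rand_orbit f j x (splice k (t, t')) = rand_orbit f j x t.
Proof.
by move=> jk; apply: rand_orbit_eq => i ij; rewrite /splice (leq_trans ij jk).
Qed.

Lemma shift_splice k (t t' : Delta) : shift_noise k (splice k (t, t')) = t'.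
Proof.
by apply/funext => j; rewrite /shift_noise /splice ltnNge leq_addr/= addKn.
Qed.

Lemma metric_base : exists B : nat -> set M, is_base B.
Proof. exact: second_countable_base (compact_second_countable cM). Qed.

Lemma rand_orbit_random_orbit :
  random_orbit nuinf X
    (@splice R n a eps).
Proof.
have [B bB] := metric_base; split=> //.
- move=> k.
  exact: (continuous_prod_borel_measurable bB (@is_base_noise_seq R n a eps)
    (@rand_orbit_continuous k)).
- exact: splice_measurable_fun.
- by move=> k A; exact: splice_nuinf nuP k A.
- by move=> k j x t t'; exact: rand_orbit_splice_le.
- by move=> k l x t t'; rewrite rand_orbit_add shift_splice rand_orbit_splice_le.
Qed.

Definition reach x : set M := [set y | exists k (t : Delta), rand_orbit f k x t = y].

Lemma reach_refl x : reach x x.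
Proof. by exists 0%N, point. Qed.

(** For a fixed noise the orbit map is continuous: points close to [y] and reachable from [x] are
    carried close to the given point, and splicing the two noises reaches it from [x] in one go. *)
Lemma reach_closure x y : closure (reach x) y -> reach y `<=` closure (reach x).
Proof.
move=> xy _ [k [t <-]] B.
have ck : {for y, continuous (fun z => rand_orbit f k z t)}.
  apply: (@continuous_comp M (M * Delta)%type M (fun z => (z, t))
    (fun p => rand_orbit f k p.1 p.2)); last exact: rand_orbit_continuous.
  by apply: continuous_pair_for; [exact: cvg_id|exact: cvg_cst].
move=> /ck /xy [z [[l [s zE]] Bz]]; exists (rand_orbit f k z t); split=> //.
exists (l + k)%N, (splice l (s, t)).
by rewrite rand_orbit_add shift_splice rand_orbit_splice_le// zE.
Qed.

Lemma closure_reach_absorbing x :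
  absorbing X (closure (reach x)).
Proof. by move=> y xy k t; apply: (reach_closure xy); exists k, t. Qed.

Hypothesis f_open : forall t : T, forall U : set M, open U ->
  open [set f x (set_val t) | x in U].

Lemma rand_orbit_open k (t : Delta) (U : set M) : open U ->
  open [set rand_orbit f k x t | x in U].
Proof.
move=> oU; elim: k => [|k ih]; first by rewrite image_id.
rewrite (_ : [set _ | _ in _] = [set f x (set_val (t k)) | x in
   [set rand_orbit f k x t | x in U]]); last by rewrite image_comp.
exact: f_open.
Qed.

Lemma interior_absorbing (C : set M) :
  absorbing X C ->
  absorbing X C°.
Proof.
move=> aC x Cx k t.
have : [set rand_orbit f k y t | y in C°] `<=` C°.
  rewrite -open_subsetE; last exact/rand_orbit_open/open_interior.
  by move=> _ [y /interior_subset Cy <-]; exact: (aC y Cy k t).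
by apply; exists x.
Qed.

Lemma reach_positive x (U : set M) : (forall V : set T, open V -> V !=set0 -> (0 < nu V)%E) ->
  open U -> (U `&` closure (reach x)) !=set0 ->
  exists k, (0 < nuinf [set t : borel Delta | U (rand_orbit f k x t)])%E.
Proof.
move=> nu0 oU [y [Uy xy]].
have [_ [[k [t <-]] Uz]] := xy U (open_nbhs_nbhs (conj oU Uy)).
exists k; apply: (nuinf_open_gt0 nuP nu0); last by exists t.
apply: (open_section x (G := (fun p : M * Delta => rand_orbit f k p.1 p.2) @^-1` U)).
by move: (@rand_orbit_continuous k) => /continuousP; apply.
Qed.

Definition hits (U : set M) x : set Delta := [set t | exists k, U (rand_orbit f k x t)].

(** Openness jointly in the point and the noise is what the semicontinuity of slices asks for. *)
Lemma hits_open_graph (U : set M) : open U ->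
  open [set p : M * Delta | hits U p.1 p.2].
Proof.
move=> oU; rewrite (_ : [set _ | _] = \bigcup_k
    ((fun p : M * Delta => rand_orbit f k p.1 p.2) @^-1` U)).
  by apply: bigcup_open => k _; move: (@rand_orbit_continuous k) => /continuousP; apply.
by apply/seteqP; split=> p [k]; [exists k|move=> _ ?; exists k].
Qed.

Lemma hits_open (U : set M) x : open U -> open (hits U x).
Proof. by move=> oU; exact: (open_section x (hits_open_graph oU)). Qed.

Lemma hits_eventually (C : set M) x t :
  absorbing X C ->
  hits C x t -> exists k, forall j, (k <= j)%N -> C (rand_orbit f j x t).
Proof.
move=> aC [k Ck]; exists k => j kj.
by rewrite -(subnKC kj) rand_orbit_add; exact: (aC _ Ck).
Qed.

End NoisyOrbits.

(** * Contraction and attracting measures *)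

Section Mixing.
Context (R : realType) (M : pmetricType R) (n : nat) (f : M -> 'rV[R]_n -> M).
Context (a : 'rV[R]_n) (eps : {posnum R}).
Local Notation T := (noise a eps).
Local Notation Delta := (noise_seq a eps).
Local Notation X := (rand_orbit f : nat -> borel M -> borel Delta -> borel M).
Context (nu : probability (borel T) R) (nuinf : probability (borel Delta) R).
Hypothesis nuP : is_product_probability nu nuinf.
Hypothesis cM : compact [set: M].
Hypothesis f_continuous : forall x t, oball1 t ->
  {for (x, t), continuous (fun p : M * 'rV[R]_n => f p.1 p.2)}.
Hypothesis sub_oball : cball a eps%:num `<=` @oball1 R n.

Let RO := rand_orbit_random_orbit nuP cM f_continuous sub_oball.
Local Notation P1 := (op nuinf X 1).

Definition visit k (U : set M) (x : M) : R :=
  fine (nuinf [set t : borel Delta | U (rand_orbit f k x t)]).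

Let open_orbit_graph k (U : set M) : open U ->
  open ((fun p : M * Delta => rand_orbit f k p.1 p.2) @^-1` U).
Proof.
have := @rand_orbit_continuous R M n f a eps f_continuous sub_oball k.
by move=> /continuousP; apply.
Qed.

Let measurable_visit k (U : set (borel M)) (x : borel M) : measurable U ->
  measurable [set t : borel Delta | U (rand_orbit f k x t)].
Proof.
move=> mU; have := measurableT_comp (orbit_measurable RO k) (@measurable_pair1 _ _ (borel M) (borel Delta) x).
by move=> /(_ measurableT U mU); rewrite setTI.
Qed.

Lemma visitE k (U : set (borel M)) x : measurable U -> visit k U x = op nuinf X k \1_U x.
Proof.
move=> mU; rewrite /visit -int_indic; last exact: measurable_visit.
by apply: eq_Rintegral => t _; rewrite !indicE; congr (nat_of_bool _)%:R;
  apply/idP/idP => /set_mem h; exact/mem_set.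
Qed.

(** Visiting the open set [U] at time [k] with probability above [1/(j+1)] is an open condition on
    the starting point; compactness of [C] leaves finitely many pairs [(k, j)]. *)
Lemma uniform_visit (C U : set M) : compact C -> open U ->
  (forall x, C x -> exists k,
     (0 < nuinf [set t : borel Delta | U (rand_orbit f k x t)])%E) ->
  exists L (delta : R), 0 < delta <= 2^-1 /\
    forall x, C x -> exists2 k, (k <= L)%N & delta <= visit k U x.
Proof.
move=> cC oU Cvisit.
have mU := open_borel oU.
have finv k x : nuinf [set t : borel Delta | U (rand_orbit f k x t)] \is a fin_num.
  by apply: fin_num_measure; exact: measurable_visit.
move: cC; rewrite compact_cover => /(_ (nat * nat)%type setT (fun p =>
  [set x | (p.2.+1%:R^-1%:E <
    nuinf [set t | ((fun q : M * Delta => rand_orbit f p.1 q.1 q.2) @^-1` U) (x, t)])%E])) [].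
- by move=> p _; apply: slice_gt_open; exact: open_orbit_graph.
- move=> x /Cvisit[k]; rewrite -(fineK (finv k x)) lte_fin => v0.
  have [j] := ltr_add_invr v0; rewrite add0r => jv.
  by exists (k, j) => //=; rewrite -(fineK (finv k x)) lte_fin.
move=> D _ CD.
pose L := (\max_(p <- enum_fset D) p.1)%N; pose J := (\max_(p <- enum_fset D) p.2)%N.
(* [J.+2] instead of [J.+1] gives [delta <= 1/2], which later keeps the contraction ratios strictly
   between 0 and 1. *)
exists L, (J.+2%:R^-1); split.
  by rewrite invr_gt0 ltr0n/= lef_pV2 ?posrE// ler_nat.
move=> x /CD[[k j] /= Dkj]; rewrite -(fineK (finv k x)) lte_fin => v.
exists k; first exact: (@leq_bigmax_seq _ _ xpredT (fun p : nat * nat => p.1) (k, j)).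
apply: le_trans (ltW v); rewrite lef_pV2 ?posrE// ler_nat ltnW// !ltnS.
exact: (@leq_bigmax_seq _ _ xpredT (fun p : nat * nat => p.2) (k, j)).
Qed.

Lemma iter_op1 k (h : borel M -> R) : bmeas h -> iter k P1 h = op nuinf X k h.
Proof.
move=> bh; elim: k => [|k ih]; first by rewrite (op0 RO).
rewrite iterS ih; apply/funext => x.
by rewrite -(op_add RO 1 k x bh).
Qed.

Lemma visit_monotone k l (U : set M) x : absorbing X U -> open U -> (k <= l)%N ->
  visit k U x <= visit l U x.
Proof.
move=> aU oU kl; have mU := open_borel oU.
apply: fine_le; [exact: fin_num_measure (measurable_visit k x mU)|
  exact: fin_num_measure (measurable_visit l x mU)|].
apply: (le_measure nuinf (mem_set (measurable_visit k x mU))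
  (mem_set (measurable_visit l x mU))) => t /= Ut.
by rewrite -(subnKC kl) rand_orbit_add; exact: (aU _ Ut).
Qed.

(** From any point the orbit is in [U] at time [L] with probability at least [delta]: an earlier
    visit counts because [U] is absorbing. By the Markov property, being outside at time [L * j] has
    probability at most [(1 - delta) ^+ j]. *)
Lemma hits_full (U : set M) x : open U -> absorbing X U ->
  (forall x, exists k,
     (0 < nuinf [set t : borel Delta | U (rand_orbit f k x t)])%E) ->
  nuinf (~` hits f U x) = 0%E.
Proof.
move=> oU aU Uvisit; have mU := open_borel oU.
have [L [delta [/andP[d0 d1] Lv]]] := uniform_visit cM oU (fun x _ => Uvisit x).
pose w : borel M -> R := \1_(~` U).
have bw : bmeas w by apply: bmeas_indic; exact: measurableC.
have mP := markov_op_iter L (markov_op_op1 RO).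
have visitC k y : op nuinf X k w y = 1 - visit k U y.
  rewrite visitE// -[X in X - _](int_cst nuinf) -intB;
    [|exact: bmeas_cst|exact/(bmeas_orbit RO)/bmeas_indic].
  apply: eq_Rintegral => t _; rewrite /w !indicE in_setC.
  by case: (_ \in _); rewrite ?subrr ?subr0.
have Pw y : op nuinf X L w y <= (1 - delta) * w y.
  rewrite /w indicE in_setC; have [/set_mem Uy|_] := boolP (y \in U).
    rewrite mulr0; apply: int_le_cst => [|t]; first exact: (bmeas_orbit RO).
    by rewrite indicE in_setC mem_set//; exact: (aU _ Uy).
  rewrite mulr1 visitC lerD2l lerN2.
  have [k kL] := Lv y I; move=> /le_trans; apply; exact: visit_monotone.
have Pjw j y : op nuinf X (L * j) w y <= (1 - delta) ^+ j.
  suff H : op nuinf X (L * j) w y <= (1 - delta) ^+ j * w y.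
    apply: le_trans H _; rewrite ler_piMr ?exprn_ge0//; first lra.
    by case/andP: (indic_01 R (~` U) y).
  elim: j y => [|j ih] y; first by rewrite muln0 (op0 RO) mul1r.
  rewrite mulnS (op_add RO _ _ _ bw).
  apply: (@le_trans _ _ (op nuinf X L (fun z => (1 - delta) ^+ j * w z) y)).
    apply: le_int => [||t]; last exact: ih.
      exact: (bmeas_orbit RO L y (bmeas_op RO (L * j) bw)).
    exact: (bmeas_orbit RO L y (bmeasZ ((1 - delta) ^+ j) bw)).
  rewrite /op intZ; last exact: (bmeas_orbit RO L y bw).
  rewrite exprSr -mulrA ler_wpM2l ?exprn_ge0//; first lra.
  exact: Pw.
have mH : measurable (~` hits f U x : set (borel Delta)).
  apply: measurableC; apply: sub_sigma_algebra.
  exact: (hits_open f_continuous sub_oball).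
rewrite -(fineK (fin_num_measure nuinf _ mH)); congr (_%:E).
apply/esym; apply: (geometric_unique (r := 1 - delta) (K := 1)).
  by apply/andP; split; lra.
move=> j; rewrite sub0r normrN ger0_norm ?fine_ge0// mul1r.
apply: le_trans (Pjw j x); rewrite visitC /visit.
have mV := measurable_visit (L * j) x mU.
have -> : 1 - fine (nuinf [set t : borel Delta | U (rand_orbit f (L * j) x t)]) =
    fine (nuinf (~` [set t : borel Delta | U (rand_orbit f (L * j) x t)])).
  by rewrite probability_setC// fineB//; exact: fin_num_measure mV.
apply: fine_le; [exact: fin_num_measure mH|exact: fin_num_measure (measurableC mV)|].
apply: (le_measure nuinf (mem_set mH) (mem_set (measurableC mV))) => t nh Ut.
by apply: nh; exists (L * j)%N.
Qed.

End Mixing.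

Section AttractorMeasure.
Context (R : realType) (M : pmetricType R) (n : nat) (f : M -> 'rV[R]_n -> M).
Context (a : 'rV[R]_n) (eps : {posnum R}).
Local Notation T := (noise a eps).
Local Notation Delta := (noise_seq a eps).
Local Notation X := (rand_orbit f : nat -> borel M -> borel Delta -> borel M).
Context (nu : probability (borel T) R) (nuinf : probability (borel Delta) R).
Context (m : probability (borel M) R) (K : nat).
Hypothesis nuP : is_product_probability nu nuinf.
Hypothesis nu0 : forall V : set T, open V -> V !=set0 -> (0 < nu V)%E.
Hypothesis cM : compact [set: M].
Hypothesis f_continuous : forall x t, oball1 t ->
  {for (x, t), continuous (fun p : M * 'rV[R]_n => f p.1 p.2)}.
Hypothesis sub_oball : cball a eps%:num `<=` @oball1 R n.
Hypothesis orbit_null : forall x (A : set (borel M)), measurable A -> m A = 0%E ->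
  nuinf [set t : borel Delta | A (rand_orbit f K x t)] = 0%E.

Let RO := rand_orbit_random_orbit nuP cM f_continuous sub_oball.
Local Notation P1 := (op nuinf X 1).

(* Orbits may need different times to visit the set on which laws overlap, which
   is why the operator averages over the first times. *)
Definition mixing L := mix L (fun k => iter (k + K) P1).

Let mP k : markov_op nuinf X (iter k P1).
Proof. exact/markov_op_iter/(markov_op_op1 RO). Qed.

Lemma markov_op_mixing L : markov_op nuinf X (mixing L).
Proof. by apply: (markov_op_mix RO) => k; exact: mP. Qed.

Lemma mixingE L (h : borel M -> R) x : bmeas h ->
  mixing L h x = L.+1%:R^-1 * \sum_(k < L.+1) op nuinf X k (op nuinf X K h) x.
Proof.
move=> bh; rewrite /mixing /mix; congr (_ * _); apply: eq_bigr => k _.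
rewrite (iter_op1 nuP cM f_continuous sub_oball (k + K) bh).
exact: (op_add RO).
Qed.

(** Each term of the average ends with [K] steps, whose law from any point does not charge [m]-null
    sets. *)
Lemma mixing_null L (A : set (borel M)) x : measurable A -> m A = 0%E ->
  mixing L \1_A x = 0.
Proof.
move=> mA mA0; rewrite mixingE; last exact: bmeas_indic.
have opK y : op nuinf X K \1_A y = 0.
  by rewrite -(visitE nuP cM f_continuous sub_oball)// /visit orbit_null.
rewrite big1 ?mulr0// => k _.
by rewrite /op; under eq_Rintegral do rewrite -/(op nuinf X K \1_A _) opK; rewrite int_cst.
Qed.

Lemma mixing_harmonic L (h : borel M -> R) : bmeas h -> P1 h = h -> mixing L h = h.
Proof.
move=> bh hh; apply/funext => x; rewrite /mixing /mix.
have iterh k : iter k P1 h = h by elim: k => // k ih; rewrite iterS ih.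
under eq_bigr do rewrite iterh.
by rewrite sumr_const card_ord -[h x *+ _]mulr_natl mulKf// pnatr_eq0.
Qed.

Section Contraction.
Context (C : set M).
Hypothesis cC : closed C.
Hypothesis C0 : C !=set0.
Hypothesis aC : absorbing X C.
Hypothesis minC : forall x, C x -> C `<=` closure (@reach R M n f a eps x).

Lemma mixing_contraction : exists L (r : R), 0 < r < 1 /\
  forall (h : borel M -> R) x y, bmeas h -> (forall z, 0 <= h z <= 1) ->
    C x -> C y -> mixing L h x - mixing L h y <= r.
Proof.
have kC : compact C by apply: (subclosed_compact cC cM).
have cK := @rand_orbit_continuous R M n f a eps f_continuous sub_oball K.
have [||U [eta [oU [z0 [Uz0 Cz0]] /andP[eta0 eta1] overlap]]] := @overlap_open R M Delta m nuinf
  (fun p => rand_orbit f K p.1 p.2) cM cK _ _ C kC C0.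
- move=> x; exact: (measurableT_comp (orbit_measurable RO K)
    (@measurable_pair1 _ _ (borel M) (borel Delta) x)).
- by move=> x A mA mA0; exact: orbit_null.
have [|L [delta [/andP[d0 d1] visitU]]] :=
  uniform_visit nuP cM f_continuous sub_oball kC oU.
  move=> x Cx; apply: (reach_positive nuP f_continuous sub_oball nu0 oU).
  by exists z0; split=> //; exact: (minC Cx).
have L0 : 0 < L.+1%:R^-1 :> R by rewrite invr_gt0.
have L1 : L.+1%:R^-1 <= 1 :> R by rewrite invf_le1// ler1n.
pose q := L.+1%:R^-1 * (delta * eta).
have q0 : 0 < q by rewrite !mulr_gt0.
have q1 : q <= 2^-1.
  have de : delta * eta <= 2^-1 by rewrite (le_trans _ d1)// ler_piMr// ltW.
  by rewrite /q (le_trans _ de)// ler_piMl// mulr_ge0// ltW.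
exists L, (1 - q); split; first by apply/andP; split; lra.
move=> h x y bh h01 Cx Cy.
have mU := open_borel oU.
pose g := op nuinf X K h.
have bg : bmeas g by exact: (bmeas_op RO).
have g01 z : 0 <= g z <= 1.
  apply/andP; split.
    by apply: int_ge_cst => [|t]; [exact: (bmeas_orbit RO)|case/andP: (h01 (X K z t))].
  by apply: int_le_cst => [|t]; [exact: (bmeas_orbit RO)|case/andP: (h01 (X K z t))].
have gosc u v : (U `&` C) u -> (U `&` C) v -> g u - g v <= 1 - eta.
  by move=> UCu UCv; exact: overlap.
have gUC0 : has_inf (g @` (U `&` C)).
  split; first by exists (g z0), z0.
  by exists 0 => _ [z _ <-]; case/andP: (g01 z).
pose c := inf (g @` (U `&` C)).
have c0 : 0 <= c.
  by apply: lb_le_inf; [exact: gUC0.1|move=> _ [z _ <-]; case/andP: (g01 z)].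
have cg z : (U `&` C) z -> c <= g z.
  by move=> UCz; apply: ge_inf; [exact: gUC0.2|exists z].
have gc z : (U `&` C) z -> g z <= c + (1 - eta).
  move=> UCz; rewrite -lerBlDr; apply: lb_le_inf; first exact: gUC0.1.
  by move=> _ [w UCw <-]; rewrite lerBlDr -lerBlDl; exact: gosc.
have opg01 k z : 0 <= op nuinf X k g z <= 1.
  apply/andP; split.
    by apply: int_ge_cst => [|t]; [exact: (bmeas_orbit RO)|case/andP: (g01 (X k z t))].
  by apply: int_le_cst => [|t]; [exact: (bmeas_orbit RO)|case/andP: (g01 (X k z t))].
have b1 k z : bmeas (fun t => \1_U (X k z t) : R).
  exact: (bmeas_orbit RO k z (bmeas_indic mU)).
have op_ge k z : C z -> c * visit (a := a) (eps := eps) f nuinf k U z <= op nuinf X k g z.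
  move=> Cz; rewrite (visitE nuP cM f_continuous sub_oball)// -intZ//.
  apply: le_int => [||t]; [exact: bmeasZ|exact: (bmeas_orbit RO)|].
  rewrite indicE; have [/set_mem Ut|_] := boolP (_ \in U).
    by rewrite mulr1; apply: cg; split=> //; exact: (aC Cz).
  by rewrite mulr0; case/andP: (g01 (X k z t)).
have op_le k z : C z -> op nuinf X k g z <= 1 - (eta - c) * visit (a := a) (eps := eps) f nuinf k U z.
  move=> Cz; rewrite (visitE nuP cM f_continuous sub_oball)// -intZ//.
  rewrite -[X in X - _](int_cst nuinf) -intB; [|exact: bmeas_cst|exact: bmeasZ].
  apply: le_int => [||t]; [exact: (bmeas_orbit RO)|by apply: bmeasB; [exact: bmeas_cst|exact: bmeasZ]|].
  rewrite indicE; have [/set_mem Ut|_] := boolP (_ \in U).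
    rewrite mulr1; have : g (X k z t) <= c + (1 - eta) by apply: gc; split=> //; exact: (aC Cz).
    lra.
  by rewrite mulr0 subr0; case/andP: (g01 (X k z t)).
have Q_ge : L.+1%:R^-1 * (delta * c) <= mixing L h y.
  rewrite mixingE// ler_pM2l//; have [k kL vk] := visitU y Cy.
  rewrite (bigD1 (Ordinal (kL : (k < L.+1)%N)))//= -/g.
  apply: (@le_trans _ _ (op nuinf X k g y)).
    apply: le_trans (op_ge k y Cy); rewrite mulrC ler_wpM2l//.
  by rewrite lerDl sumr_ge0// => i _; case/andP: (opg01 i y).
have Q_le01 : mixing L h x <= 1.
  rewrite mixingE// ler_pdivrMl// mulr1.
  apply: (@le_trans _ _ (\sum_(k < L.+1) (1 : R))).
    by apply: ler_sum => k _; case/andP: (opg01 k x).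
  by rewrite sumr_const card_ord.
have Q_le : c <= eta -> mixing L h x <= 1 - L.+1%:R^-1 * (delta * (eta - c)).
  move=> ceta; have [k kL vk] := visitU x Cx.
  rewrite mixingE// ler_pdivrMl// mulrBr mulr1 mulVKf ?pnatr_eq0//.
  rewrite (bigD1 (Ordinal (kL : (k < L.+1)%N)))//= -/g.
  have -> : L.+1%:R - delta * (eta - c) = (1 - delta * (eta - c)) + L%:R.
    by rewrite -natr1; ring.
  apply: lerD.
    apply: le_trans (op_le k x Cx) _; rewrite lerD2l lerN2 [delta * _]mulrC.
    by rewrite ler_wpM2l// subr_ge0.
  apply: (@le_trans _ _ (\sum_(i < L.+1 | i != Ordinal (kL : (k < L.+1)%N)) (1 : R))).
    by apply: ler_sum => i _; case/andP: (opg01 i x).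
  by rewrite sumr_const cardC1 card_ord.
have qE : L.+1%:R^-1 * (delta * (eta - c)) + L.+1%:R^-1 * (delta * c) = q.
  by rewrite -mulrDr -mulrDr subrK.
(* When [c] exceeds [eta], the upper estimate says nothing, but the lower one already exceeds
   [q]. *)
have [ceta|etac] := leP c eta.
  by apply: le_trans (lerB (Q_le ceta) Q_ge) _; rewrite -addrA -opprD qE.
apply: lerB => //; apply: le_trans Q_ge.
by rewrite /q !ler_pM2l// ltW.
Qed.

End Contraction.
End AttractorMeasure.

(** * Continuous observables through countably many indicators *)

Section CompactMetric.
Context (R : realType) (M : pmetricType R).
Hypothesis cM : compact [set: M].

Lemma compact_uniform_continuous (phi : M -> R) (e : R) : continuous phi -> 0 < e ->
  exists N, forall x y, ball x (N.+1%:R^-1 : R) y -> `|phi x - phi y| < e.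
Proof.
move=> cphi e0.
pose W n := [set x | forall y, ball x (n.+1%:R^-1 : R) y -> `|phi x - phi y| < e].
have leW i j : (i <= j)%N -> W i `<=` W j.
  move=> ij x Wx y xy; apply: Wx; apply: le_ball xy.
  by rewrite lef_pV2 ?posrE// ler_nat ltnS.
move: cM; rewrite compact_cover => /(_ nat setT (fun n => (W n)°)) [].
- by move=> n _; exact: open_interior.
- move=> x _.
  have e20 : 0 < e / 2 by rewrite divr_gt0.
  have /nbhs_ballP[d /= d0 xd] : nbhs x [set y | `|phi x - phi y| < e / 2].
    by move/cvgrPdist_lt: (cphi x) => /(_ _ e20).
  have d20 : 0 < d / 2 by rewrite divr_gt0.
  have [n] := ltr_add_invr d20; rewrite add0r => nd.
  exists n => //; apply/nbhs_ballP; exists (d / 2) => //= y xy z yz.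
  rewrite -(subrKA (phi x)) (le_lt_trans (ler_normD _ _))// (splitr e) ltrD//.
    rewrite distrC; apply: xd; apply: le_ball xy; lra.
  apply: xd; rewrite /= (splitr d); apply: ball_triangle xy _.
  exact: le_ball (ltW nd) _ yz.
move=> D _ DM; exists (\max_(i <- enum_fset D) i)%N => x.
have [i /= iD /interior_subset Wi] := DM x I.
by apply: leW Wi; exact: (@leq_bigmax_seq _ _ xpredT id).
Qed.

Lemma continuous_bmeas (phi : M -> R) : continuous phi -> bmeas (phi : borel M -> R).
Proof.
move=> cphi; split.
  apply: (measurability _ (RGenOInfty.measurableE R)) => _ [_ [x ->] <-].
  rewrite setTI; apply: open_borel; move/continuousP: cphi; apply.
  exact: interval_open.
have [B [_ hB]] := compact_bounded (continuous_compact (continuous_subspaceT cphi) cM).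
by exists (B + 1) => x; apply: (hB (B + 1)); [rewrite ltrDl|exists x].
Qed.

(** Step functions on these cells approximate every continuous function uniformly. Since there are
    countably many cells, almost sure convergence of their averages yields a null set independent of
    the observable. *)
Lemma fine_partitions : exists (l : nat -> nat) (c : nat -> nat -> M)
    (A : nat -> nat -> set (borel M)),
  [/\ forall N i, measurable (A N i),
      forall N i z, A N i z -> ball z (N.+1%:R^-1 : R) (c N i),
      forall N z, exists2 i, (i < l N)%N & A N i z &
      forall N i j z, A N i z -> A N j z -> i = j].
Proof.
have /choice[s sP] N : exists s : seq M, forall z, exists2 q, q \in s & (ball q (N.+1%:R^-1 : R))° z.
  move: cM; rewrite compact_cover => /(_ M setT (fun q => (ball q (N.+1%:R^-1 : R))°)) [].
  - by move=> q _; exact: open_interior.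
  - by move=> z _; exists z => //; apply: nbhsx_ballx; rewrite invr_gt0.
  move=> D _ DM; exists (enum_fset D) => z.
  by have [q /= qD qz] := DM z I; exists q.
pose c N i := nth point (s N) i.
pose B N i : set (borel M) := (ball (c N i) (N.+1%:R^-1 : R))°.
have mB N i : measurable (B N i) by apply: open_borel; exact: open_interior.
exists (fun N => size (s N)), c, (fun N => seqDU (B N)); split.
- by move=> N i; exact: seqDU_measurable.
- move=> N i z /(@subset_seqDU _ (B N) i z) Bz.
  by apply: ball_sym; move: Bz; exact: interior_subset.
- move=> N z.
  have : (\big[setU/set0]_(k < size (s N)) seqDU (B N) k) z.
    rewrite -bigsetU_seqDU -bigcup_mkord; have [q qs qz] := sP N z.
    exists (index q (s N)) => /=; first by rewrite index_mem.
    by rewrite /B /c nth_index.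
  by rewrite -bigcup_mkord => -[i /= il Az]; exists i.
- by move=> N i j z Ai Aj; apply: (@trivIset_seqDU _ (B N)) => //; exists z.
Qed.

Section Averages.
Context dW (W : measurableType dW) (X : nat -> borel M -> W -> borel M).

Let averageD (h g : borel M -> R) n x t :
  average X (fun z => h z + g z) n x t = average X h n x t + average X g n x t.
Proof. by rewrite /average big_split/= mulrDr. Qed.

Let average_le (h : borel M -> R) (e : R) n x t : (forall z, `|h z| <= e) ->
  `|average X h n x t| <= e.
Proof.
move=> he; rewrite /average normrM ger0_norm ?invr_ge0//.
have [->|n0] := posnP n; first by rewrite invr0 mul0r (le_trans _ (he point)).
rewrite ler_pdivrMl ?ltr0n//.
apply: le_trans (ler_norm_sum _ _ _) _.
apply: le_trans (ler_sum _ (fun j _ => he _)) _.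
by rewrite sumr_const card_ord mulr_natl.
Qed.

Lemma average_cvg_partition (l : nat -> nat) (c : nat -> nat -> M)
    (A : nat -> nat -> set (borel M)) (mu : probability (borel M) R) x t :
  (forall N i, measurable (A N i)) ->
  (forall N i z, A N i z -> ball z (N.+1%:R^-1 : R) (c N i)) ->
  (forall N z, exists2 i, (i < l N)%N & A N i z) ->
  (forall N i j z, A N i z -> A N j z -> i = j) ->
  (forall N i, (fun n => average X \1_(A N i) n x t) @ \oo --> fine (mu (A N i))) ->
  forall phi : M -> R, continuous phi ->
    (fun n => average X phi n x t) @ \oo --> \int[mu]_z phi z.
Proof.
move=> mA Ac Acov Auniq Acvg phi cphi; apply/cvgrPdist_le => e e0.
have e30 : 0 < e / 3 by rewrite divr_gt0.
have [N phiN] := compact_uniform_continuous cphi e30.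
pose psi z : R := \sum_(i < l N) phi (c N i) * \1_(A N i) z.
have psiE z : `|phi z - psi z| <= e / 3.
  have [i il Az] := Acov N z.
  have -> : psi z = phi (c N i).
    rewrite /psi (bigD1 (Ordinal il))//= indicE mem_set// mulr1 big1 ?addr0// => j ji.
    rewrite indicE memNset ?mulr0// => Ajz; move/eqP: ji; apply.
    exact/val_inj/(Auniq N _ _ z).
  by apply: ltW; apply: phiN; exact: Ac.
have bphi := continuous_bmeas cphi.
have b1 i : bmeas (fun z => phi (c N i) * \1_(A N i) z) by apply: bmeasZ; exact: bmeas_indic.
have bpsi : bmeas (psi : borel M -> R) by apply: bmeas_sum => i; exact: b1.
have i1 : `|\int[mu]_z phi z - \int[mu]_z psi z| <= e / 3.
  by rewrite -intB//; apply: int_norm_le => //; exact: bmeasB.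
have psi_cvg : (fun n => average X psi n x t) @ \oo --> \int[mu]_z psi z.
  rewrite int_sum//.
  rewrite (eq_bigr (fun i : 'I_(l N) => phi (c N i) * fine (mu (A N i)))); last first.
    by move=> i _; rewrite intZ ?int_indic//; exact: bmeas_indic.
  rewrite (_ : (fun n => _) = (fun n => \sum_(i < l N) phi (c N i) *
      average X \1_(A N i) n x t)).
    by apply: cvg_sumr => i; apply: cvgMl_tmp; exact: Acvg.
  apply/funext => n; rewrite /average /psi exchange_big/= mulr_sumr.
  by apply: eq_bigr => i _; rewrite -mulr_sumr mulrCA.
move/cvgrPdist_le: psi_cvg => /(_ _ e30); apply: filterS => n i2.
have i3 : `|average X (fun z => phi z - psi z) n x t| <= e / 3 by exact: average_le.
have e1 : average X phi n x t = average X (fun z => phi z - psi z) n x t + average X psi n x t.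
  by rewrite -averageD; congr average; apply/funext => z; rewrite subrK.
rewrite e1; move: i1 i2 i3; rewrite !ler_norml => /andP[? ?] /andP[? ?] /andP[? ?].
apply/andP; split; lra.
Qed.

End Averages.
End CompactMetric.

Lemma int_swap (R : realType) d1 d2 (T1 : measurableType d1) (T2 : measurableType d2)
    (P1 : probability T1 R) (P2 : probability T2 R) (F : T1 * T2 -> R) : bmeas F ->
  \int[P1]_x \int[P2]_y F (x, y) = \int[P2]_y \int[P1]_x F (x, y).
Proof.
move=> bF; have := Fubini (prod_integrable P1 P2 bF).
have bF' : bmeas (F \o (fun p : T2 * T1 => (p.2, p.1))).
  by apply: bmeas_comp => //; exact: measurable_swap.
have bF2 y : bmeas (fun x => F (x, y)) by exact: (bmeas_prod1 bF' y).
under eq_integral do rewrite (bmeas_intE P2 (bmeas_prod1 bF _)).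
under [X in _ = X]eq_integral do rewrite (bmeas_intE P1 (bF2 _)).
rewrite (bmeas_intE P1 (bmeas_int1 P2 bF)) (bmeas_intE P2 (bmeas_int1 P1 bF')).
by case.
Qed.

Lemma int_zero_on (R : realType) d (T : measurableType d) (P : probability T R)
    (C : set T) (h : T -> R) : measurable C -> P C = 1%E -> bmeas h ->
  (forall x, C x -> h x = 0) -> \int[P]_x h x = 0.
Proof.
move=> mC PC bh h0; have [_ [B hB]] := bh.
have B0 : 0 <= B by rewrite (le_trans _ (hB point)).
have mC' := measurableC mC.
have bC : bmeas (fun x => B * \1_(~` C) x) by apply: bmeasZ; exact: bmeas_indic.
have IC : \int[P]_x (B * \1_(~` C) x) = 0.
  rewrite intZ ?int_indic//; last exact: bmeas_indic.
  by rewrite probability_setC// PC subee//= mulr0.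
have hle x : `|h x| <= B * \1_(~` C) x.
  rewrite indicE in_setC; have [/set_mem Cx|_] := boolP (x \in C).
    by rewrite h0// normr0 mulr0.
  by rewrite mulr1.
apply/eqP; rewrite eq_le; apply/andP; split.
  by rewrite -IC; apply: le_int => // x; exact: le_trans (ler_norm _) (hle x).
rewrite -oppr0 -IC -mulN1r -intZ//; apply: le_int => // [|x]; first exact: bmeasZ.
by have := hle x; rewrite ler_norml mulN1r => /andP[].
Qed.

(** * The measure carried by a minimal set *)

Section Attractors.
Context (R : realType) (M : pmetricType R) (n : nat) (f : M -> 'rV[R]_n -> M).
Context (a : 'rV[R]_n) (eps : {posnum R}).
Local Notation T := (noise a eps).
Local Notation Delta := (noise_seq a eps).
Local Notation X := (rand_orbit f : nat -> borel M -> borel Delta -> borel M).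
Context (nu : probability (borel T) R) (nuinf : probability (borel Delta) R).
Context (m : probability (borel M) R) (K : nat).
Hypothesis nuP : is_product_probability nu nuinf.
Hypothesis nu0 : forall V : set T, open V -> V !=set0 -> (0 < nu V)%E.
Hypothesis cM : compact [set: M].
Hypothesis f_continuous : forall x t, oball1 t ->
  {for (x, t), continuous (fun p : M * 'rV[R]_n => f p.1 p.2)}.
Hypothesis sub_oball : cball a eps%:num `<=` @oball1 R n.
Hypothesis orbit_null : forall x (A : set (borel M)), measurable A -> m A = 0%E ->
  nuinf [set t : borel Delta | A (rand_orbit f K x t)] = 0%E.

Let RO := rand_orbit_random_orbit nuP cM f_continuous sub_oball.

(** The first noise has law [nu], so the one-step operator integrates [f] against [nu]; Fubini
    restores the order of integration of [stationary]. *)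
Lemma stationary_op (mu : probability (borel M) R) :
  (forall h : borel M -> R, bmeas h ->
    \int[mu]_x op nuinf X 1 h x = \int[mu]_x h x) ->
  stationary f nu mu.
Proof.
move=> muP phi cphi; have bphi := continuous_bmeas cM cphi.
have [B bB] := metric_base cM.
pose F (p : borel T * borel M) : R := phi (f p.2 (set_val p.1)).
have bF : bmeas F.
  apply: (bmeas_comp (phi := fun p : borel T * borel M => f p.2 (set_val p.1) : borel M)) bphi.
  apply: (continuous_prod_borel_measurable (@is_base_noise R n a eps) bB
    (f := fun p : T * M => f p.2 (set_val p.1))) => -[t x].
  apply: (@continuous_comp (T * M)%type (M * T)%type M (fun p => (p.2, p.1))
    (fun p => f p.1 (set_val p.2))).
    by apply: continuous_pair_for; [exact: cvg_snd|exact: cvg_fst].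
  exact: noise_step_continuous.
transitivity (\int[nu]_t (\int[mu]_z F (t, z))%:E)%E.
  by apply: eq_integral => t _; rewrite -bmeas_intE//; exact: (bmeas_prod1 bF t).
rewrite (bmeas_intE nu (bmeas_int1 mu bF)) (bmeas_intE mu bphi); congr (_%:E).
rewrite (int_swap nu mu bF) -(muP phi bphi); apply: eq_Rintegral => z _.
have bFz : bmeas (fun t : borel T => F (t, z)).
  exact: (bmeas_comp (@measurable_pair2 _ _ (borel T) (borel M) z) bF).
apply: etrans (int_map (phi := (fun t : borel Delta => (t 0%N : borel T))) _
  (nuinf_head nuP) bFz) _ => //.
exact: (continuous_borel_measurable (@noise_coord_continuous R n a eps 0%N)).
Qed.

Lemma skew_iter k (x : M) (s : Delta) :
  iter k (Defs.skew f) ((x, s) : borel M * borel Delta) = (rand_orbit f k x s, shift_noise k s).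
Proof.
elim: k => [|k IHk] //; rewrite iterS IHk /Defs.skew /= /shift_noise addn0; congr pair.
by apply/funext => j; rewrite addnS.
Qed.

Lemma skew_splice k (x : M) (t t' : Delta) :
  iter k (Defs.skew f) ((x, splice k (t, t')) : borel M * borel Delta) = (rand_orbit f k x t, t').
Proof. by rewrite skew_iter rand_orbit_splice_le// shift_splice. Qed.

Lemma attractor_measure (C : set M) : closed C -> C !=set0 -> absorbing X C ->
  (forall x, C x -> C `<=` closure (@reach R M n f a eps x)) ->
  exists mu : probability (borel M) R,
    [/\ mu C = 1%E, mu `<< m, stationary_ergodic f nu nuinf mu &
     forall x, {ae nuinf, forall t,
       (exists k, forall j, (k <= j)%N -> C (rand_orbit f j x t)) ->
       averages_to f mu x t}].
Proof.
move=> cC C0 aC minC.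
have [L [r [r01 contr]]] :=
  mixing_contraction nuP nu0 cM f_continuous sub_oball orbit_null cC C0 aC minC.
have mQ := markov_op_mixing K nuP cM f_continuous sub_oball L.
have mC := closed_borel cC.
have [mu limP] := limit_measure_exists mQ aC mC C0 r01 contr.
exists mu; split.
- exact: (limit_measure_support mQ aC mC C0 r01 limP).
- apply/null_content_dominatesP => A mA mA0.
  apply: (limit_measure_null mQ aC C0 r01 limP mA) => x _.
  exact: (mixing_null nuP cM f_continuous sub_oball orbit_null).
- split.
    apply: stationary_op => h bh.
    exact: (limit_measure_stationary RO mQ aC C0 r01 limP bh).
  apply: (skew_invariant_01 RO aC C0 r01 limP _ _ (@borel_noise_seqE R n a eps)
    (@cylinders_setI R n a eps) (@cylinders_setT R n a eps)).
  + by move=> h bh hh; exact: mixing_harmonic.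
  + by move=> k x t t'; exact: skew_splice.
  + move=> _ [k [A [_ ->]]]; exists k => t t'.
    by split=> tA i ik; have := tA i ik; rewrite /splice ik.
- move=> x.
  have [l [c [A [mA Ac Acov Auniq]]]] := fine_partitions cM.
  (* The null set is fixed here, before any observable [phi] is chosen. *)
  have : {ae nuinf, forall t, forall N i,
      (exists k, forall j, (k <= j)%N -> C (rand_orbit f j x t)) ->
      (fun k => average X \1_(A N i) k x t) @ \oo --> \int[mu]_y \1_(A N i) y}.
    apply/ae_foralln => N; apply/ae_foralln => i.
    exact: (limit_measure_average mQ r01 limP x (bmeas_indic (mA N i)) (indic_01 R (A N i))).
  apply: filterS; first exact: (ae_filter_ringOfSetsType nuinf).
  move=> t At Ct phi cphi.
  have avg N i : (fun k => average X \1_(A N i) k x t) @ \oo --> fine (mu (A N i)).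
    by rewrite -int_indic//; exact: At.
  exact: (average_cvg_partition cM mA Ac Acov Auniq avg cphi).
Qed.

End Attractors.

Section SeparateSupports.
Context (R : realType) (M : pmetricType R).
Hypothesis cM : compact [set: M].

Lemma supp_sub_closed (mu : probability (borel M) R) (C : set M) :
  closed C -> mu C = 1%E -> supp mu `<=` C.
Proof.
move=> cC muC x sx; apply: contrapT => nCx.
have := sx _ (closed_openC cC) nCx.
by rewrite probability_setC ?muC ?subee ?ltxx//; exact: closed_borel.
Qed.

(** A Urysohn function of the two carriers, which shows later that no orbit can average to two of
    the measures. *)
Lemma separating_integral (mu mu' : probability (borel M) R) (C C' : set M) :
  closed C -> closed C' -> C `&` C' = set0 -> mu C = 1%E -> mu' C' = 1%E ->
  exists phi : M -> R, [/\ continuous phi, \int[mu]_x phi x = 0 &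
    \int[mu']_x phi x = 1].
Proof.
move=> cC cC' CC' muC muC'.
have /(@uniform_separatorP _ R)[phi [cphi _ phi0 phi1]] :=
  (@normal_separatorP R M).1 pseudometric_normal C C' cC cC' CC'.
have bphi := continuous_bmeas cM cphi.
exists phi; split=> //.
  by apply: (int_zero_on (closed_borel cC) muC bphi) => x Cx; apply: phi0; exists x.
have : \int[mu']_x (phi x - 1) = 0.
  apply: (int_zero_on (closed_borel cC') muC') => [|x Cx].
    exact: (bmeasB bphi (bmeas_cst 1)).
  by apply/eqP; rewrite subr_eq0; apply/eqP/phi1; exists x.
by rewrite (intB _ bphi (bmeas_cst 1)) int_cst => /eqP; rewrite subr_eq0 => /eqP.
Qed.

End SeparateSupports.

(** * Decomposition of the noise space by the absorbing sets *)

Section Decomposition.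
Context (R : realType) (M : pmetricType R) (n : nat) (f : M -> 'rV[R]_n -> M).
Context (a : 'rV[R]_n) (eps : {posnum R}).
Local Notation T := (noise a eps).
Local Notation Delta := (noise_seq a eps).
Local Notation X := (rand_orbit f : nat -> borel M -> borel Delta -> borel M).
Context (nu : probability (borel T) R) (nuinf : probability (borel Delta) R).
Hypothesis nuP : is_product_probability nu nuinf.
Hypothesis nu0 : forall V : set T, open V -> V !=set0 -> (0 < nu V)%E.
Hypothesis cM : compact [set: M].
Hypothesis f_continuous : forall x t, oball1 t ->
  {for (x, t), continuous (fun p : M * 'rV[R]_n => f p.1 p.2)}.
Hypothesis sub_oball : cball a eps%:num `<=` @oball1 R n.
Context (l : nat) (U : 'I_l -> set M).
Hypothesis oU : forall i, open (U i).
Hypothesis aU : forall i, absorbing X (U i).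
Hypothesis disjU : forall i j, i != j -> U i `&` U j = set0.
Hypothesis covU : forall x, exists i, (U i `&` closure (@reach R M n f a eps x)) !=set0.
Local Notation V i x := (hits f (U i) x : set Delta).

Lemma hits_disjoint i j x : i != j -> V i x `&` V j x = set0.
Proof.
move=> ij; apply/seteqP; split=> // t [/(hits_eventually (@aU i))[k kU]].
move=> /(hits_eventually (@aU j))[k' kU'].
have : (U i `&` U j) (rand_orbit f (maxn k k') x t).
  by split; [apply: kU; exact: leq_maxl|apply: kU'; exact: leq_maxr].
by rewrite disjU.
Qed.

Lemma hits_cover x : nuinf (~` \bigcup_i V i x) = 0%E.
Proof.
(* Hitting some [U i] means hitting their union, which is itself open, absorbing and visited with
   positive probability from every point. *)
rewrite (_ : \bigcup_i _ = hits f (\bigcup_i U i) x); last first.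
  apply/seteqP; split=> [t [i _ [k Uk]]|t [k [i _ Uk]]]; first by exists k, i.
  by exists i => //; exists k.
apply: (hits_full nuP cM f_continuous sub_oball (U := \bigcup_i U i)).
- by apply: bigcup_open => i _.
- by move=> y [i _ Uy] k t; exists i => //; exact: (@aU i).
- move=> y; have [i Ui] := covU y.
  have := reach_positive nuP f_continuous sub_oball nu0 _ Ui.
  move=> /(_ (oU i))[k k0]; exists k; apply: (lt_le_trans k0).
  have mk W : open W -> measurable ([set t | W (rand_orbit f k y t)] : set (borel Delta)).
    move=> oW; apply: sub_sigma_algebra.
    apply: (open_section y (G := (fun p : M * Delta => rand_orbit f k p.1 p.2) @^-1` W)).
    by move: (@rand_orbit_continuous R M n f a eps f_continuous sub_oball k) => /continuousP; apply.
  apply: (le_measure nuinf (mem_set (mk _ (oU i))) (mem_set (mk _ _))).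
    by apply: bigcup_open => j _.
  by move=> t Ut; exists i.
Qed.

(* Up to a null set, a noise gained by V i when x moves to y is lost by another
   V j, so that it is enough to control the losses. *)
Lemma hits_near i x (e : R) : 0 < e ->
  \forall y \near x, (nuinf (V i x `+` V i y) < e%:E)%E.
Proof.
(* The [l] losses add up to [l * d], strictly below [e] also when [l = 0]. *)
move=> e0; pose d := e / l.+1%:R; have d0 : 0 < d by rewrite divr_gt0.
have mV j z : measurable (V j z : set (borel Delta)).
  by apply: sub_sigma_algebra; exact: (hits_open f_continuous sub_oball).
have : \forall y \near x, forall j, (nuinf (V j x `\` V j y) < d%:E)%E.
  apply: filter_forall => j.
  exact: (slice_lsc _ _ (hits_open_graph f_continuous sub_oball (oU j)) d0).
apply: filterS => y xy.
pose N : set (borel Delta) := ~` \bigcup_i V i x.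
have mN : measurable N.
  by apply: measurableC; apply: sub_sigma_algebra; apply: bigcup_open => j _;
    exact: (hits_open f_continuous sub_oball).
pose D : set (borel Delta) := \big[setU/set0]_(j < l) (V j x `\` V j y).
have mD : measurable D by apply: bigsetU_measurable => j _; exact: measurableD.
have sub : V i x `+` V i y `<=` N `|` D.
  have inD j t : V j x t -> ~ V j y t -> D t 
    by move=> Vx nVy; rewrite /D -bigcup_seq; exists j; rewrite //= mem_index_enum.
  move=> t [[]|[Vy nVx]]; first by right; exact: (inD i).
  have [[j _ Vj]|] := pselect ((\bigcup_i V i x) t); last by left.
  right; apply: (inD j) => // Vjy; have ij : i != j by apply/eqP => ij; rewrite -ij in Vj.
  have : (V i y `&` V j y) t by [].
  by rewrite hits_disjoint.
apply: (@le_lt_trans _ _ (nuinf (N `|` D))).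
  apply: (le_measure nuinf _ (mem_set (measurableU _ _ mN mD)) sub).
  by apply/mem_set/measurableU; exact: measurableD.
have N0 : nuinf N = 0%E := hits_cover x.
apply: (le_lt_trans (measureU2 nuinf mN mD)); rewrite [X in (X + _)%E]N0 add0e.
have : measurable D /\ (nuinf D <= (\sum_(j < l) d)%:E)%E.
  rewrite /D; elim/big_ind2: _ => [|A s B s' [mA As] [mB Bs']|j _].
  - by rewrite measure0.
  - split; first exact: measurableU.
    by rewrite EFinD (le_trans (measureU2 nuinf mA mB))// leeD.
  - by split; [exact: measurableD|exact: ltW].
case=> _ /le_lt_trans; apply; rewrite lte_fin sumr_const card_ord -[d *+ _]mulr_natr.
by rewrite /d -mulrA gtr_pMr// mulrC ltr_pdivrMr ?ltr0n// mul1r ltr_nat.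
Qed.

(* The basin of mu i consists of the points x for which V i x has full measure. *)
Lemma basin_measurable (mu : 'I_l -> probability (borel M) R) i :
  (forall i x, {ae nuinf, forall t, V i x t -> averages_to f (mu i) x t}) ->
  (forall j, i != j -> exists phi : M -> R, [/\ continuous phi,
     \int[mu i]_x phi x = 0 & \int[mu j]_x phi x = 1]) ->
  measurable (ergodic_basin f nuinf (mu i)).
Proof.
move=> avg sep.
have mV j x : measurable (V j x : set (borel Delta)).
  by apply: sub_sigma_algebra; exact: (hits_open f_continuous sub_oball).
(* Full probability is written as exceeding [1 - 1/(k+1)] for every [k], and each of these is an
   open condition on [x]. *)
have -> : ergodic_basin f nuinf (mu i) =
    \bigcap_k [set x | ((1 - k.+1%:R^-1)%:E < nuinf (V i x))%E].
  apply/seteqP; split=> x.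
    move=> mux k _.
    suff V1 : nuinf (V i x) = 1%E.
      by rewrite /= [X in (_ < X)%E]V1 lte_fin gtrBl invr_gt0 ltr0n.
    have N0 : nuinf (~` V i x) = 0%E.
      apply: measure_negligible; first exact: measurableC.
      have full : {ae nuinf, forall t, (\bigcup_j V j x) t}.
        apply/negligibleP; last exact: hits_cover.
        apply: measurableC; apply: sub_sigma_algebra.
        by apply: bigcup_open => j _; exact: (hits_open f_continuous sub_oball).
      have avgx : {ae nuinf, forall t, forall j, V j x t -> averages_to f (mu j) x t}.
        by apply: filter_forall => j; exact: avg.
      have : {ae nuinf, forall t, V i x t}.
        apply: (@filterS3 _ _ (ae_filter_ringOfSetsType nuinf) _ _ _ _ _ mux full avgx) => t mut [j _ Vj] avgt.
        (* The noise lies in some [V j]. If [j] differed from [i], the averages of the separating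
           function would tend to both 0 and 1. *)
        have [<-//|ij] := eqVneq j i.
        have [phi [cphi phi0 phi1]] := sep j ltac:(by rewrite eq_sym).
        have e01 : \int[mu i]_y phi y = \int[mu j]_y phi y.
          exact: (cvg_unique (@Rhausdorff R) (mut phi cphi) (avgt j Vj phi cphi)).
        by move: e01; rewrite phi0 phi1 => /esym/eqP; rewrite oner_eq0.
      by [].
    have := probability_setC nuinf (measurableC (mV i x)).
    by rewrite setCK [X in (_ - X)%E]N0 sube0.
  move=> Vx; have V1 : nuinf (V i x) = 1%E.
    apply/eqP; rewrite eq_le probability_le1//=.
    have finV : nuinf (V i x) \is a fin_num by exact: fin_num_measure.
    rewrite -(fineK finV) lee_fin leNgt; apply/negP => v1.
    have [k] := ltr_add_invr v1; have := Vx k I.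
    by rewrite /= -(fineK finV) lte_fin ltrBlDr => /lt_trans/[apply]; rewrite ltxx.
  have : {ae nuinf, forall t, V i x t}.
    apply/negligibleP; first exact: measurableC (mV i x).
    apply: etrans (probability_setC nuinf (mV i x)) _.
    by rewrite [X in (_ - X)%E]V1 subee.
  by apply: (@filterS2 _ _ (ae_filter_ringOfSetsType nuinf) _ _ _ _ (avg i x)) => t; apply.
apply: bigcap_measurable => [|k _]; [by exists 0%N|apply: open_borel].
exact: (slice_gt_open _ _ (hits_open_graph f_continuous sub_oball (oU i))).
Qed.

End Decomposition.

Lemma diffeo_open (R : realType) (M : topologicalType) d (X : manifold M d)
    (r : option nat) (h : M -> M) (U : set M) :
  @diffeo R r M d X h -> open U -> open (h @` U).
Proof.
move=> [k [hk kh _ [ck _]]] oU; suff -> : h @` U = k @^-1` U.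
  by move/continuousP: ck; apply.
apply/seteqP; split=> [_ [x Ux <-]|y Uy]; first by rewrite /preimage/= hk.
by exists (k y).
Qed.

Theorem theorem1 (R : realType) (M : pmetricType R) (d : nat)
  (X : manifold M d) (g : riemannian X) (m : probability (borel M) R)
  (n : nat) (f : M -> 'rV[R]_n -> M) (a : 'rV[R]_n) (eps : {posnum R})
  (nu : probability (borel (noise a eps)) R)
  (nuinf : probability (borel (noise_seq a eps)) R)
  (r : option nat) (K : nat) (xi0 : R) :
  compact [set: M] -> connected [set: M] ->
  is_riemannian_distance g -> is_normalized_volume g m ->
  (0 < n)%N ->
  C1_family X f ->
  (forall t, oball1 t -> diffeo (Some 1%N) X (fun x => f x t)) ->
  r != Some 0%N -> diffeo r X (fun x => f x a) ->
  cball a eps%:num `<=` @oball1 R n ->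
  is_normalized_lebesgue nu -> is_product_probability nu nuinf ->
  0 < xi0 ->
  (forall (k : nat) (x : M), (K <= k)%N ->
    ball (iter k (fun z => f z a) x) xi0
      `<=` [set rand_orbit f k x t | t in [set: noise_seq a eps]]) ->
  (forall (k : nat) (x : M), (K <= k)%N ->
    (pushforward nuinf (rand_orbit f k x : borel _ -> borel M)) `<< m) ->
  exists (l : nat) (mu : 'I_l -> probability (borel M) R),
  [/\ (forall i, physical f m nu nuinf (mu i) /\ mu i `<< m),
      (forall i j : 'I_l, (i < j)%N -> supp (mu i) `&` supp (mu j) = set0) &
      exists V : 'I_l -> M -> set (noise_seq a eps),
        (forall x : M,
          [/\ (forall i, open (V i x)),
              (forall i j : 'I_l, (i < j)%N -> V i x `&` V j x = set0),
              nuinf (~` (\bigcup_i V i x)) = 0%E &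
              (forall i,
                {ae nuinf, forall t, V i x t -> averages_to f (mu i) x t})]) /\
        (forall (i : 'I_l) (x : M) (e : R), 0 < e ->
          \forall y \near x, (nuinf (V i x `+` V i y) < e%:E)%E)].
Proof.
move=> cM _ _ _ _ [f_continuous _] f_diffeo _ _ sub_oball nuL nuP xi_gt0 hypA hypB.
have nu0 (V : set (noise a eps)) : open V -> V !=set0 -> (0 < nu V)%E.
  exact: noise_open_gt0.
have f_open (t : noise a eps) (U : set M) : open U -> open [set f x (set_val t) | x in U].
  apply: diffeo_open; apply: f_diffeo; apply: sub_oball.
  by apply: set_mem; exact: (valP t).
have orbit_null x (A : set (borel M)) : measurable A -> m A = 0%E ->
    nuinf [set t : borel (noise_seq a eps) | A (rand_orbit f K x t)] = 0%E.
  by move=> mA mA0; move/null_content_dominatesP: (hypB K x (leqnn K)); apply.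
have refl x : @reach R M n f a eps x x by exact: reach_refl.
have clos x y := @reach_closure R M n f a eps f_continuous sub_oball x y.
(* Assumption A) enters here, at time [K]: the unperturbed orbit supplies the center of a ball of
   reachable points. *)
have reach_ball x : exists z, ball z xi0 `<=` @reach R M n f a eps x.
  exists (iter K (fun z => f z a) x) => y /(hypA K x (leqnn K))[t _ <-].
  by exists K, t.
have [l [C [CE disjC minC covC]]] := minimal_family cM xi_gt0 refl clos reach_ball.
pose XX : nat -> borel M -> borel (noise_seq a eps) -> borel M := rand_orbit f.
have cC i : closed (C i) by have [x ->] := CE i; exact: closed_closure.
have aC i : absorbing XX (C i).
  by have [x ->] := CE i; exact: closure_reach_absorbing.
have intC i : (C i)° !=set0.
  have [x ->] := CE i; have [z zx] := reach_ball x; exists z.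
  apply: filterS (nbhsx_ballx z _ xi_gt0).
  by apply: subset_trans zx _; exact: subset_closure.
have C0 i : C i !=set0 by have [z /interior_subset] := intC i; exists z.
pose U i := (C i)°.
have oU i : open (U i) by exact: open_interior.
have aU i : absorbing XX (U i) by exact: interior_absorbing.
have disjU i j : i != j -> U i `&` U j = set0.
  move=> ij; apply/seteqP; split=> // z [/interior_subset Ci /interior_subset Cj].
  by rewrite -(disjC i j ij).
have covU x : exists i, (U i `&` closure (@reach R M n f a eps x)) !=set0.
  have [i Cix] := covC x; have [z Uz] := intC i.
  by exists i, z; split=> //; apply: Cix; exact: interior_subset.
have [mu muP] := choice (fun i => attractor_measure nuP nu0 cM f_continuous
  sub_oball orbit_null (cC i) (C0 i) (aC i) (@minC i)).
have muC i : mu i (C i) = 1%E by have [] := muP i.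
have avg i x : {ae nuinf, forall t, hits f (U i) x t -> averages_to f (mu i) x t}.
  have [_ _ _ /(_ x)] := muP i.
  apply: filterS; first exact: (ae_filter_ringOfSetsType nuinf).
  move=> t avgt /(hits_eventually (aU i))[k Uk]; apply: avgt.
  by exists k => j /Uk; exact: interior_subset.
have neq (i j : 'I_l) : (i < j)%N -> i != j.
  by move=> ij; rewrite -(inj_eq val_inj) neq_ltn ij.
exists l, mu; split.
- move=> i; have [muCi mum ergi avgi] := muP i; split=> //; split=> //.
  have mE : measurable (ergodic_basin f nuinf (mu i)).
    apply: (basin_measurable nuP nu0 cM f_continuous sub_oball oU aU covU avg) => j ij.
    exact: (separating_integral cM (cC i) (cC j) (disjC i j ij) (muC i) (muC j)).
  have mCi := closed_borel (cC i).
  (* The basin contains [C i], which is not [m]-null: [mu i] is absolutely continuous and gives it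
     mass 1. Measurability of the basin permits the comparison of [m]-masses. *)
  apply: (@lt_le_trans _ _ (m (C i))).
    rewrite lt0e measure_ge0 andbT; apply/eqP => mC0.
    have : (1 = 0 :> \bar R)%E.
      by rewrite -muCi; move/null_content_dominatesP: mum; apply.
    by move/eqP; rewrite onee_eq0.
  apply: (le_measure m (mem_set mCi) (mem_set mE)) => x Cx.
  move: (avgi x); apply: filterS; first exact: (ae_filter_ringOfSetsType nuinf).
  by move=> t; apply; exists 0%N => j _; exact: (aC i x Cx).
- move=> i j ij; apply/seteqP; split=> // x [si sj].
  have /seteqP[/(_ x) + _] := disjC i j (neq i j ij).
  by apply; split; exact: (supp_sub_closed (cC _) (muC _)).
- exists (fun i x => hits f (U i) x); split=> [x|i x e e0].
    split=> //.
    + by move=> i; exact: hits_open.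
    + by move=> i j ij; apply: (hits_disjoint aU disjU); exact: neq.
    + exact: (hits_cover nuP nu0 cM f_continuous sub_oball oU aU covU).
  exact: (hits_near nuP nu0 cM f_continuous sub_oball oU aU disjU covU).
Qed.
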